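(* Let $\Gamma\subset\mathbb{R}$ be a closed bounded set of Lebesgue measure zero, and let $A$ be a self-adjoint operator on $L_2(\mathbb{R})$ that describes a $\delta'$-interaction on $\Gamma$. Suppose that the negative spectrum of $A$ is discrete. Then the number of negative eigenvalues of $A$ (counted with multiplicity) is not less than the number of isolated points of $\Gamma$ at which the intensity of the $\delta'$-interaction is negative.
   Context: Let $\Gamma\subset\mathbb{R}$ be closed, bounded and of Lebesgue measure zero. The minimal operator $L_{\min,\Gamma}$ is the symmetric operator in $L_2(\mathbb{R})$ with domain $C_0^\infty(\mathbb{R}\setminus\Gamma)$ and action $L_{\min,\Gamma}\varphi=-\varphi''$. Let $A\supset L_{\min,\Gamma}$ be a self-adjoint extension, with domain $\mathfrak{D}(A)$. - $A$ defines a local interaction on $\Gamma$ if $u\in\mathfrak{D}(A)$ implies $\chi u\in\mathfrak{D}(A)$ for every $\chi\in C_0^\infty(\mathbb{R})$ such that $\chi'\in C_0^\infty(\mathbb{R}\setminus\Gamma)$. - $A$ admits splitting boundary conditions at $x_0\in\Gamma$ if, with respect to $L_2(\mathbb{R})=L_2(-\infty,x_0)\oplus L_2(x_0,+\infty)$, $A=A_1\oplus A_2$ with $A_1$ self-adjoint on $L_2(-\infty,x_0)$ and $A_2$ self-adjoint on $L_2(x_0,+\infty)$. - $A$ describes a $\delta'$-interaction on $\Gamma$ if it defines a local interaction on $\Gamma$, does not admit splitting boundary conditions at any point of $\Gamma$, and every $\chi\in C_0^\infty(\mathbb{R})$ with $\chi'\in C_0^\infty(\mathbb{R}\setminus\Gamma)$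 belongs to $\mathfrak{D}(A)$. If $A$ describes a $\delta'$-interaction on $\Gamma$ and $x_0$ is an isolated point of $\Gamma$, there is a real number $\beta$ such that every $\psi\in\mathfrak{D}(A)$ satisfies $$\psi'(x_0+0)=\psi'(x_0-0),\qquad \psi(x_0+0)-\psi(x_0-0)=\tfrac{\beta}{2}\,[\psi'(x_0+0)+\psi'(x_0-0)];$$ this number $\beta$ is called the intensity of the $\delta'$-interaction at $x_0$. The negative spectrum is discrete if $\sigma(A)\cap(-\infty,0)$ consists of isolated eigenvalues of finite multiplicity. *)

(* Defs.v *)
From HB Require Import structures.
From mathcomp Require Import all_boot all_order all_algebra.
From mathcomp Require Import complex.
From mathcomp Require Import all_classical all_reals all_analysis.

Set Implicit Arguments.
Unset Strict Implicit.
Unset Printing Implicit Defensive.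

Import Order.TTheory GRing.Theory Num.Theory.
Import numFieldNormedType.Exports.

Local Open Scope classical_set_scope.
Local Open Scope ring_scope.
Local Open Scope complex_scope.

(* There is no normed R-module structure on R[i], so measurability, integrals, *)
(* limits and derivatives of functions R -> R[i] are taken componentwise.      *)

Section HilbertSpace.
Context {R : realType}.
Implicit Types (m : {measure set (measurableTypeR R) -> \bar R}).
Implicit Types (u v : R -> R[i]) (A : set ((R -> R[i]) * (R -> R[i]))).

Definition reF u : R -> R := fun x => complex.Re (u x).
Definition imF u : R -> R := fun x => complex.Im (u x).

(* Elements of L2(m) are represented by functions; equality in L2(m) is       *)
(* [u = v %[ae m]], not Leibniz equality.                                     *)
Definition L2 m : set (R -> R[i]) :=
  [set u | reF u \in Lfun m 2%:E /\ imF u \in Lfun m 2%:E].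

Definition cintegral m u : R[i] :=
  (\int[m]_x reF u x) +i* (\int[m]_x imF u x).

Definition inner m u v : R[i] := cintegral m (fun x => u x * (v x)^*).

Definition norm2 m u : R := Num.sqrt (complex.Re (inner m u u)).

Definition dom A : set (R -> R[i]) := [set u | exists v, A (u, v)].

(* Operators are identified with their graphs, saturated under equality       *)
(* almost everywhere.                                                         *)
Definition operator m A : Prop :=
  [/\ A `<=` L2 m `*` L2 m,
      forall u u' v v', A (u, v) -> L2 m u' -> L2 m v' ->
        u' = u %[ae m] -> v' = v %[ae m] -> A (u', v'),
      forall u v v', A (u, v) -> A (u, v') -> v = v' %[ae m],
      A (fun=> 0, fun=> 0) &
      forall (a : R[i]) u u' v v', A (u, v) -> A (u', v') ->
        A (fun x => a * u x + u' x, fun x => a * v x + v' x)].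

Definition densely_defined m A : Prop :=
  forall u, L2 m u -> forall e : R, 0 < e ->
    exists2 w, dom A w & norm2 m (fun x => u x - w x) < e.

Definition adjoint m A : set ((R -> R[i]) * (R -> R[i])) :=
  [set p | [/\ L2 m p.1, L2 m p.2 &
    forall u v, A (u, v) -> inner m v p.1 = inner m u p.2]].

Definition self_adjoint m A : Prop :=
  [/\ operator m A, densely_defined m A & A = adjoint m A].

(* z belongs to the resolvent set when A - z is a bijection of dom A onto     *)
(* L2(m) with bounded inverse; injectivity is the case w = z u of the bound.  *)
Definition resolvent_set m A : set R[i] :=
  [set z |
    (forall f, L2 m f -> exists u w, A (u, w) /\
       (fun x => w x - z * u x) = f %[ae m]) /\
    (exists c : R, forall u w, A (u, w) ->
       norm2 m u <= c * norm2 m (fun x => w x - z * u x))].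

Definition spectrum m A : set R[i] := ~` resolvent_set m A.

Definition eigenfunction A (z : R[i]) u : Prop := A (u, fun x => z * u x).

Definition eigenvalue m A (z : R[i]) : Prop :=
  exists2 u, eigenfunction A z u & ~ (u = (fun=> 0) %[ae m]).

Definition lin_indep m n (e : 'I_n -> R -> R[i]) : Prop :=
  forall c : 'I_n -> R[i],
    (fun x => \sum_(i < n) c i * e i x) = (fun=> 0) %[ae m] ->
    forall i, c i = 0.

(* dim ker (A - z), +oo when infinite, 0 when z is not an eigenvalue *)
Definition multiplicity m A (z : R[i]) : \bar R :=
  ereal_sup [set (n%:R)%:E | n in [set n : nat |
    exists2 e : 'I_n -> R -> R[i],
      forall i, eigenfunction A z (e i) & lin_indep m e]].

Definition negative_spectrum_discrete m A : Prop :=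
  forall l : R, l < 0 -> spectrum m A l%:C ->
    [/\ eigenvalue m A l%:C,
        @isolated R[i]^o (spectrum m A) l%:C &
        (multiplicity m A l%:C < +oo)%E].

Definition nb_negative_eigenvalues m A : \bar R :=
  \esum_(l in [set l : R | l < 0]) multiplicity m A l%:C.

End HilbertSpace.

Section DeltaPrime.
Context {R : realType}.
Implicit Types (u : R -> R[i]) (A : set ((R -> R[i]) * (R -> R[i]))).
Implicit Types (Gamma : set R).

Local Notation mu := (@lebesgue_measure R).

Definition cderiv u : R -> R[i] := fun x => derive1 (reF u) x +i* derive1 (imF u) x.

Definition cderivable u (x : R) : Prop :=
  derivable (reF u) x 1 /\ derivable (imF u) x 1.

Definition smooth u : Prop := forall n x, cderivable (iter n cderiv u) x.

(* C_0^oo(O) for O open, with functions extended by 0 to the whole line *)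
Definition test_function (O : set R) : set (R -> R[i]) :=
  [set u | smooth u /\
    exists K : set R, [/\ compact K, K `<=` O & forall x, ~ K x -> u x = 0]].

Definition Lmin Gamma : set ((R -> R[i]) * (R -> R[i])) :=
  [set (phi, fun x => - cderiv (cderiv phi) x) |
    phi in test_function (~` Gamma)].

(* The chi in C_0^oo(R) whose derivative lies in C_0^oo(R \ Gamma). *)
Definition cutoff Gamma : set (R -> R[i]) :=
  [set chi | test_function setT chi /\
             test_function (~` Gamma) (cderiv chi)].

Definition local_interaction Gamma A : Prop :=
  forall u chi, dom A u -> cutoff Gamma chi -> dom A (fun x => chi x * u x).

(* An element of L2(a, b) is represented by a function on R considered up to  *)
(* equality almost everywhere on (a, b): a.e. equality for mu restricted to   *)
(* (a, b). With this encoding the graph of a direct sum is an intersection.   *)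
Definition splitting_at A (x0 : R) : Prop :=
  exists A1 A2 : set ((R -> R[i]) * (R -> R[i])),
    [/\ self_adjoint (mrestr mu (measurable_itv `]-oo, x0[)) A1,
        self_adjoint (mrestr mu (measurable_itv `]x0, +oo[)) A2 &
        A = A1 `&` A2].

Definition delta'_interaction Gamma A : Prop :=
  [/\ Lmin Gamma `<=` A,
      local_interaction Gamma A,
      forall x0, Gamma x0 -> ~ splitting_at A x0 &
      cutoff Gamma `<=` dom A].

Definition ccvg u (F : set_system R) (a : R[i]) : Prop :=
  reF u @ F --> complex.Re a /\ imF u @ F --> complex.Im a.

(* One-sided values of u and u' (F = x0^'+ or x0^'-), computed on the         *)
(* representative of the class of u that is differentiable near x0.           *)
Definition boundary_values u (F : set_system R) (a d : R[i]) : Prop :=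
  exists f : R -> R[i],
    [/\ f = u %[ae mu], \forall x \near F, cderivable f x,
        ccvg f F a & ccvg (cderiv f) F d].

Definition has_intensity A (x0 beta : R) : Prop :=
  forall u, dom A u -> exists up um dp dm : R[i],
    [/\ boundary_values u x0^'+ up dp, boundary_values u x0^'- um dm,
        dp = dm & up - um = (beta / 2)%:C * (dp + dm)].

Definition negative_intensity_points Gamma A : set R :=
  [set x0 | isolated Gamma x0 /\
            exists2 beta : R, has_intensity A x0 beta & beta < 0].

End DeltaPrime.

(* Main.v *)
Require Import Defs.
From HB Require Import structures.
From mathcomp Require Import all_boot all_order all_algebra.
From mathcomp Require Import complex ring lra.
From mathcomp Require Import all_classical all_reals all_analysis.
From mathcomp Require Import measurable_realfun.

(** Each isolated point [x_i] of [Gamma] whose intensity [beta_i] is negative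
carries a function [psi_i] of the domain of [A] with negative energy, and the
[psi_i] at [n] such points can be chosen so that the quadratic form of [A] is
negative on their whole span.  A self-adjoint operator with discrete negative
spectrum whose form is negative on an [n]-dimensional space has at least [n]
negative eigenvalues.  As this holds for every finite family of points, it also
settles the case of infinitely many of them.

The trial functions.  The boundary condition at [x_i] allows a jump [beta_i]
together with a common one-sided slope 1.  So [psi_i] is [beta_i] times a step
at [x_i], cut off by a plateau [eta] that is 1 on a large neighbourhood of
[Gamma], plus a compactly supported profile [kappa_i] of width [eps] that equals
[x - x_i] near [x_i] ([trial], [far_cutoff], [near_slope]).  In the matrix of the
form, integrating [- kappa_i''] against the step at [x_j] gives [kappa_i' (x_j)],
which is 1 if [i = j] and 0 otherwise; the pairings of the cutoffs with
themselves are O(1/L) and those of the profiles are O(eps), where [L] is the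
scale of [eta].  The matrix is thus as close as one likes to the diagonal matrix
of the [beta_i] ([entry_bound], [near_diagonal_form_le], [count_points]).

Why they lie in the domain ([trial_mem]).  The hypotheses put in the domain only
the functions whose derivative vanishes near [Gamma], and restrict the others by
the boundary condition.  Since [A] is its own adjoint, it suffices to check that
[<w, psi_i> = <v, - psi_i''>] for all [(v, w)] in [A].  This identity holds for
smooth functions [Psi_h] that coincide with [psi_i] outside a neighbourhood of
[x_i] of size [h] and are constant near [x_i]: they are in the domain by
hypothesis, and [A] acts on them as minus the second derivative because it is
symmetric on test functions supported off the null set [Gamma]
([cutoff_image]).  When [h] goes to 0, the contribution of the small
neighbourhood to [<v, Psi_h''>] tends to
[v(x_i + 0) - v(x_i - 0) - beta_i v'(x_i)], and this is 0 precisely by the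
boundary condition on [v] ([boundary_identity]).

From negative form to eigenvalues ([negative_form_bound]).  Suppose that
[k < n] orthogonal negative eigenfunctions are known.  Some combination [u] of
the [n] trial functions is orthogonal to them, with [<A u, u> < 0].  On the
orthogonal complement of the known eigenfunctions, if [A - t] were bounded below
for every negative [t], then for very negative [t] its lower bound would be
[|t|], the distance from [t] to 0 ([gap]), and expanding
[|(A - t) u| >= |t| |u|] gives [2 t <A u, u> <= |A u|^2]; letting [t] go to
minus infinity contradicts [<A u, u> < 0].  Hence the bound fails at some
negative [l], which is isolated from the other exceptional values, and a Cauchy
sequence of approximate eigenvectors converges to a new eigenvector
([isolated_kernel]).  The argument uses resolvents only, no spectral
measure. *)

Set Implicit Arguments.
Unset Strict Implicit.
Unset Printing Implicit Defensive.

Import Order.TTheory GRing.Theory Num.Theory.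
Import numFieldNormedType.Exports.

Local Open Scope classical_set_scope.
Local Open Scope ring_scope.

(** * Gaps and isolated points in the spectrum of a self-adjoint relation *)

Section AbstractSpectral.
Context {R : realType} {E : lmodType R}.

Record semi_inner (ip : E -> E -> R) : Prop := SemiInner {
  ip_sym : forall u v, ip u v = ip v u;
  ip_lin : forall a u v w, ip (a *: u + v) w = a * ip u w + ip v w;
  ip_ge0 : forall u, 0 <= ip u u }.

(** Completeness along sequences whose squared increments decay like
[16^-k]; this is the rate of the approximate eigenvectors at distances [4^-k]
from an isolated point, and it makes almost everywhere convergence in L2
immediate. *)
Definition geo_complete (ip : E -> E -> R) : Prop :=
  forall (w : nat -> E) (C : R),
    (forall k, ip (w k.+1 - w k) (w k.+1 - w k) <= C * (16^-1) ^+ k) ->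
    exists w0, ip (w k - w0) (w k - w0) @[k --> \oo] --> (0 : R).

(** Elements of L2 are represented by functions, so an operator is a relation
that only determines its values up to vectors of norm 0.  The field [rel_max]
says that the relation contains its adjoint. *)
Record self_adjoint_rel (ip : E -> E -> R) (A : E -> E -> Prop) : Prop :=
  SelfAdjointRel {
  rel_lin : forall (a : R) u v u' v', A u v -> A u' v' ->
    A (a *: u + u') (a *: v + v');
  rel_sym : forall u v u' v', A u v -> A u' v' -> ip v u' = ip u v';
  rel_max : forall u v, (forall x y, A x y -> ip y u = ip x v) -> A u v }.

Variables (ip : E -> E -> R) (ipP : semi_inner ip).
Local Notation N u := (ip u u).

Lemma ip0l w : ip 0 w = 0.
Proof.
have := ip_lin ipP 1 0 0 w; rewrite scaler0 addr0 mul1r => h.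
by apply: (addrI (ip 0 w)); rewrite addr0.
Qed.
Lemma ipDl u v w : ip (u + v) w = ip u w + ip v w.
Proof. by have := ip_lin ipP 1 u v w; rewrite scale1r mul1r. Qed.
Lemma ipZl a u w : ip (a *: u) w = a * ip u w.
Proof. by have := ip_lin ipP a u 0 w; rewrite addr0 ip0l addr0. Qed.
Lemma ipNl u w : ip (- u) w = - ip u w.
Proof. by rewrite -scaleN1r ipZl mulN1r. Qed.
Lemma ip0r w : ip w 0 = 0.
Proof. by rewrite (ip_sym ipP) ip0l. Qed.
Lemma ipDr u v w : ip w (u + v) = ip w u + ip w v.
Proof. by rewrite (ip_sym ipP) ipDl !(ip_sym ipP w). Qed.
Lemma ipZr a u w : ip w (a *: u) = a * ip w u.
Proof. by rewrite (ip_sym ipP) ipZl (ip_sym ipP w). Qed.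
Lemma ipNr u w : ip w (- u) = - ip w u.
Proof. by rewrite (ip_sym ipP) ipNl (ip_sym ipP w). Qed.
Definition ip_simp := (ipDl, ipDr, ipZl, ipZr, ipNl, ipNr, ip0l, ip0r).

(** The form may be degenerate, hence the separate case [N v = 0]: a nonzero
[ip u v] would make [N (u + a *: v)] negative for some [a]. *)
Lemma cauchy_schwarz u v : ip u v ^+ 2 <= N u * N v.
Proof.
have [v0|v0] := eqVneq (N v) 0.
  suff -> : ip u v = 0 by rewrite expr0n/= v0 mulr0.
  apply/eqP/negPn/negP => uv0.
  pose a := - ((N u + 1) / (2 * ip u v)).
  have := ip_ge0 ipP (u + a *: v).
  have -> : N (u + a *: v) = -1.
    by rewrite !ip_simp (ip_sym ipP v u) v0 /a; field.
  by rewrite ler0N1.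
have vp : 0 < N v by rewrite lt_def v0 ip_ge0.
have h : N (N v *: u - ip u v *: v) = N v * (N u * N v - ip u v ^+ 2).
  by rewrite !ip_simp (ip_sym ipP v u); ring.
by have := ip_ge0 ipP (N v *: u - ip u v *: v); rewrite h pmulr_rge0// subr_ge0.
Qed.

Lemma ipN0 u v : N v = 0 -> ip u v = 0.
Proof.
move=> v0; have := cauchy_schwarz u v; rewrite v0 mulr0 => h.
by apply/eqP; rewrite -sqrf_eq0 eq_le h sqr_ge0.
Qed.

Lemma sqnormD u v : N (u + v) <= 2 * N u + 2 * N v.
Proof.
have := ip_ge0 ipP (u - v); rewrite !ip_simp (ip_sym ipP v u) => h; lra.
Qed.

Lemma ip_cvg (w : nat -> E) w0 y :
  N (w k - w0) @[k --> \oo] --> (0 : R) -> ip y (w k) @[k --> \oo] --> ip y w0.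
Proof.
move=> cw; apply/cvgrPdist_lt => e e0.
pose M := N y + 1.
have M0 : 0 < M by rewrite ltr_wpDl ?ip_ge0.
have : \forall k \near \oo, N (w k - w0) < e ^+ 2 / M.
  move/cvgrPdist_lt : cw => /(_ (e ^+ 2 / M)).
  rewrite divr_gt0 ?exprn_gt0// => /(_ isT); apply: filterS => k.
  by rewrite sub0r normrN ger0_norm ?ip_ge0.
apply: filterS => k hk.
rewrite -ipNr -ipDr -(ltr_pXn2r (_ : (0 < 2)%N))// ?nnegrE ?ltW//.
rewrite -normrX ger0_norm ?sqr_ge0//.
have := cauchy_schwarz y (w k - w0).
have -> : w0 - w k = - (w k - w0) by rewrite opprB.
rewrite ipNr sqrrN => /le_lt_trans; apply.
rewrite ltr_pdivlMr// in hk.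
apply: le_lt_trans hk; rewrite mulrC ler_wpM2l ?ip_ge0// /M.
by rewrite lerDl.
Qed.

Variables (A : E -> E -> Prop) (AP : self_adjoint_rel ip A).

Definition orthogonal_to (S : set E) : set E :=
  [set u | forall e, S e -> ip u e = 0].

(** [onto], [below] and [regular] concern the part of [A - t] in a subspace;
[regular] says without inverses that [t] is in its resolvent set.  The constants
in [below] compare squared norms. *)
Definition onto (H : set E) (t : R) : Prop :=
  forall f, H f -> exists2 u, H u & A u (f + t *: u).

Definition below (H : set E) (t c : R) : Prop :=
  forall u v, H u -> A u v -> c * N u <= N (v - t *: u).

Definition regular H t := onto H t /\ exists2 c, 0 < c & below H t c.

Lemma rel0 : A 0 0.
Proof. by apply: (rel_max AP) => x y _; rewrite !ip0r. Qed.

Lemma rel_scale a u v : A u v -> A (a *: u) (a *: v).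
Proof. by move=> h; have := rel_lin AP a h rel0; rewrite !addr0. Qed.

Lemma rel_add u v u' v' : A u v -> A u' v' -> A (u + u') (v + v').
Proof. by move=> h h'; have := rel_lin AP 1 h h'; rewrite !scale1r. Qed.

Lemma rel_sub u v u' v' : A u v -> A u' v' -> A (u - u') (v - v').
Proof.
move=> h h'; have := rel_lin AP (-1) h' h.
by rewrite !scaleN1r addrC [- v' + v]addrC.
Qed.

Section InvariantSubspace.
Variable S : set E.
Hypothesis S_eigen : forall e, S e -> exists l : R, A e (l *: e).
Local Notation H := (orthogonal_to S).

Lemma orthD u v : H u -> H v -> H (u + v).
Proof. by move=> hu hv e Se; rewrite ipDl hu// hv// addr0. Qed.

Lemma orthZ a u : H u -> H (a *: u).
Proof. by move=> hu e Se; rewrite ipZl hu// mulr0. Qed.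

Lemma orthB u v : H u -> H v -> H (u - v).
Proof. by move=> hu hv e Se; rewrite ipDl ipNl hu// hv// subr0. Qed.

Lemma orth_cvg (w : nat -> E) w0 : (forall k, H (w k)) ->
  N (w k - w0) @[k --> \oo] --> (0 : R) -> H w0.
Proof.
move=> hw cw e Se; rewrite (ip_sym ipP).
have := ip_cvg (y := e) cw.
under eq_fun => k do rewrite (ip_sym ipP) hw//.
by move=> h; have := cvg_unique _ h (cvg_cst 0); apply; exact: norm_hausdorff.
Qed.

(** For [f] orthogonal to an eigenvector [e] with value [l], a solution [u] of
[(A - t) u = f] satisfies [(t - l) <u, e> = 0] by symmetry.  If [t = l], the lower
bound at [t] makes [e] itself a null vector. *)
Lemma regular_orth t : regular setT t -> regular H t.
Proof.
move=> [Ho [c c0 Hb]]; split; last first.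
  by exists c => // u v _; exact: Hb.
move=> f Hf; have [u _ Au] := Ho f I.
exists u => // e Se.
have [l Ae] := S_eigen Se.
have := rel_sym AP Au Ae.
rewrite ipDl Hf// add0r ipZl ipZr.
have [tl _|tl] := eqVneq t l.
  apply: ipN0; have := Hb e _ I Ae; rewrite tl subrr ip0r => h.
  by apply/eqP; rewrite eq_le ip_ge0// andbT -(pmulr_rle0 _ c0).
  move=> h; have {}h : (t - l) * ip u e = 0 by rewrite mulrBl h subrr.
  by apply/eqP; move/eqP : h; rewrite mulf_eq0 subr_eq0 (negPf tl).
Qed.

(** For [x = (A - t) u] and [g = (A - t) x], the bounds at [t - d] and
[t + d] chained along [(A - t)^2 - d^2 = (A - t - d) (A - t + d)] give
[c^2 |u|^2 + d^2 |x|^2 <= |g|^2], where [|x|^2 = <g, u>].  Either [|g|] is at least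
[2 d |x|], or Cauchy-Schwarz bounds [|u|^2] below by [|x|^2 / (4 d^2)], and then the
first term strictly improves the constant [d^2]. *)
Lemma gap_step t d c : onto H t -> 0 < d -> below H t (d ^+ 2) -> 0 < c ->
  below H (t - d) c -> below H (t + d) c ->
  exists2 d', d < d' & below H t (d' ^+ 2).
Proof.
move=> Ht d0 Hd c0 Hm Hp.
pose q := Num.min (4 * d ^+ 2) (d ^+ 2 + c ^+ 2 / (4 * d ^+ 2)).
have d20 : 0 < d ^+ 2 by rewrite exprn_gt0.
have qd : d ^+ 2 < q.
  rewrite lt_min; apply/andP; split; first by lra.
  by rewrite ltrDl divr_gt0 ?exprn_gt0// mulr_gt0.
have q0 : 0 <= q by apply: ltW; apply: lt_trans qd.
exists (Num.sqrt q).
  by rewrite -(ltr_pXn2r (_ : (0 < 2)%N))// ?nnegrE ?sqrtr_ge0 ?ltW// sqr_sqrtr.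
move=> x g' Hx Axg'; rewrite sqr_sqrtr//.
set g := g' - t *: x.
have [u Hu Au] := Ht x Hx.
set X := N g; set Y := N x; set Z := N u.
have e1 : ip g u = Y.
  rewrite /g ipDl ipNl ipZl (rel_sym AP Axg' Au) ipDr ipZr /Y.
  by rewrite addrK.
have e2 : d ^+ 2 * Z <= Y.
  by have := Hd _ _ Hu Au; rewrite addrK.
have e3 : c * Z <= N (x + d *: u).
  have := Hm _ _ Hu Au; congr (_ <= _).
  by rewrite !ip_simp (ip_sym ipP u x); ring.
have e4 : c * N (x + d *: u) <= X - 2 * d ^+ 2 * Y + d ^+ 4 * Z.
  have := Hp _ _ (orthD Hx (orthZ d Hu)) (rel_add Axg' (rel_scale d Au)).
  congr (_ <= _).
  have e0 : ip g' u = Y + t * ip x u by rewrite -e1 /g !ip_simp; ring.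
  rewrite /X /g /Y /Z !ip_simp (ip_sym ipP u g') (ip_sym ipP u x) (ip_sym ipP x g').
  by rewrite e0 /Y; ring.
have X0 : 0 <= X by exact: ip_ge0.
have Y0 : 0 <= Y by exact: ip_ge0.
have Z0 : 0 <= Z by exact: ip_ge0.
have e6 : c ^+ 2 * Z + d ^+ 2 * Y <= X.
  have h1 : c * (c * Z) <= c * N (x + d *: u) by rewrite ler_pM2l.
  have h2 : d ^+ 2 * (d ^+ 2 * Z) <= d ^+ 2 * Y by rewrite ler_pM2l.
  have : c * (c * Z) <= X - 2 * d ^+ 2 * Y + d ^+ 4 * Z.
    exact: le_trans h1 e4.
  by move: h2; rewrite [d ^+ 4](exprD _ 2 2); lra.
have e7 : Y ^+ 2 <= X * Z by rewrite -e1; exact: cauchy_schwarz.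
have [Xd|Xd] := leP (4 * d ^+ 2 * Y) X.
  by apply: le_trans Xd; rewrite ler_wpM2r// /q ge_min lexx.
have Yp : 0 < Y.
  rewrite lt_def Y0 andbT; apply/eqP => Ye.
  by move: Xd; rewrite Ye mulr0 ltNge X0.
have e8 : Y <= 4 * d ^+ 2 * Z.
  rewrite -(ler_pM2l Yp) -expr2; apply: le_trans e7 _.
  by rewrite mulrA (mulrC Y) ler_wpM2r// ltW.
apply: le_trans e6; apply: le_trans
   (_ : (d ^+ 2 + c ^+ 2 / (4 * d ^+ 2)) * Y <= _).
  by rewrite ler_wpM2r// /q ge_min lexx orbT.
rewrite mulrDl addrC lerD2r mulrAC -mulrA ler_pM2l ?exprn_gt0//.
by rewrite ler_pdivrMr ?mulr_gt0// mulrC.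
Qed.

(** The norm of a self-adjoint resolvent is the inverse of the distance to the
spectrum.  In the form used here: the supremum of the radii [d] for which [d^2]
is a lower bound is attained, so by [gap_step] it is not less than [r]. *)
Lemma gap t r c0 : onto H t -> 0 < r -> 0 < c0 -> below H t c0 ->
  (forall d, 0 < d < r ->
    exists2 c, 0 < c & below H (t - d) c /\ below H (t + d) c) ->
  below H t (r ^+ 2).
Proof.
move=> Ht r0 c00 Hc0 Hpm.
pose D := [set d | 0 <= d <= r /\ below H t (d ^+ 2)].
pose d0 := Num.min r (Num.min 1 c0).
have d00 : 0 < d0 by rewrite !lt_min r0 ltr01.
have Dd0 : D d0.
  split; first by rewrite ltW// ge_min lexx.
  move=> u v Hu Auv; apply: le_trans (Hc0 _ _ Hu Auv).
  rewrite ler_wpM2r ?ip_ge0//.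
  have h1 : d0 <= 1 by rewrite !ge_min lexx orbT.
  have h2 : d0 <= c0 by rewrite !ge_min lexx !orbT.
  by apply: le_trans h2; rewrite expr2 ger_pMr.
have supD : has_sup D.
  by split; [exists d0|exists r => d [/andP[]]].
pose s := sup D.
have sd0 : d0 <= s by apply: ub_le_sup => //; case: supD.
have s0 : 0 < s by apply: lt_le_trans d00 sd0.
have sr : s <= r by apply: ge_sup; [exists d0|move=> d [/andP[]]].
have Ds : below H t (s ^+ 2).
  move=> u v Hu Auv.
  have [u0|u0] := eqVneq (N u) 0; first by rewrite u0 mulr0 ip_ge0.
  have up : 0 < N u by rewrite lt_def u0 ip_ge0.
  rewrite -ler_pdivlMr//.
  have q0 : 0 <= N (v - t *: u) / N u by rewrite divr_ge0// ip_ge0.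
  rewrite -[leRHS]sqr_sqrtr// ler_pXn2r ?nnegrE ?sqrtr_ge0 ?(ltW s0)//.
  apply: ge_sup; first by exists d0.
  move=> d [/andP[d_ge0 _] Hd].
  rewrite -(ler_pXn2r (_ : (0 < 2)%N))// ?nnegrE ?sqrtr_ge0// sqr_sqrtr//.
  by rewrite ler_pdivlMr//; exact: Hd.
suff -> : r = s by [].
apply/eqP; rewrite eq_le sr andbT leNgt; apply/negP => ltsr.
have [c cp [Hm Hp]] := Hpm s (introT andP (conj s0 ltsr)).
have [d' sd' Hd'] := gap_step Ht s0 Ds cp Hm Hp.
suff /ub_le_sup : D (Num.min d' r).
  move=> /(_ (proj2 supD)); rewrite -/s leNgt => /negP; apply.
  by rewrite lt_min sd'.
have m0 : 0 < Num.min d' r by rewrite lt_min (lt_trans s0 sd').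
split; first by rewrite ltW//= ge_min lexx orbT.
move=> u v Hu Auv; apply: le_trans (Hd' _ _ Hu Auv).
rewrite ler_wpM2r ?ip_ge0//.
rewrite ler_pXn2r ?nnegrE ?(ltW m0) ?(ltW (lt_trans s0 sd'))//.
by rewrite ge_min lexx.
Qed.

Lemma gap_regular t r : 0 < r -> regular H t ->
  (forall d, 0 < d < r -> regular H (t - d) /\ regular H (t + d)) ->
  below H t (r ^+ 2).
Proof.
move=> r0 [Ht [c0 c00 Hc]] Hr; apply: (gap Ht r0 c00 Hc) => d dr.
have [[_ [c1 c10 H1]] [_ [c2 c20 H2]]] := Hr d dr.
exists (Num.min c1 c2); first by rewrite lt_min c10.
split=> u v Hu Auv.
- apply: le_trans (H1 _ _ Hu Auv).
  by rewrite ler_wpM2r ?ip_ge0// ge_min lexx.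
- apply: le_trans (H2 _ _ Hu Auv).
  by rewrite ler_wpM2r ?ip_ge0// ge_min lexx orbT.
Qed.

Section IsolatedPoint.
Variables (l rho : R).
Hypothesis rho0 : 0 < rho.
Hypothesis Hreg : forall t, 0 < `|t - l| < rho -> regular H t.
Let dl := rho / 4.
Let dl0 : 0 < dl. Proof. by rewrite divr_gt0. Qed.

(* On a punctured neighbourhood of l the lower bound is the distance to l. At
   l itself this gives a bound on the form, hence a lower bound for A - l on the
   range of A - l. *)
Let near_below s : s != 0 -> `|s| <= dl -> below H (l + s) (s ^+ 2).
Proof.
move=> s0 sdl; rewrite -[s ^+ 2]ger0_norm ?sqr_ge0// normrX.
have s0' : 0 < `|s| by rewrite normr_gt0.
have lt_s : `|s| < rho by move: sdl; rewrite /dl; lra.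
apply: gap_regular => //.
  by apply: Hreg; rewrite addrAC subrr add0r s0'.
move=> d /andP[d0 ds].
have H1 e : `|e| = d -> regular H (l + s + e).
  move=> ed; apply: Hreg; have -> : l + s + e - l = s + e by ring.
  apply/andP; split.
    rewrite normr_gt0; apply/eqP => /eqP; rewrite addr_eq0 => /eqP se.
    by move: ds; rewrite se normrN ed ltxx.
  apply: le_lt_trans (ler_normD _ _) _; rewrite ed.
  by move: sdl; rewrite /dl; lra.
by split; apply: H1; rewrite ?normrN gtr0_norm.
Qed.

Let form_bound u1 v1 u2 v2 : H u1 -> H u2 -> A u1 v1 -> A u2 v2 ->
  ip (v1 - l *: u1) u2 <=
  (N (v1 - l *: u1) + N (v2 - l *: u2)) / (4 * dl).
Proof.
move=> Hu1 Hu2 A1 A2.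
have q u v (sg : R) : sg ^+ 2 = 1 -> H u -> A u v ->
    2 * dl * sg * ip (v - l *: u) u <= N (v - l *: u).
  move=> sg1 Hu Auv.
  have sg0 : sg * dl != 0.
    rewrite mulf_neq0 ?(gt_eqF dl0)//; apply/eqP => sge; move/eqP: sg1.
    by rewrite sge expr0n/= eq_sym oner_eq0.
  have sgn : `|sg * dl| <= dl.
    have dln : `|dl| = dl by apply: gtr0_norm.
    by rewrite normrM dln -sqrtr_sqr sg1 sqrtr1 mul1r.
  have := near_below sg0 sgn Hu Auv.
  rewrite exprMn sg1 mul1r.
  have -> : N (v - (l + sg * dl) *: u) =
      N (v - l *: u) - 2 * dl * sg * ip (v - l *: u) u + sg ^+ 2 * dl ^+ 2 * N u.
    by rewrite !ip_simp (ip_sym ipP u v); ring.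
  by rewrite sg1; lra.
have q1 := q _ _ 1 (expr1n _ _) (orthD Hu1 Hu2) (rel_add A1 A2).
have sN : (-1 : R) ^+ 2 = 1 by rewrite sqrrN expr1n.
have q2 := q _ _ (-1) sN (orthB Hu1 Hu2) (rel_sub A1 A2).
rewrite ler_pdivlMr ?mulr_gt0//.
have e1 : ip v1 u2 = ip u1 v2 by rewrite (rel_sym AP A1 A2).
move: q1 q2; rewrite !ip_simp (ip_sym ipP v2 u1) (ip_sym ipP u2 u1) (ip_sym ipP u2 v1) (ip_sym ipP v2 v1) -e1.
move=> q1 q2; lra.
Qed.

(* Applied to 2 dl g and v, form_bound balances its two terms: the first one
   becomes exactly half of the left-hand side. *)
Let range_bound g v v' : H g -> H v -> A g (v + l *: g) -> A v v' ->
  4 * dl ^+ 2 * N v <= N (v' - l *: v).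
Proof.
move=> Hg Hv Ag Av.
have := form_bound (orthZ (2 * dl) Hg) Hv (rel_scale (2 * dl) Ag) Av.
have -> : ip ((2 * dl) *: (v + l *: g) - l *: ((2 * dl) *: g)) v = 2 * dl * N v.
  by rewrite !ip_simp; ring.
have -> : N ((2 * dl) *: (v + l *: g) - l *: ((2 * dl) *: g)) =
    4 * dl ^+ 2 * N v by rewrite !ip_simp (ip_sym ipP g v); ring.
rewrite ler_pdivlMr ?mulr_gt0//.
set n' := N (_ - _) => h.
have -> : 4 * dl ^+ 2 * N v = 2 * dl * N v * (4 * dl) - 4 * dl ^+ 2 * N v by ring.
by rewrite lerBlDl.
Qed.

(* For h with (A - l - e) h = u, put x = u + e h = (A - l) h and w = - e h = u - x.
   Then (A - l) w = - e x, and x is small by range_bound: w is an approximate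
   eigenvector of precision e that stays close to u. *)
Let improve u v e : H u -> A u v -> 0 < e <= dl ->
  exists w w' h, [/\ H w, A w w', H h /\ A h (u - w + l *: h),
    N (w' - l *: w) <= e ^+ 2 * (N (v - l *: u) / dl ^+ 2) &
    N (u - w) <= N (v - l *: u) / dl ^+ 2].
Proof.
move=> Hu Au /andP[e0 edl].
have [] := Hreg (t := l + e).
  by rewrite addrAC subrr add0r gtr0_norm// e0/=; move: edl; rewrite /dl; lra.
move=> /(_ u Hu)[h Hh Ah] _.
have Ax : A h (u + e *: h + l *: h).
  by rewrite -addrA -scalerDl (addrC e).
have [x xE] : exists x, u + e *: h = x by exists (u + e *: h).
have Hx : H x by rewrite -xE; apply: orthD => //; exact: orthZ.
have Ax' := rel_add Au (rel_scale e Ax); rewrite xE in Ax Ax'.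
have b1 := range_bound Hh Hx Ax Ax'.
have b2 : N (v + e *: (x + l *: h) - l *: x) <=
    2 * N (v - l *: u) + 2 * (e ^+ 2 * N x).
  have -> : v + e *: (x + l *: h) - l *: x = (v - l *: u) + e *: x.
    have -> : l *: x = l *: u + e *: (l *: h).
      by rewrite -xE scalerDr !scalerA mulrC.
    by rewrite scalerDr opprD addrACA addrK.
  by apply: le_trans (sqnormD _ _) _; rewrite ipZl ipZr mulrA -expr2.
have b3 : N x <= N (v - l *: u) / dl ^+ 2.
  rewrite ler_pdivlMr ?exprn_gt0// mulrC.
  have : e ^+ 2 * N x <= dl ^+ 2 * N x.
    by rewrite ler_wpM2r ?ip_ge0// ler_pXn2r// nnegrE ltW.
  by move: (le_trans b1 b2); lra.
exists (- (e *: h)); exists (- (e *: (x + l *: h))); exists h.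
rewrite !opprK xE; split => //.
- by rewrite -scaleNr; exact: orthZ.
- by rewrite -!scaleNr; exact: rel_scale.
have -> : N (- (e *: (x + l *: h)) - l *: - (e *: h)) = e ^+ 2 * N x.
  by rewrite !ip_simp (ip_sym ipP h x); ring.
by rewrite ler_pM2l ?exprn_gt0.
Qed.

(** Vectors [w_k] with [|(A - l) w_k|] of order [4^-k] are built by solving
[(A - l - e_k) h_k = u].  Differences of the [w_k] lie in the range of [A - l], where
[range_bound] turns smallness of [(A - l) (w_k - w_j)] into smallness of
[w_k - w_j]; so the [w_k] converge.  The limit is not null because all of them
stay close to a fixed [u] on which [A - l] is small. *)
Lemma isolated_kernel : geo_complete ip ->
  (forall c, 0 < c -> ~ below H l c) ->
  exists w, [/\ H w, A w (l *: w) & 0 < N w].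
Proof.
move=> comp nb.
(* The factor 16 leaves |u - w_k| <= |u| / 4, so the limit is not null. *)
have c0 : 0 < dl ^+ 2 / 16 by rewrite divr_gt0 ?exprn_gt0.
have [u [v [Hu Au uv]]] : exists u v, [/\ H u, A u v &
    N (v - l *: u) < dl ^+ 2 / 16 * N u].
  apply: contrapT => h; apply: (nb _ c0) => u v Hu Au.
  by rewrite leNgt; apply/negP => uv; apply: h; exists u, v.
set q := N (v - l *: u) / dl ^+ 2.
have q0 : 0 <= q by rewrite divr_ge0 ?ip_ge0 ?sqr_ge0.
have qu : 16 * q < N u.
  have d2 : 0 < dl ^+ 2 by rewrite exprn_gt0.
  have qE : N (v - l *: u) = q * dl ^+ 2 by rewrite /q divfK// gt_eqF.
  by rewrite -(ltr_pM2r d2); move: uv; rewrite qE; lra.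
pose e k : R := dl * (4^-1) ^+ k.
have e0 k : 0 < e k <= dl.
  rewrite mulr_gt0 ?exprn_gt0//= ger_pMr// exprn_ile1// invf_le1//.
  by rewrite ler1n.
have /choice[W PW] k : exists W : E * E * E,
    [/\ H W.1.1, A W.1.1 W.1.2, H W.2 /\ A W.2 (u - W.1.1 + l *: W.2),
    N (W.1.2 - l *: W.1.1) <= e k ^+ 2 * q & N (u - W.1.1) <= q].
  by have [w [w' [h P]]] := improve Hu Au (e0 k); exists (w, w', h).
pose w k := (W k).1.1; pose w' k := (W k).1.2; pose h k := (W k).2.
have ek k : e k ^+ 2 = dl ^+ 2 * 16^-1 ^+ k.
  rewrite /e exprMn -!exprM mulnC exprM; congr (_ * _ ^+ _).
  by rewrite exprVn -natrX.
have [w0 cw] : exists w0, N (w k - w0) @[k --> \oo] --> (0 : R).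
  apply: (comp w q) => k.
  have [Hw1 A1 [Hh1 Ah1] n1 _] := PW k.
  have [Hw2 A2 [Hh2 Ah2] n2 _] := PW k.+1.
  rewrite -/(w k) -/(w' k) -/(h k) in Hw1 A1 Hh1 Ah1 n1.
  rewrite -/(w k.+1) -/(w' k.+1) -/(h k.+1) in Hw2 A2 Hh2 Ah2 n2.
  have Ah : A (h k - h k.+1) ((w k.+1 - w k) + l *: (h k - h k.+1)).
    have := rel_sub Ah1 Ah2; congr A.
    rewrite scalerBr opprD addrACA; congr (_ + _).
    by rewrite opprB addrC addrA subrK.
  have := range_bound (orthB Hh1 Hh2) (orthB Hw2 Hw1) Ah (rel_sub A2 A1).
  have -> : w' k.+1 - w' k - l *: (w k.+1 - w k) =
      (w' k.+1 - l *: w k.+1) + (- 1 *: (w' k - l *: w k)).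
    rewrite scaleN1r scalerBr !opprB addrACA [RHS]addrC [RHS]addrACA.
    by congr (_ + _); exact: addrC.
  move=> /le_trans/(_ (sqnormD _ _)).
  rewrite ipZl ipZr mulN1r mulN1r opprK => h3.
  rewrite ek in n1; rewrite ek in n2.
  have : 4 * dl ^+ 2 * N (w k.+1 - w k) <= 4 * dl ^+ 2 * (q * 16^-1 ^+ k).
    apply: le_trans h3 _.
    have : dl ^+ 2 * 16^-1 ^+ k.+1 * q <= dl ^+ 2 * 16^-1 ^+ k * q.
      by rewrite ler_wpM2r// ler_wpM2l ?sqr_ge0// exprS ger_pMl ?exprn_gt0// invf_le1 ?ler1n.
    by move: n1 n2; lra.
  by rewrite ler_pM2l// mulr_gt0 ?exprn_gt0.
exists w0; split.
- by apply: orth_cvg cw => k; have [] := PW k.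
- apply: (rel_max AP) => x y Axy.
  have cy := ip_cvg (y := y - l *: x) cw.
  suff : ip (y - l *: x) w0 = 0.
    by rewrite ipDl ipNl ipZl ipZr => /eqP; rewrite subr_eq0 => /eqP.
  apply: (cvg_unique (@norm_hausdorff _ _) cy).
  have cz : N (w' k - l *: w k - 0) @[k --> \oo] --> (0 : R).
    apply: (@squeeze_cvgr _ _ _ _ (cst 0) (fun k => dl ^+ 2 * q * 16^-1 ^+ k)).
    - apply: nearW => k /=; rewrite subr0 (ip_ge0 ipP)/=.
      by have [_ _ _ n1 _] := PW k; rewrite ek mulrAC in n1.
    - exact: cvg_cst.
    - rewrite -[0 in X in _ --> X](mulr0 (dl ^+ 2 * q)); apply: cvgMl_tmp.
      by apply: cvg_expr; rewrite ger0_norm// invf_lt1// ltr1n.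
  have := ip_cvg (y := x) cz; rewrite ip0r; apply: cvg_trans.
  apply: near_eq_cvg; apply: nearW => k; have [_ Aw _ _ _] := PW k.
  by rewrite !ip_simp (rel_sym AP Axy Aw).
- rewrite lt_def (ip_ge0 ipP) andbT; apply/eqP => w00.
  have uq : 0 < (N u - 2 * q) / 4 by move: qu q0; lra.
  have /cvgrPdist_lt/(_ _ uq)[k _ /(_ k (leqnn k))] := cw.
  rewrite /= sub0r normrN ger0_norm ?ip_ge0// => hk.
  have [_ _ _ _ n1] := PW k; rewrite -/(w k) in n1.
  have := sqnormD (u - w k) (w k - w0 + w0).
  have := sqnormD (w k - w0) w0.
  rewrite !subrK w00; move: n1 hk; lra.
Qed.

End IsolatedPoint.

(** If no negative [l] gave a new eigenvector, [A - t] would be bounded below on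
the complement for every negative [t]: off [L] by hypothesis, on [L] by
[isolated_kernel].  Then [gap] applies with [r = - t]. *)
Lemma new_eigenvector (L : seq R) u v :
  geo_complete ip ->
  (forall t : R, t < 0 -> t \notin L -> regular setT t) ->
  H u -> A u v -> ip v u < 0 ->
  exists l w, [/\ l \in L, l < 0, H w, A w (l *: w) & 0 < N w].
Proof.
move=> comp LP Hu Au uv; apply: contrapT => noev.
have reg0 (t : R) : t < 0 -> t \notin L -> regular H t.
  by move=> t0 tL; apply: regular_orth; exact: LP.
have bel (t : R) : t < 0 -> exists2 c, 0 < c & below H t c.
  move=> t0; have [tL|tL] := boolP (t \in L); last first.
    by have [_ ex] := reg0 t t0 tL; exact: ex.
  apply: contrapT => nc; apply: noev; exists t.
  have [rho rho0 Hrho] : exists2 rho, 0 < rho &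
      forall s, 0 < `|s - t| < rho -> s < 0 /\ s \notin L.
    (* The least distance from t to 0 and to the other members of L. *)
    pose m := \big[Num.min/ - t]_(s <- L | s != t) `|s - t|.
    have m0 : 0 < m.
      rewrite /m; elim/big_ind : _ => //; first by rewrite oppr_gt0.
        by move=> a b a0 b0; rewrite lt_min a0.
      by move=> s st; rewrite normr_gt0 subr_eq0.
    exists m => // s /andP[s0 sm]; split.
      have : `|s - t| < - t.
        by apply: lt_le_trans sm _; exact: bigmin_le_id.
      by move/(le_lt_trans (ler_norm _)); rewrite ltrBlDr addrC subrr.
    apply/negP => sL; move: sm; rewrite ltNge => /negP; apply.
    apply: ge_bigmin_seq => //.
    by move: s0; rewrite normr_gt0 subr_eq0.
  have [w [Hw Aw w0]] : exists w, [/\ H w, A w (t *: w) & 0 < N w].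
    apply: (isolated_kernel rho0) => //.
    - by move=> s /Hrho[s0 sL]; exact: reg0.
    - by move=> c c0 Hc; apply: nc; exists c.
  by exists w.
have key (t : R) : t < 0 -> t \notin L -> 2 * t * ip v u <= N v.
  move=> t0 tL; have [Ht [c c0 Hc]] := reg0 t t0 tL.
  have nt : 0 < - t by rewrite oppr_gt0.
  have := gap Ht nt c0 Hc.
  have hpm d : 0 < d < - t -> exists2 c, 0 < c & below H (t - d) c /\ below H (t + d) c.
    move=> /andP[d0 dt].
    have [c1 c10 H1] : exists2 c, 0 < c & below H (t - d) c by apply: bel; lra.
    have [c2 c20 H2] : exists2 c, 0 < c & below H (t + d) c by apply: bel; lra.
    exists (Num.min c1 c2); first by rewrite lt_min c10.
    split=> u' v' Hu' Au'.
    - by apply: le_trans (H1 _ _ Hu' Au'); rewrite ler_wpM2r ?(ip_ge0 ipP)// ge_min lexx.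
    - apply: le_trans (H2 _ _ Hu' Au').
      by rewrite ler_wpM2r ?(ip_ge0 ipP)// ge_min lexx orbT.
  move=> /(_ hpm _ _ Hu Au); rewrite !ip_simp (ip_sym ipP u v) sqrrN; lra.
(* t is below L, and so low that 2 t <v, u> exceeds N v. *)
pose t1 := \big[Num.min/ -1]_(s <- L) (s - 1).
have t1L s : s \in L -> t1 <= s - 1 by move=> sL; exact: ge_bigmin_seq.
have t10 : t1 <= -1 by exact: bigmin_le_id.
pose t := Num.min t1 ((N v + 1) / (2 * ip v u)).
have tt1 : t <= t1 by rewrite ge_min lexx.
have t0 : t < 0 by apply: le_lt_trans tt1 _; lra.
have tL : t \notin L.
  by apply/negP => /t1L; move: tt1; lra.
have := key t t0 tL.
rewrite mulrAC leNgt => /negP; apply.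
have : t <= (N v + 1) / (2 * ip v u) by rewrite ge_min lexx orbT.
rewrite ler_ndivlMr; last by rewrite nmulr_llt0// pmulr_rlt0.
by rewrite (mulrC t); lra.
Qed.

End InvariantSubspace.
End AbstractSpectral.

(** * Real square-integrable functions *)

Lemma geometric_cvg (R : realType) (u : nat -> R) (s : R) :
  (forall k, `|u k.+1 - u k| <= s * 2^-1 ^+ k) ->
  exists2 l : R, u k @[k --> \oo] --> l & forall k, `|u k - l| <= 2 * s * 2^-1 ^+ k.
Proof.
move=> us; have s0 : 0 <= s.
  by have := us 0; rewrite expr0 mulr1; apply: le_trans; exact: normr_ge0.
have h1 : `|2^-1 : R| < 1 by rewrite ger0_norm// invf_lt1// ltr1n.
have cu : cvgn (series (telescope u)).
  apply: normed_cvg.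
  apply: (@series_le_cvg _ _ (geometric s 2^-1)) => [n|n|n|].
  - exact: normr_ge0.
  - by rewrite /= mulr_ge0// exprn_ge0.
  - exact: us.
  - exact: is_cvg_geometric_series.
have [l ul] : exists l : R, u k @[k --> \oo] --> l.
  exists (u 0 + limn (series (telescope u))).
  rewrite (_ : (fun k => _) = (fun k => u 0 + series (telescope u) k)).
    by apply: cvgD => //; exact: cvg_cst.
  by apply/funext => k; rewrite -eq_sum_telescope.
exists l => // k.
have tail n : `|u k - u (k + n)%N| <= 2 * s * 2^-1 ^+ k * (1 - 2^-1 ^+ n).
  elim: n => [|n IH]; first by rewrite addn0 subrr normr0 expr0 subrr mulr0.
  have -> : u k - u (k + n.+1)%N =
      (u k - u (k + n)%N) - (u (k + n).+1 - u (k + n)%N).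
    by rewrite addnS; ring.
  apply: le_trans (ler_normB _ _) _; apply: le_trans (lerD IH (us _)) _.
  by rewrite exprD exprS; lra.
have cl : `|u k - u (k + n)%N| @[n --> \oo] --> `|u k - l|.
  apply: cvg_norm; apply: cvgB; first exact: cvg_cst.
  by under eq_fun do rewrite addnC; move: ul; rewrite -(cvg_shiftn k u).
rewrite -(cvg_lim _ cl)//; apply: limr_le; first by apply/cvg_ex; eexists; exact: cl.
apply: nearW => n; apply: le_trans (tail n) _.
have pk : 0 <= 2 * s * 2^-1 ^+ k by rewrite mulr_ge0 ?exprn_ge0// mulr_ge0.
have pn : 0 <= (2^-1 : R) ^+ n by rewrite exprn_ge0.
by rewrite -[leRHS]mulr1 ler_wpM2l// lerBlDr lerDl.
Qed.

Section RealL2.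
Context d (T : measurableType d) (R : realType) (mu : {measure set T -> \bar R}).
Local Notation L2r := (Lfun mu 2%:E).
Implicit Types f g h : T -> R.

Definition rip f g : R := \int[mu]_x (f x * g x).

Lemma Lfun2_measurable f : f \in L2r -> measurable_fun setT f.
Proof. by rewrite inE => /andP[]; rewrite inE. Qed.

Lemma Lfun2_mul_integrable f g : f \in L2r -> g \in L2r ->
  mu.-integrable setT (EFin \o (fun x => f x * g x)).
Proof. by move=> hf hg; apply/Lfun1_integrable; exact: Lfun2_mul_Lfun1. Qed.

Lemma Lfun2P f : measurable_fun setT f ->
  (\int[mu]_x (f x ^+ 2)%:E < +oo)%E -> f \in L2r.
Proof.
move=> mf ff; rewrite inE; apply/andP; split; rewrite inE//=.
rewrite /finite_norm unlock poweR_lty//.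
by under eq_integral => x _ do rewrite /= powR_mulrn// -normrX ger0_norm ?sqr_ge0//.
Qed.

Lemma Lfun2_le f g : measurable_fun setT f -> g \in L2r ->
  (forall x, `|f x| <= `|g x|) -> f \in L2r.
Proof.
move=> mf hg fg; apply: Lfun2P => //.
have := Lfun2_integrable_sqr hg => /integrableP[mg].
apply: le_lt_trans; apply: ge0_le_integral => //.
- by move=> x _; rewrite lee_fin sqr_ge0.
- by apply/measurable_EFinP; exact: measurable_funX.
- exact: measurableT_comp.
- move=> x _ /=; rewrite lee_fin normrX -[leLHS]real_normK ?num_real//.
  by rewrite ler_pXn2r ?nnegrE.
Qed.

Lemma Lfun2D f g : f \in L2r -> g \in L2r -> (fun x => f x + g x) \in L2r.
Proof.
by move=> hf hg; have [_] := Lfun_addr_closed mu (lee1n 2 : (1 <= 2%:E :> \bar R)%E); exact.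
Qed.

Lemma Lfun2Z a f : f \in L2r -> (fun x => a * f x) \in L2r.
Proof.
move=> hf; have -> : (fun x => a * f x) = a \o* f.
  by apply/funext => x /=; rewrite mulrC.
by apply: Lfun_scale => //; rewrite ler1n.
Qed.

Lemma Lfun2_0 : (fun=> 0 : R) \in L2r.
Proof.
by have [] := Lfun_addr_closed mu (lee1n 2 : (1 <= 2%:E :> \bar R)%E).
Qed.

Lemma Lfun2N f : f \in L2r -> (fun x => - f x) \in L2r.
Proof.
by move=> /(Lfun2Z (-1)); under eq_fun do rewrite mulN1r.
Qed.

Lemma Lfun2B f g : f \in L2r -> g \in L2r -> (fun x => f x - g x) \in L2r.
Proof. by move=> hf /Lfun2N; exact: Lfun2D. Qed.

Lemma Lfun2_sum n (f : 'I_n -> T -> R) : (forall i, f i \in L2r) ->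
  (fun x => \sum_i f i x) \in L2r.
Proof.
elim: n f => [|n IH] f hf.
  by under eq_fun do rewrite big_ord0; exact: Lfun2_0.
by under eq_fun do rewrite big_ord_recl; apply: Lfun2D => //; exact: IH.
Qed.

Lemma rip_sym f g : rip f g = rip g f.
Proof. by apply: eq_Rintegral => x _; rewrite mulrC. Qed.

Lemma rip_ge0 f : 0 <= rip f f.
Proof. by apply: Rintegral_ge0 => x _; rewrite -expr2 sqr_ge0. Qed.

Lemma ripD f g h : f \in L2r -> g \in L2r -> h \in L2r ->
  rip (fun x => f x + g x) h = rip f h + rip g h.
Proof.
move=> hf hg hh; rewrite -RintegralD//; try exact: Lfun2_mul_integrable.
by apply: eq_Rintegral => x _ /=; rewrite mulrDl.
Qed.

Lemma ripZ a f g : f \in L2r -> g \in L2r ->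
  rip (fun x => a * f x) g = a * rip f g.
Proof.
move=> hf hg; rewrite -RintegralZl//; try exact: Lfun2_mul_integrable.
by apply: eq_Rintegral => x _ /=; rewrite mulrA.
Qed.

Lemma ripNr f g : f \in L2r -> g \in L2r -> rip f (fun x => - g x) = - rip f g.
Proof.
move=> hf hg; rewrite rip_sym (rip_sym f) -mulN1r -ripZ//.
by congr rip; apply/funext => x; rewrite mulN1r.
Qed.

Lemma rip0 g : rip (fun=> 0) g = 0.
Proof.
rewrite /rip (_ : (fun x => _) = cst 0); last by apply/funext => x; rewrite mul0r.
by rewrite /Rintegral integral0.
Qed.

Lemma rip_sum n (f : 'I_n -> T -> R) g : (forall i, f i \in L2r) -> g \in L2r ->
  rip (fun x => \sum_i f i x) g = \sum_i rip (f i) g.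
Proof.
elim: n f => [|n IH] f hf hg.
  by rewrite big_ord0; under [X in rip X]eq_fun do rewrite big_ord0; exact: rip0.
rewrite big_ord_recl -IH//.
under [X in rip X]eq_fun do rewrite big_ord_recl.
by rewrite ripD//; apply: Lfun2_sum.
Qed.

Lemma rip_EFin f : f \in L2r -> (rip f f)%:E = (\int[mu]_x (f x ^+ 2)%:E)%E.
Proof.
move=> hf; rewrite /rip /Rintegral fineK.
  by apply: eq_integral => x _; rewrite expr2.
exact: integrable_fin_num (Lfun2_mul_integrable hf hf).
Qed.

Lemma ae_eq_rip f f' g g' : f \in L2r -> f' \in L2r -> g \in L2r -> g' \in L2r ->
  f = f' %[ae mu] -> g = g' %[ae mu] -> rip f g = rip f' g'.
Proof.
move=> hf hf' hg hg' ff' gg'; congr fine; apply: ae_eq_integral => //.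
- by have /integrableP[] := Lfun2_mul_integrable hf hg.
- by have /integrableP[] := Lfun2_mul_integrable hf' hg'.
- by move: ff' gg'; apply: filterS2 => x /= + + _ => -> // ->.
Qed.

Lemma rip_eq0 f : f \in L2r -> rip f f = 0 -> f = (fun=> 0) %[ae mu].
Proof.
move=> hf f0.
have mf2 : measurable_fun setT (fun x => (f x ^+ 2)%:E).
  by apply/measurable_EFinP; apply: measurable_funX; exact: Lfun2_measurable.
have : (\int[mu]_x `|(f x ^+ 2)%:E| = 0)%E.
  under eq_integral do rewrite gee0_abs ?lee_fin ?sqr_ge0//.
  by rewrite -rip_EFin// f0.
move/(ae_eq_integral_abs mu measurableT mf2).
apply: filterS => x /= h _; apply/eqP; rewrite -sqrf_eq0.
by have [->] := h I.
Qed.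

(** Riesz-Fischer.  Since the squared increments are at most [C * 16^-k], the
series of the [4^k |f (k+1) - f k|^2] is integrable; where it is finite, the
increments at that point are at most a constant times [2^-k], which gives both
the pointwise limit and the domination of the error. *)
Lemma Lfun2_complete (f : nat -> T -> R) (C : R) :
  (forall k, f k \in L2r) ->
  (forall k, rip (fun x => f k.+1 x - f k x) (fun x => f k.+1 x - f k x)
     <= C * 16^-1 ^+ k) ->
  exists2 g, g \in L2r &
    rip (fun x => f k x - g x) (fun x => f k x - g x) @[k --> \oo] --> (0 : R).
Proof.
move=> hf fC.
pose dd k x := f k.+1 x - f k x.
have hd k : dd k \in L2r by exact: Lfun2B.
pose s k x := (4 ^+ k * dd k x ^+ 2)%:E.
have s0 k x : (0 <= s k x)%E by rewrite lee_fin mulr_ge0// ?sqr_ge0// exprn_ge0.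
have ms k : measurable_fun setT (s k).
  apply/measurable_EFinP; apply: measurable_funM => //.
  by apply: measurable_funX; exact: Lfun2_measurable.
pose S x := (\sum_(0 <= k <oo) s k x)%E.
have S0 x : (0 <= S x)%E by exact: nneseries_ge0.
have mS : measurable_fun setT S by exact: ge0_emeasurable_sum.
have intS : (\int[mu]_x S x <= (C * (4 / 3))%:E)%E.
  have C0 : 0 <= C by have := fC 0; rewrite expr0 mulr1; apply: le_trans; exact: rip_ge0.
  rewrite integral_nneseries//.
  apply: lime_le.
    by apply: is_cvg_nneseries => n _ _; exact: integral_ge0.
  apply: nearW => n.
  have q1 : `|4^-1 : R| < 1 by rewrite ger0_norm// invf_lt1// ltr1n.
  have := @geometric_le_lim R n C 4^-1 C0 _ q1.
  rewrite invr_gt0 ltr0n => /(_ isT).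
  have -> : (1 - 4^-1 : R)^-1 = 4 / 3 by field.
  rewrite -lee_fin; apply: le_trans.
  rewrite /series/= -sumEFin; apply: lee_sum => k _.
  rewrite /s; under eq_integral do rewrite EFinM.
  have md : measurable_fun setT (fun x => (dd k x ^+ 2)%:E).
    by apply/measurable_EFinP; apply: measurable_funX; exact: Lfun2_measurable.
  have d0 x : setT x -> (0 <= (dd k x ^+ 2)%:E)%E by rewrite lee_fin sqr_ge0.
  rewrite (ge0_integralZl_EFin mu measurableT d0 md (exprn_ge0 k _))//.
  rewrite -rip_EFin// -EFinM lee_fin.
  apply: le_trans (_ : 4 ^+ k * (C * 16^-1 ^+ k) <= _).
    by rewrite ler_wpM2l ?exprn_ge0//; exact: fC.
  rewrite mulrCA ler_wpM2l// -exprMn.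
  by have -> : (4 * 16^-1 : R) = 4^-1 by field.
have Sbnd k x : (S x < +oo)%E -> `|dd k x| <= Num.sqrt (fine (S x)) * 2^-1 ^+ k.
  move=> Sx; have Sfin : S x \is a fin_num by rewrite ge0_fin_numE.
  have : (s k x <= S x)%E.
    apply: le_trans (nneseries_lim_ge k.+1 _); last by move=> n _ _; exact: s0.
    by rewrite big_nat_recr//= leeDr// sume_ge0.
  rewrite -(fineK Sfin) lee_fin => h.
  have fS0 : 0 <= fine (S x) by exact: fine_ge0.
  rewrite -(ler_pXn2r (_ : (0 < 2)%N))// ?nnegrE ?mulr_ge0 ?sqrtr_ge0 ?exprn_ge0//.
  rewrite real_normK ?num_real// exprMn sqr_sqrtr// -exprM mulnC exprM.
  have -> : (2^-1 ^+ 2 : R) = 4^-1 by field.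
  by rewrite exprVn ler_pdivlMr ?exprn_gt0// mulrC.
pose D := [set x | (S x < +oo)%E].
have mD : measurable D.
  by rewrite -[D]setTI; exact: emeasurable_fun_infty_o.
(* Killing f k off the set of convergence makes the limit measurable. *)
pose f' k x := f k x * \1_D x.
have f'E k x : D x -> f' k x = f k x.
  by move=> Dx; rewrite /f' indicE mem_set// mulr1.
have f'N k x : ~ D x -> f' k x = 0.
  by move=> Dx; rewrite /f' indicE memNset// mulr0.
have /choice[g Pg] x : exists l : R, f' k x @[k --> \oo] --> l /\
    (D x -> forall k, `|f k x - l| <= 2 * Num.sqrt (fine (S x)) * 2^-1 ^+ k).
  have [Dx|Dx] := pselect (D x); last first.
    exists 0; split => //; under eq_fun do rewrite f'N//; exact: cvg_cst.
  have [l fl lb] := geometric_cvg (fun k => Sbnd k x Dx).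
  by exists l; split=> //; under eq_fun do rewrite f'E//.
have mg : measurable_fun setT g.
  apply: (@measurable_fun_cvg _ _ _ setT f').
    by move=> k; apply: measurable_funM; [exact: Lfun2_measurable|exact: measurable_indic].
  by move=> x _; have [] := Pg x.
have aeD : {ae mu, forall x, D x}.
  have iS : mu.-integrable setT S.
    apply/integrableP; split=> //.
    under eq_integral do rewrite gee0_abs//.
    by apply: le_lt_trans intS _; rewrite ltry.
  have := integrable_ae measurableT iS; apply: filterS => x /(_ I).
  by rewrite ge0_fin_numE.
have bnd k : (\int[mu]_x ((f k x - g x) ^+ 2)%:E <= (4 * 4^-1 ^+ k * (C * (4 / 3)))%:E)%E.
  rewrite EFinM; apply: le_trans (_ : ((4 * 4^-1 ^+ k)%:E * \int[mu]_x S x <= _)%E); last first.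
    by rewrite lee_wpmul2l// lee_fin mulr_ge0 ?exprn_ge0.
  have k0 : 0 <= 4 * 4^-1 ^+ k :> R by rewrite mulr_ge0 ?exprn_ge0.
  rewrite -(ge0_integralZl_EFin mu measurableT (fun x _ => S0 x) mS k0).
  apply: ae_ge0_le_integral => //.
  - by move=> x _; rewrite lee_fin sqr_ge0.
  - apply/measurable_EFinP; apply: measurable_funX; apply: measurable_funB => //.
    exact: Lfun2_measurable.
  - by move=> x _; rewrite mule_ge0// lee_fin mulr_ge0 ?exprn_ge0.
  - by apply: measurable_funeM.
  move: aeD; apply: filterS => x Dx _.
  have Sfin : S x \is a fin_num by rewrite ge0_fin_numE.
  have fS0 : 0 <= fine (S x) by exact: fine_ge0.
  have [_ /(_ Dx k) h] := Pg x.
  rewrite -(fineK Sfin) -EFinM lee_fin -[leLHS]real_normK ?num_real//.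
  have -> : 4 * 4^-1 ^+ k * fine (S x) = (2 * Num.sqrt (fine (S x)) * 2^-1 ^+ k) ^+ 2.
    rewrite !exprMn sqr_sqrtr// -exprM mulnC exprM.
    have -> : (2^-1 ^+ 2 : R) = 4^-1 by field.
    by ring.
  by rewrite ler_pXn2r ?nnegrE ?mulr_ge0 ?sqrtr_ge0 ?exprn_ge0.
have hfg k : (fun x => f k x - g x) \in L2r.
  apply: Lfun2P; last by apply: le_lt_trans (bnd k) _; rewrite ltry.
  by apply: measurable_funB => //; exact: Lfun2_measurable.
exists g.
  have -> : g = (fun x => f 0%N x - (f 0%N x - g x)) by apply/funext => x; ring.
  exact: Lfun2B.
apply: (@squeeze_cvgr _ _ _ _ (cst 0) (fun k => 4 * (C * (4 / 3)) * 4^-1 ^+ k)).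
- apply: nearW => k /=; rewrite rip_ge0/= -lee_fin rip_EFin//.
  by apply: le_trans (bnd k) _; rewrite mulrAC.
- exact: cvg_cst.
- rewrite -[0 in X in _ --> X](mulr0 (4 * (C * (4 / 3)))); apply: cvgMl_tmp.
  by apply: cvg_expr; rewrite ger0_norm// invf_lt1// ltr1n.
Qed.
End RealL2.

(** * Complex square-integrable functions as a real Hilbert space *)

Arguments inner : simpl never.
Arguments reF : simpl never.
Arguments imF : simpl never.

Section ComplexL2.
Local Open Scope complex_scope.
Context {R : realType} (mu : {measure set (measurableTypeR R) -> \bar R}).
Implicit Types u v w : R -> R[i].
Local Notation L2r := (Lfun mu 2%:E).

Lemma innerE u v : L2 mu u -> L2 mu v -> inner mu u v =
  (rip mu (reF u) (reF v) + rip mu (imF u) (imF v)) +i*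
  (rip mu (imF u) (reF v) - rip mu (reF u) (imF v)).
Proof.
move=> [ur ui] [vr vi]; rewrite /inner /cintegral; congr (_ +i* _).
- rewrite -RintegralD//; try exact: Lfun2_mul_integrable.
  apply: eq_Rintegral => x _; rewrite /reF /imF.
  by case: (u x) (v x) => [a b] [c e] /=; ring.
- rewrite -RintegralB//; try exact: Lfun2_mul_integrable.
  apply: eq_Rintegral => x _; rewrite /reF /imF.
  by case: (u x) (v x) => [a b] [c e] /=; ring.
Qed.

Lemma reF_comb (a : R[i]) u v : reF (fun x => a * u x + v x) =
  fun x => (complex.Re a * reF u x + (- complex.Im a) * imF u x) + reF v x.
Proof.
apply/funext => x; rewrite /reF /imF.
by case: a (u x) (v x) => [? ?] [? ?] [? ?] /=; ring.
Qed.

Lemma imF_comb (a : R[i]) u v : imF (fun x => a * u x + v x) =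
  fun x => (complex.Re a * imF u x + complex.Im a * reF u x) + imF v x.
Proof.
apply/funext => x; rewrite /reF /imF.
by case: a (u x) (v x) => [? ?] [? ?] [? ?] /=; ring.
Qed.

Lemma L2_comb (a : R[i]) u v : L2 mu u -> L2 mu v -> L2 mu (fun x => a * u x + v x).
Proof.
move=> [ur ui] [vr vi]; split; rewrite ?reF_comb ?imF_comb.
- by apply: Lfun2D => //; apply: Lfun2D; exact: Lfun2Z.
- by apply: Lfun2D => //; apply: Lfun2D; exact: Lfun2Z.
Qed.

Local Notation LR := (LfunType mu (lee1n 2 : (1 <= 2%:E :> \bar R)%E)).
(** The real space of real and imaginary parts, on which [reip] is the real part
of [inner].  Working over the reals costs nothing for eigenvalue problems with
real parameter, as long as sets of eigenvectors are closed under
multiplication by ['i]. *)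
Definition L2E : lmodType R := (LR * LR)%type.

Definition mkc (p : L2E) : R -> R[i] := fun x => p.1 x +i* p.2 x.
Definition reip (p q : L2E) : R := rip mu p.1 q.1 + rip mu p.2 q.2.

Lemma mkc_L2 p : L2 mu (mkc p).
Proof. by split; exact: LfunP. Qed.

Lemma L2_mkc u : L2 mu u -> exists p, mkc p = u.
Proof.
move=> [ur ui]; exists (Lfun_Sub (lee1n 2) ur, Lfun_Sub (lee1n 2) ui).
by apply/funext => x; rewrite /mkc/= /reF /imF; case: (u x).
Qed.

Let Lval_lin (a : R) (f g : LR) :
  (a *: f + g : LR) = (fun x => a * f x + g x) :> (R -> R).
Proof. reflexivity. Qed.

Let fst_lin (a : R) (p q : L2E) :
  (a *: p + q).1 = (fun x => a * p.1 x + q.1 x) :> (R -> R).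
Proof.
have -> : (a *: p + q).1 = (a *: (p.1 : LR) + q.1 : LR) by reflexivity.
exact: Lval_lin.
Qed.

Let snd_lin (a : R) (p q : L2E) :
  (a *: p + q).2 = (fun x => a * p.2 x + q.2 x) :> (R -> R).
Proof.
have -> : (a *: p + q).2 = (a *: (p.2 : LR) + q.2 : LR) by reflexivity.
exact: Lval_lin.
Qed.

Lemma mkc_lin (a : R) p q : mkc (a *: p + q) = fun x => a%:C * mkc p x + mkc q x.
Proof.
apply/funext => x; rewrite /mkc fst_lin snd_lin.
by apply/eqP; rewrite eq_complex /= !mul0r subr0 addr0 !eqxx.
Qed.

Let reip_subE (p q : L2E) : reip (p - q) (p - q) =
  rip mu (fun x => p.1 x - q.1 x) (fun x => p.1 x - q.1 x) +
  rip mu (fun x => p.2 x - q.2 x) (fun x => p.2 x - q.2 x).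
Proof.
have -> : p - q = -1 *: q + p by rewrite scaleN1r addrC.
rewrite /reip fst_lin snd_lin.
by congr (rip mu _ _ + rip mu _ _); apply/funext => x; rewrite mulN1r addrC.
Qed.

Lemma reip_semi : semi_inner reip.
Proof.
split.
- by move=> p q; rewrite /reip rip_sym (rip_sym _ p.2).
- move=> a p q r; rewrite /reip.
  rewrite fst_lin snd_lin !ripD ?ripZ//; try exact: LfunP; try (apply: Lfun2Z; exact: LfunP).
  by ring.
- by move=> p; rewrite /reip addr_ge0// rip_ge0.
Qed.

Lemma reip_inner p q : reip p q = complex.Re (inner mu (mkc p) (mkc q)).
Proof. by rewrite innerE//; exact: mkc_L2. Qed.

Lemma reip_complete : geo_complete reip.
Proof.
move=> w C hw.
have [g1 hg1 c1] : exists2 g, g \in L2r &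
    rip mu (fun x => (w k).1 x - g x) (fun x => (w k).1 x - g x) @[k --> \oo] --> (0 : R).
  apply: (@Lfun2_complete _ _ _ mu (fun k => (w k).1) C).
    by move=> k; exact: LfunP.
  by move=> k; apply: le_trans (hw k); rewrite reip_subE lerDl rip_ge0.
have [g2 hg2 c2] : exists2 g, g \in L2r &
    rip mu (fun x => (w k).2 x - g x) (fun x => (w k).2 x - g x) @[k --> \oo] --> (0 : R).
  apply: (@Lfun2_complete _ _ _ mu (fun k => (w k).2) C).
    by move=> k; exact: LfunP.
  by move=> k; apply: le_trans (hw k); rewrite reip_subE lerDr rip_ge0.
exists (Lfun_Sub (lee1n 2) hg1, Lfun_Sub (lee1n 2) hg2).
have -> : (0 : R) = 0 + 0 by rewrite addr0.
have -> : (fun k => reip (w k - (Lfun_Sub (lee1n 2) hg1, Lfun_Sub (lee1n 2) hg2))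
   (w k - (Lfun_Sub (lee1n 2) hg1, Lfun_Sub (lee1n 2) hg2))) =
  (fun k => rip mu (fun x => (w k).1 x - g1 x) (fun x => (w k).1 x - g1 x) +
            rip mu (fun x => (w k).2 x - g2 x) (fun x => (w k).2 x - g2 x)).
  by apply/funext => k; rewrite reip_subE.
exact: cvgD c1 c2.
Qed.

Variables (A : set ((R -> R[i]) * (R -> R[i]))) (A_sa : self_adjoint mu A).

Definition Arel (p q : L2E) : Prop := A (mkc p, mkc q).

(** Maximality for the real part of [inner] gives maximality for [inner]: the
imaginary part of the adjoint identity at [u'] is, up to sign, its real part at
['i * u']. *)
Lemma Arel_self_adjoint : self_adjoint_rel reip Arel.
Proof.
have [[AL2' Asat Auniq A0 Alin] _ Aadj] := A_sa.
have AL2 x y : A (x, y) -> L2 mu x /\ L2 mu y by move/AL2'.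
split.
- move=> a u v u' v' h h'; rewrite /Arel !mkc_lin; exact: Alin.
- move=> u v u' v' h; rewrite {1}/Arel Aadj => -[_ _ /(_ _ _ h)].
  by rewrite !reip_inner => ->.
- move=> u v huv; rewrite /Arel Aadj; split; try exact: mkc_L2.
  move=> u' v' h'.
  have hi : A ((fun x => 'i * u' x + 0), (fun x => 'i * v' x + 0)).
    exact: Alin h' A0.
  have red x y : A (x, y) -> complex.Re (inner mu y (mkc u)) = complex.Re (inner mu x (mkc v)).
    move=> hxy; have [/L2_mkc[p px] /L2_mkc[q qy]] := AL2 _ _ hxy.
    have : reip q u = reip p v by apply: huv; rewrite /Arel px qy.
    by rewrite !reip_inner px qy.
  have := red _ _ hi; have := red _ _ h'.
  have [Lu' Lv'] := AL2 _ _ h'; have [Liu' Liv'] := AL2 _ _ hi.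
  have Lu := mkc_L2 u; have Lv := mkc_L2 v.
  rewrite (innerE Lv' Lu) (innerE Lu' Lv) (innerE Liv' Lu) (innerE Liu' Lv) /complex.Re.
  have i1 : reF (fun x => 'i * u' x + 0) = fun x => -1 * imF u' x.
    by apply/funext => x; rewrite /reF /imF; case: (u' x) => a b /=; ring.
  have i2 : imF (fun x => 'i * u' x + 0) = reF u'.
    by apply/funext => x; rewrite /reF /imF; case: (u' x) => a b /=; ring.
  have i3 : reF (fun x => 'i * v' x + 0) = fun x => -1 * imF v' x.
    by apply/funext => x; rewrite /reF /imF; case: (v' x) => a b /=; ring.
  have i4 : imF (fun x => 'i * v' x + 0) = reF v'.
    by apply/funext => x; rewrite /reF /imF; case: (v' x) => a b /=; ring.
  rewrite i1 i2 i3 i4 !ripZ; try (by case: Lu'); try (by case: Lv'); try (by case: Lu); try (by case: Lv).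
  by move=> e1 e2; congr (_ +i* _) => //; lra.
Qed.

Let A_L2 u v : A (u, v) -> L2 mu u /\ L2 mu v.
Proof. by have [[AL2 _ _ _ _] _ _] := A_sa; move/AL2. Qed.

Let A_lin (a : R[i]) u u' v v' : A (u, v) -> A (u', v') ->
  A (fun x => a * u x + u' x, fun x => a * v x + v' x).
Proof. by have [[_ _ _ _ Alin] _ _] := A_sa; exact: Alin. Qed.

Lemma norm2_mkc p : norm2 mu (mkc p) = Num.sqrt (reip p p).
Proof. by rewrite reip_inner. Qed.

Lemma mkc_sub (t : R) p q :
  mkc (q - t *: p) = fun x => mkc q x - t%:C * mkc p x.
Proof.
rewrite addrC -scaleNr mkc_lin; apply/funext => x.
by rewrite rmorphN mulNr addrC.
Qed.

(** The saturation of [A] under almost everywhere equality turns a solution up to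
a null set into an exact one. *)
Lemma resolvent_regular (t : R) : resolvent_set mu A t%:C ->
  regular reip Arel setT t.
Proof.
move=> [onto_t [c bound_t]]; split.
- move=> f _; have [u [w [Auw wf]]] := onto_t _ (mkc_L2 f).
  have [Lu Lw] := A_L2 Auw; have [p pu] := L2_mkc Lu.
  exists p => //; rewrite /Arel addrC mkc_lin.
  have [[_ Asat _ _ _] _ _] := A_sa.
  apply: (Asat u _ w) => //.
  + exact: mkc_L2.
  + by apply: L2_comb; exact: mkc_L2.
  + by rewrite pu; exact: ae_eq_refl.
  + rewrite pu; move: wf; apply: (@filterS _ _ (ae_filter_ringOfSetsType mu)) => x /= + _.
    by move=> /(_ I) <-; rewrite addrC subrK.
- pose d := Num.max c 1.
  have d0 : 0 < d by rewrite lt_max ltr01 orbT.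
  exists (d ^- 2); first by rewrite invr_gt0 exprn_gt0.
  move=> p q _ Apq.
  have := bound_t _ _ Apq.
  rewrite -mkc_sub !norm2_mkc.
  set X := reip p p; set Y := reip _ _ => h.
  have X0 : 0 <= X by exact: (ip_ge0 reip_semi).
  have Y0 : 0 <= Y by exact: (ip_ge0 reip_semi).
  have {}h : Num.sqrt X <= d * Num.sqrt Y.
    by apply: le_trans h _; rewrite ler_wpM2r ?sqrtr_ge0// le_max lexx.
  rewrite ler_pdivrMl ?exprn_gt0//.
  rewrite -(sqr_sqrtr X0) -(sqr_sqrtr Y0) -exprMn ler_pXn2r ?nnegrE ?sqrtr_ge0//.
  by rewrite mulr_ge0 ?sqrtr_ge0// ltW.
Qed.

(** [new_eigenvector] for the complement of the [e i] and [fun x => 'i * e i x],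
which together span the complex space of the [e i] over the reals. *)
Lemma new_negative_eigenfunction n (l : 'I_n -> R) (e : 'I_n -> R -> R[i]) u v :
  (forall i, eigenfunction A (l i)%:C (e i)) ->
  (forall t : R, t < 0 -> (forall i, t != l i) -> resolvent_set mu A t%:C) ->
  A (u, v) -> (forall i, inner mu u (e i) = 0) ->
  complex.Re (inner mu v u) < 0 ->
  exists i w, [/\ l i < 0, eigenfunction A (l i)%:C w,
    forall j, inner mu w (e j) = 0 & 0 < complex.Re (inner mu w w)].
Proof.
move=> eigen res Auv ue vu.
have Le i : L2 mu (e i) by have [] := A_L2 (eigen i).
have [Lu Lv] := A_L2 Auv.
pose S := [set q : L2E | exists i,
  mkc q = e i \/ mkc q = fun x => 'i * e i x + 0].
have A0 : A (fun=> 0, fun=> 0) by have [[_ _ _ A0 _] _ _] := A_sa.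
have SP q : S q -> exists t : R, Arel q (t *: q).
  move=> [i eq_e]; exists (l i); rewrite -[l i *: q]addr0 /Arel mkc_lin.
  have -> : mkc 0 = fun=> 0 by [].
  have -> : (fun x : R => (l i)%:C * mkc q x + 0) = (fun x : R => (l i)%:C * mkc q x).
    by apply/funext => x; rewrite addr0.
  case: eq_e => ->; first exact: eigen.
  have := A_lin 'i (eigen i) A0; congr (A (_, _)).
  by apply/funext => x; rewrite !addr0 mulrCA.
have ripN f g : f \in L2r -> g \in L2r -> rip mu f (fun x => -1 * g x) = - rip mu f g.
  by move=> hf hg; rewrite rip_sym ripZ// mulN1r rip_sym.
have irF i : reF (fun x => 'i * e i x + 0) = fun x => -1 * imF (e i) x.
  by apply/funext => x; rewrite /reF /imF; case: (e i x) => a b /=; ring.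
have ieF i : imF (fun x => 'i * e i x + 0) = reF (e i).
  by apply/funext => x; rewrite /reF /imF; case: (e i x) => a b /=; ring.
have orthP q : orthogonal_to reip S q <-> forall i, inner mu (mkc q) (e i) = 0.
  have Lq := mkc_L2 q.
  split.
    move=> hq i.
    have [p pe] := L2_mkc (Le i).
    have Lie : L2 mu (fun x => 'i * e i x + 0) by case: (A_L2 (A_lin 'i (eigen i) A0)).
    have [p' pe'] := L2_mkc Lie.
    have h1 : reip q p = 0 by apply: hq; exists i; left.
    have h2 : reip q p' = 0 by apply: hq; exists i; right.
    move: h1 h2; rewrite !reip_inner pe pe' (innerE Lq (Le i)) (innerE Lq Lie) ieF irF.
    have [Lqr Lqi] := Lq; have [Ler Lei] := Le i.
    by rewrite /complex.Re ripN// => -> h2; congr (_ +i* _); lra.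
  move=> hq p [i pe].
  have : inner mu (mkc q) (e i) = 0 by [].
  rewrite innerE// => -[h1 h2]; rewrite reip_inner.
  case: pe => ->; first by rewrite innerE.
  rewrite innerE//; last by case: (A_L2 (A_lin 'i (eigen i) A0)).
  have [Lqr Lqi] := Lq; have [Ler Lei] := Le i.
  by rewrite /complex.Re (ieF i) (irF i) ripN//; lra.
have [p pu] := L2_mkc Lu; have [q qv] := L2_mkc Lv.
have resL (t : R) : t < 0 -> t \notin [seq l i | i <- enum 'I_n] ->
    regular reip Arel setT t.
  move=> t0 tl; apply: resolvent_regular; apply: res => // i.
  by apply: contraNneq tl => ->; apply: map_f; rewrite mem_enum.
have Hp : orthogonal_to reip S p by apply/orthP; rewrite pu.
have Apq : Arel p q by rewrite /Arel pu qv.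
have pq : reip q p < 0 by rewrite reip_inner pu qv.
have [t [w [/mapP[i _ ->] t0 Hw Aw w0]]] :=
  new_eigenvector reip_semi Arel_self_adjoint SP reip_complete resL Hp Apq pq.
exists i, (mkc w); split => //.
- move: Aw; rewrite -[l i *: w]addr0 /Arel mkc_lin; congr (A (_, _)).
  have -> : mkc 0 = fun=> 0 by [].
  by apply/funext => x; rewrite addr0.
- by apply/orthP.
- by rewrite -reip_inner.
Qed.

End ComplexL2.

(** * Counting negative eigenvalues *)

Section Counting.
Local Open Scope complex_scope.
Context {R : realType} (mu : {measure set (measurableTypeR R) -> \bar R}).
Implicit Types u v w : R -> R[i].

Lemma inner_lin (a : R[i]) u v w : L2 mu u -> L2 mu v -> L2 mu w ->
  inner mu (fun x => a * u x + v x) w = a * inner mu u w + inner mu v w.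
Proof.
move=> Lu Lv Lw; have Lc := L2_comb a Lu Lv.
rewrite (innerE Lc Lw) (innerE Lu Lw) (innerE Lv Lw).
have [ur ui] := Lu; have [vr vi] := Lv; have [wr wi] := Lw.
rewrite reF_comb imF_comb; case: a {Lc} => a b.
have lin (c d : R) f g h k : f \in Lfun mu 2%:E -> g \in Lfun mu 2%:E ->
    h \in Lfun mu 2%:E -> k \in Lfun mu 2%:E ->
    rip mu (fun x => (c * f x + d * g x) + h x) k =
    c * rip mu f k + d * rip mu g k + rip mu h k.
  move=> hf hg hh hk; rewrite (@ripD _ _ _ mu (fun x => c * f x + d * g x))//.
    by rewrite (@ripD _ _ _ mu (fun x => c * f x)) ?ripZ//; exact: Lfun2Z.
  by apply: Lfun2D; exact: Lfun2Z.
rewrite !lin//; apply/eqP; rewrite eq_complex /=.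
by apply/andP; split; apply/eqP; ring.
Qed.

Lemma L2_0 : L2 mu (fun=> 0).
Proof. by split; exact: Lfun2_0. Qed.

Lemma inner0 w : L2 mu w -> inner mu (fun=> 0) w = 0.
Proof. by move=> Lw; rewrite innerE ?rip0 ?addr0 ?subr0//; exact: L2_0. Qed.

Lemma innerZ (a : R[i]) u w : L2 mu u -> L2 mu w ->
  inner mu (fun x => a * u x) w = a * inner mu u w.
Proof.
move=> Lu Lw; have := inner_lin a Lu L2_0 Lw; rewrite inner0// addr0 => <-.
by congr (inner mu _ w); apply/funext => x; rewrite addr0.
Qed.

Lemma L2Z (a : R[i]) u : L2 mu u -> L2 mu (fun x => a * u x).
Proof.
move=> Lu; have := L2_comb a Lu L2_0.
by under eq_fun do rewrite addr0.
Qed.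

Lemma L2_sum n (c : 'I_n -> R[i]) (f : 'I_n -> R -> R[i]) :
  (forall i, L2 mu (f i)) -> L2 mu (fun x => \sum_i c i * f i x).
Proof.
elim: n c f => [|n IH] c f hf.
  by under eq_fun do rewrite big_ord0; exact: L2_0.
under eq_fun do rewrite big_ord_recl; apply: L2_comb => //.
by apply: (IH (fun i => c (lift ord0 i)) (fun i => f (lift ord0 i))).
Qed.

Lemma inner_sum n (c : 'I_n -> R[i]) (f : 'I_n -> R -> R[i]) w :
  (forall i, L2 mu (f i)) -> L2 mu w ->
  inner mu (fun x => \sum_i c i * f i x) w = \sum_i c i * inner mu (f i) w.
Proof.
elim: n c f => [|n IH] c f hf Lw.
  by rewrite big_ord0 -[RHS](inner0 Lw); congr (inner mu _ w); apply/funext => x; rewrite big_ord0.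
rewrite big_ord_recl.
rewrite -(IH (fun i => c (lift ord0 i)) (fun i => f (lift ord0 i)))//.
rewrite -inner_lin//; last by apply: (L2_sum (fun i => c (lift ord0 i))).
by congr (inner mu _ w); apply/funext => x; rewrite big_ord_recl.
Qed.

Lemma inner_conj u w : L2 mu u -> L2 mu w -> inner mu w u = (inner mu u w)^*.
Proof.
move=> Lu Lw; rewrite !innerE//; apply/eqP; rewrite eq_complex /=.
rewrite (rip_sym mu (reF w)) (rip_sym mu (imF w)) eqxx/=.
by rewrite (rip_sym mu (imF w)) (rip_sym mu (reF w)) opprB.
Qed.

Lemma inner_ae0 u w : L2 mu u -> L2 mu w -> u = (fun=> 0) %[ae mu] ->
  inner mu u w = 0.
Proof.
move=> Lu Lw u0; rewrite innerE//.
have [ur ui] := Lu; have [wr wi] := Lw.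
have r0 : reF u = (fun=> 0) %[ae mu].
  by move: u0; apply: (@filterS _ _ (ae_filter_ringOfSetsType mu)) => x /= + _ => /(_ I); rewrite /reF => ->.
have i0 : imF u = (fun=> 0) %[ae mu].
  by move: u0; apply: (@filterS _ _ (ae_filter_ringOfSetsType mu)) => x /= + _ => /(_ I); rewrite /imF => ->.
have e f g : f \in Lfun mu 2%:E -> g \in Lfun mu 2%:E -> f = (fun=> 0) %[ae mu] -> rip mu f g = 0.
  move=> hf hg f0; rewrite -(rip0 mu g); apply: ae_eq_rip => //.
  - exact: Lfun2_0.
  - exact: ae_eq_refl.
by rewrite !e// addr0 subr0.
Qed.

Lemma inner_gt0 u : L2 mu u -> ~ (u = (fun=> 0) %[ae mu]) ->
  0 < complex.Re (inner mu u u).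
Proof.
move=> Lu u0; rewrite innerE// /complex.Re lt_def addr_ge0 ?rip_ge0// andbT.
apply/negP => /eqP h; apply: u0; have [ur ui] := Lu.
have := rip_ge0 mu (reF u); have := rip_ge0 mu (imF u) => i0 r0.
have hr : rip mu (reF u) (reF u) = 0 by lra.
have hi : rip mu (imF u) (imF u) = 0 by lra.
move: (rip_eq0 ur hr) (rip_eq0 ui hi).
apply: (@filterS2 _ _ (ae_filter_ringOfSetsType mu)) => x /= + + _.
move=> /(_ I) + /(_ I); rewrite /reF /imF.
by case: (u x) => a b /= -> ->.
Qed.

Lemma orthogonal_lin_indep n (e : 'I_n -> R -> R[i]) :
  (forall i, L2 mu (e i)) -> (forall i, 0 < complex.Re (inner mu (e i) (e i))) ->
  (forall i j, i != j -> inner mu (e i) (e j) = 0) -> lin_indep mu e.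
Proof.
move=> Le epos eorth c c0 i.
have := inner_ae0 (L2_sum c Le) (Le i) c0.
rewrite inner_sum// (bigD1 i)//= big1 ?addr0 => [/eqP|j ji]; last first.
  by rewrite eorth ?mulr0.
rewrite mulf_eq0 => /orP[/eqP//|/eqP ei0].
by have := epos i; rewrite ei0 ltxx.
Qed.

Variables (A : set ((R -> R[i]) * (R -> R[i]))) (A_sa : self_adjoint mu A).

(** Indexed by [nat] so that a family can be extended without changing its type. *)
Definition orthogonal_eigenfamily k (l : nat -> R) (e : nat -> R -> R[i]) :=
  [/\ forall i, (i < k)%N -> l i < 0,
      forall i, (i < k)%N -> eigenfunction A (l i)%:C (e i),
      forall i, (i < k)%N -> 0 < complex.Re (inner mu (e i) (e i)) &
      forall i j, (i < k)%N -> (j < k)%N -> i != j -> inner mu (e i) (e j) = 0].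

Let A_L2 u v : A (u, v) -> L2 mu u /\ L2 mu v.
Proof. by have [[AL2 _ _ _ _] _ _] := A_sa; move/AL2. Qed.

(** Grouping the family by eigenvalue, each group is linearly independent, so its
size is at most the multiplicity. *)
Lemma eigenfamily_le k l e : orthogonal_eigenfamily k l e ->
  ((k%:R)%:E <= nb_negative_eigenvalues mu A)%E.
Proof.
move=> [lneg eigen epos eorth].
pose P t := [pred i : 'I_k | l i == t].
have mult (t : R) : ((#|P t|%:R)%:E <= multiplicity mu A t%:C)%E.
  apply: ereal_sup_ubound; exists #|P t| => //.
  exists (fun i : 'I_#|P t| => e (enum_val i : 'I_k)).
    move=> i; set j : 'I_k := enum_val i.
    have lj : l j = t by apply/eqP; have := enum_valP i; rewrite inE.
    by rewrite -[t in t%:C]lj; exact: eigen.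
  apply: orthogonal_lin_indep => [i|i|i j ij].
  - by case: (A_L2 (eigen _ (ltn_ord (enum_val i)))).
  - exact: epos.
  - apply: eorth => //; apply: contra ij => /eqP/val_inj ij.
    by apply/eqP/enum_val_inj.
pose s := undup [seq l (val i) | i <- enum 'I_k].
apply: esum_ge; exists [set` s].
  split; first exact: finite_seq.
  by move=> t /=; rewrite mem_undup => /mapP[i _ ->]; exact: (lneg _ (ltn_ord i)).
rewrite -fsbig_seq ?undup_uniq//=.
apply: (@le_trans _ _ (\sum_(t <- s) (#|P t|%:R)%:E)%E); last first.
  by apply: lee_sum.
rewrite sumEFin lee_fin -natr_sum ler_nat.
under eq_bigr do rewrite -sum1_card.
under eq_bigr do rewrite big_mkcond.
rewrite exchange_big /=.
rewrite -[leqLHS](card_ord k) -sum1_card; apply: leq_sum => i _.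
have ls : l i \in s by rewrite mem_undup (map_f (fun i : 'I_k => l (val i)))// mem_enum.
by rewrite (big_rem (l i))//= inE eqxx.
Qed.

Hypothesis A_disc : negative_spectrum_discrete mu A.

Lemma A_sum n (c : 'I_n -> R[i]) (psi phi : 'I_n -> R -> R[i]) :
  (forall i, A (psi i, phi i)) ->
  A (fun x => \sum_i c i * psi i x, fun x => \sum_i c i * phi i x).
Proof.
have [[_ _ _ A0 Alin] _ _] := A_sa.
elim: n c psi phi => [|n IH] c psi phi Apsi.
  by under eq_fun do rewrite big_ord0; under [X in (_, X)]eq_fun do rewrite big_ord0.
under eq_fun do rewrite big_ord_recl; under [X in (_, X)]eq_fun do rewrite big_ord_recl.
apply: Alin => //.
by apply: (IH (fun i => c (lift ord0 i)) (fun i => psi (lift ord0 i)) (fun i => phi (lift ord0 i))).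
Qed.

(** Induction on the number [k] of known eigenfunctions.  If some negative [t]
that is not yet one of their eigenvalues is in the spectrum, an eigenfunction
for [t] is orthogonal to them.  Otherwise all other negative values are in the
resolvent set; as [k < n], some combination of the [psi i] is orthogonal to the
known eigenfunctions, and [new_negative_eigenfunction] applies to it. *)
Lemma negative_form_bound n (psi phi : 'I_n -> R -> R[i]) :
  (forall i, A (psi i, phi i)) ->
  (forall c : 'I_n -> R[i], (exists i, c i != 0) ->
    complex.Re (inner mu (fun x => \sum_i c i * phi i x)
                         (fun x => \sum_i c i * psi i x)) < 0) ->
  ((n%:R)%:E <= nb_negative_eigenvalues mu A)%E.
Proof.
move=> Apsi neg.
suff [l [e /eigenfamily_le//]] : exists l e, orthogonal_eigenfamily n l e.
suff H k : (k <= n)%N -> exists l e, orthogonal_eigenfamily k l e by exact: H.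
elim: k => [_|k IH kn]; first by exists (fun=> 0), (fun=> fun=> 0); split.
have [l [e [lneg eigen epos eorth]]] := IH (ltnW kn).
have Le i : (i < k)%N -> L2 mu (e i) by move=> /eigen/A_L2[].
suff [t [w [t0 Aw we w0]]] : exists (t : R) w, [/\ t < 0, eigenfunction A t%:C w,
    forall i, (i < k)%N -> inner mu w (e i) = 0 & 0 < complex.Re (inner mu w w)].
  have Lw : L2 mu w by case: (A_L2 Aw).
  have ew i : (i < k)%N -> inner mu (e i) w = 0.
    by move=> ik; rewrite inner_conj ?we ?conjc0//; exact: Le.
  exists (fun i => if i == k then t else l i), (fun i => if i == k then w else e i).
  split=> [i|i|i|i j]; rewrite !ltnS.
  - by case: eqVneq => // ik; rewrite leq_eqVlt (negPf ik); exact: lneg.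
  - by case: eqVneq => // ik; rewrite leq_eqVlt (negPf ik); exact: eigen.
  - by case: eqVneq => // ik; rewrite leq_eqVlt (negPf ik); exact: epos.
  - case: (eqVneq i k) => [->|ik]; case: (eqVneq j k) => [->|jk]; rewrite ?eqxx//.
    + by rewrite (leq_eqVlt j) (negPf jk)/= => _ jk' _; exact: we.
    + by rewrite (leq_eqVlt i) (negPf ik)/= => ik' _ _; exact: ew.
    + rewrite (leq_eqVlt i) (leq_eqVlt j) (negPf ik) (negPf jk); exact: eorth.
have [[t [t0 tl nres]]|allres] := pselect (exists t : R,
    [/\ t < 0, forall i : 'I_k, t != l i & ~ resolvent_set mu A t%:C]).
  have [[u Au u0] _ _] := A_disc t0 nres.
  have Lu : L2 mu u by case: (A_L2 Au).
  exists t, u; split => //; last exact: inner_gt0.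
  move=> i ik.
  have [_ _ Aadj] := A_sa.
  have : adjoint mu A (u, fun x => t%:C * u x) by rewrite -Aadj; exact: Au.
  move=> [_ _ /(_ _ _ (eigen i ik))] /=.
  have Ltu : L2 mu (fun x => t%:C * u x) by exact: L2Z.
  rewrite innerZ; [|exact: Le|exact: Lu].
  rewrite (inner_conj Ltu (Le i ik)) innerZ//; last exact: Le.
  rewrite (inner_conj Lu (Le i ik)).
  set z := inner mu u (e i); case: z => a b.
  move=> /eqP; rewrite eq_complex /= => /andP[/eqP h1 /eqP h2].
  have tli : t - l i != 0 by rewrite subr_eq0; exact: (tl (Ordinal ik)).
  have a0 : (t - l i) * a = 0 by lra.
  have b0 : (t - l i) * b = 0 by lra.
  move/eqP: a0; rewrite mulf_eq0 (negPf tli) => /eqP ->.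
  by move/eqP: b0; rewrite mulf_eq0 (negPf tli) => /eqP ->.
have Lpsi i : L2 mu (psi i) by case: (A_L2 (Apsi i)).
(* A row vector in the kernel of this n by k matrix is the wanted combination. *)
pose G := \matrix_(i < n, j < k) inner mu (psi i) (e j).
have /rowV0Pn[c /sub_kermxP cG c0] : kermx G != 0.
  rewrite -mxrank_eq0 mxrank_ker subn_eq0 -ltnNge.
  exact: leq_ltn_trans (rank_leq_col _) kn.
have ex_c : exists i, c 0 i != 0.
  apply: contrapT => h; move/negP: c0; apply; apply/eqP/rowP => i.
  rewrite mxE; apply/eqP/negPn/negP => ci; apply: h; by exists i.
pose u x := \sum_i c 0 i * psi i x; pose v x := \sum_i c 0 i * phi i x.
have Auv : A (u, v).
  by apply: A_sum.
have ue (i : 'I_k) : inner mu u (e i) = 0.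
  rewrite inner_sum//; last exact: Le.
  have : (c *m G) 0 i = 0 by rewrite cG mxE.
  by rewrite mxE => h; rewrite -[RHS]h; apply: eq_bigr => j _; rewrite mxE.
have res (t : R) : t < 0 -> (forall i : 'I_k, t != l i) -> resolvent_set mu A t%:C.
  by move=> t0 tl; apply: contrapT => h; apply: allres; exists t.
have [i [w [li Aw we w0]]] := new_negative_eigenfunction A_sa
  (fun i : 'I_k => eigen i (ltn_ord i)) res Auv ue (neg _ ex_c).
exists (l i), w; split => // j jk.
exact: (we (Ordinal jk)).
Qed.

End Counting.

(** * Smooth functions, steps and plateaus *)

Section Smooth.
Context {R : realType}.
Implicit Types (f g : R -> R) (x : R) (n : nat).

(** Derivatives are given as witnesses, so that closure properties are proved by
exhibiting the derivative, with no reference to [derive1]. *)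
Fixpoint times_derivable n f : Prop :=
  if n is m.+1 then
    exists2 f', (forall x, is_derive x 1 f (f' x)) & times_derivable m f'
  else True.

Definition smooth_real f := forall n, times_derivable n f.

Lemma times_derivableS n f : times_derivable n.+1 f -> times_derivable n f.
Proof.
elim: n f => [//|n IH] f [f' ff' hf']; exists f' => //; exact: IH.
Qed.

Lemma smooth_is_derive f x : smooth_real f -> is_derive x 1 f (derive1 f x).
Proof.
by move=> /(_ 1)[f' ff' _]; rewrite derive1E (@derive_val _ _ _ _ _ _ _ (ff' x)).
Qed.

Lemma derive1_smooth f : smooth_real f -> smooth_real (derive1 f).
Proof.
move=> sf n; have [f' ff' sf'] := sf n.+1.
have -> // : derive1 f = f'.
by apply/funext => x; rewrite derive1E (@derive_val _ _ _ _ _ _ _ (ff' x)).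
Qed.

Lemma smooth_iter f n : smooth_real f -> smooth_real (derive1n n f).
Proof. by move=> sf; elim: n => //= n; exact: derive1_smooth. Qed.

Lemma smooth_continuous f : smooth_real f -> continuous f.
Proof.
move=> sf x; have h := smooth_is_derive x sf.
by apply: differentiable_continuous; apply/derivable1_diffP; exact: ex_derive.
Qed.

Lemma times_derivable_cst n (c : R) : times_derivable n (fun=> c).
Proof.
elim: n c => [//|n IH] c; exists (fun=> 0); last exact: IH.
by move=> x; exact: is_derive_cst.
Qed.

Lemma times_derivable_id n : times_derivable n (fun x : R => x).
Proof.
case: n => [//|n]; exists (fun=> 1); last exact: times_derivable_cst.
by move=> x; exact: is_derive_id.
Qed.

Lemma times_derivableD n f g : times_derivable n f -> times_derivable n g ->
  times_derivable n (fun x => f x + g x).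
Proof.
elim: n f g => [//|n IH] f g [f' ff' hf] [g' gg' hg].
exists (fun x => f' x + g' x); last exact: IH.
by move=> x; exact: is_deriveD.
Qed.

Lemma times_derivableM n f g : times_derivable n f -> times_derivable n g ->
  times_derivable n (fun x => f x * g x).
Proof.
elim: n f g => [//|n IH] f g sf sg.
have sf1 := times_derivableS sf; have sg1 := times_derivableS sg.
have [f' ff' hf] := sf; have [g' gg' hg] := sg.
exists (fun x => f x * g' x + g x * f' x).
  by move=> x; exact: is_deriveM.
by apply: times_derivableD; exact: IH.
Qed.

Lemma times_derivable_affine n f (a b : R) : times_derivable n f ->
  times_derivable n (fun x => f (a * x + b)).
Proof.
elim: n f => [//|n IH] f [f' ff' hf].
exists (fun x => f' (a * x + b) * a); last first.
  by apply: times_derivableM; [exact: IH|exact: times_derivable_cst].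
move=> x; apply: (@is_derive1_comp _ f (fun x => a * x + b)).
have h1 : is_derive x 1 (fun x : R => a * x) (a *: 1).
  exact: (@is_deriveZ _ _ _ (fun x : R => x) a x 1 1).
have := is_deriveD h1 (@is_derive_cst _ _ _ b x 1).
by move/is_derive_eq; apply; rewrite addr0 scaler1.
Qed.

Lemma times_derivableV n f : (forall x, f x != 0) -> times_derivable n f ->
  times_derivable n (fun x => (f x)^-1).
Proof.
move=> f0; elim: n => [//|n IH] sf.
have {}IH := IH (times_derivableS sf).
have [f' ff' hf] := sf.
exists (fun x => - 1 * ((f x)^-1 * (f x)^-1) * f' x).
  move=> x; have := is_deriveV (f0 x) (ff' x).
  by move/is_derive_eq; apply; rewrite /GRing.scale/= expr2 invfM mulN1r.
apply: times_derivableM => //; apply: times_derivableM; first exact: times_derivable_cst.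
exact: times_derivableM.
Qed.

Lemma is_derive_flat f x (C : R) :
  (forall y, `|f y - f x| <= C * (y - x) ^+ 2) -> is_derive x 1 f 0.
Proof.
move=> fC.
have c0 : h^-1 *: (f (h *: 1 + x) - f x) @[h --> 0^'] --> (0 : R).
  apply/cvgrPdist_le => e e0.
  have C0 : 0 < `|C| + 1 by rewrite ltr_wpDl.
  near=> h.
  have h0 : h != 0 by near: h; exact: nbhs_dnbhs_neq.
  rewrite sub0r normrN normrM normfV.
  rewrite ler_pdivrMl ?normr_gt0//; apply: le_trans (fC _) _.
  rewrite /GRing.scale/= mulr1 addrK -[h ^+ 2]real_normK ?num_real// expr2.
  rewrite mulrCA ler_wpM2l//.
  apply: (@le_trans _ _ ((`|C| + 1) * `|h|)).
    by rewrite ler_wpM2r//; apply: le_trans (ler_norm _) _; rewrite lerDl.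
  rewrite mulrC -ler_pdivlMr//.
  near: h; apply: dnbhs0_le; exact: divr_gt0.
apply: DeriveDef; first by apply/cvg_ex; exists 0; exact: c0.
exact: (cvg_lim (@norm_hausdorff _ _) c0).
Unshelve. all: by end_near. Qed.

(** The functions [x^-m exp(- 1 / x)], extended by 0: a family that contains the
standard flat function and whose span is closed under differentiation. *)
Definition expinv m x : R := if 0 < x then x ^- m * expR (- x^-1) else 0.

Lemma expinv_ge0 m x : 0 <= expinv m x.
Proof.
rewrite /expinv; case: ifPn => // x0.
by rewrite mulr_ge0 ?expR_ge0// invr_ge0 exprn_ge0// ltW.
Qed.

(** From the Taylor term of order [m + 2] of [exp(1 / x)]; the square makes the
derivative at 0 vanish. *)
Lemma expinv_le m x : expinv m x <= (m.+2)`!%:R * x ^+ 2.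
Proof.
rewrite /expinv; case: ifPn => x0; last by rewrite mulr_ge0 ?sqr_ge0.
have xi0 : 0 <= x^-1 by rewrite invr_ge0 ltW.
have := expR_ge1Dxn m.+1 xi0.
rewrite expRN => h.
have {}h : x ^- m.+2 / (m.+2)`!%:R <= expR x^-1.
  by apply: le_trans h; rewrite exprVn lerDr.
rewrite ler_pdivrMr ?expR_gt0//.
rewrite ler_pdivrMr ?ltr0n ?fact_gt0// in h.
have -> : x ^- m = x ^+ 2 * x ^- m.+2.
  rewrite (exprS x m.+1) (exprS x m); field.
  by rewrite expf_neq0 ?gt_eqF.
have -> : (m.+2)`!%:R * x ^+ 2 * expR x^-1 = x ^+ 2 * (expR x^-1 * (m.+2)`!%:R) by ring.
by rewrite ler_wpM2l ?sqr_ge0.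
Qed.

Lemma expinv_is_derive m x :
  is_derive x 1 (expinv m) (expinv m.+2 x - m%:R * expinv m.+1 x).
Proof.
have [x0|x0|->] := ltgtP x 0.
- have e y : y < 0 -> forall k, expinv k y = 0.
    by move=> y0 k; rewrite /expinv ltNge (ltW y0).
  rewrite !e// mulr0 subr0.
  apply: (@near_eq_is_derive _ _ _ (cst 0)).
  by near=> y; rewrite e//; near: y; exact: lt_nbhsl.
- have e y k : 0 < y -> expinv k y = y ^- k * expR (- y^-1).
    by move=> y0; rewrite /expinv y0.
  apply: (@near_eq_is_derive _ _ _ (fun y : R => y ^- m * expR (- y^-1))).
    by near=> y; rewrite e//; near: y; exact: lt_nbhsr.
  have xn0 : x != 0 by rewrite gt_eqF.
  have h1 : is_derive x 1 (fun y : R => y ^+ m) ((m%:R * x ^+ m.-1) *: 1).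
    have -> : (fun y : R => y ^+ m) = (fun y : R => y) ^+ m by rewrite exprfctE.
    exact: (@is_deriveX _ _ (fun y : R => y) m x 1 1).
  have h2 := @is_deriveV _ (fun y : R => y ^+ m) x _ 1 (expf_neq0 m xn0) h1.
  have h3 : is_derive x 1 (fun y : R => y^-1) (- x ^- 2 *: 1).
    exact: (@is_deriveV _ (fun y : R => y) x 1 1).
  have h4 : is_derive x 1 (fun y : R => expR (- y^-1)) (expR (- x^-1) * - (- x ^- 2 *: 1)).
    have h5 := @is_deriveN _ _ _ (fun y : R => y^-1) x 1 _ h3.
    exact: (@is_derive1_comp _ expR (fun y : R => - y^-1) x _ _ (is_derive_expR _) h5).
  have := is_deriveM h2 h4; move/is_derive_eq; apply.
  rewrite !e// /GRing.scale/= !mulr1.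
  case: m {h1 h2} => [|m] /=.
    by rewrite !mul0r expr0 !mulr0; field.
  rewrite !exprS; field.
  by rewrite xn0 expf_neq0.
- have e k : expinv k 0 = 0 by rewrite /expinv ltxx.
  rewrite !e mulr0 subr0.
  apply: (@is_derive_flat _ _ (m.+2)`!%:R) => y.
  by rewrite e !subr0 ger0_norm ?expinv_ge0// expinv_le.
Unshelve. all: by end_near. Qed.

Lemma times_derivable_expinv n m : times_derivable n (expinv m).
Proof.
elim: n m => [//|n IH] m.
exists (fun x => expinv m.+2 x + (- m%:R) * expinv m.+1 x).
  by move=> x; rewrite mulNr; exact: expinv_is_derive.
apply: times_derivableD => //; apply: times_derivableM => //.
exact: times_derivable_cst.
Qed.

Definition step_den x := expinv 0 x + expinv 0 (-1 * x + 1).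
Definition smooth_step x := expinv 0 x * (step_den x)^-1.

Lemma expinv0_gt0 x : 0 < x -> 0 < expinv 0 x.
Proof. by move=> x0; rewrite /expinv x0 expr0 invr1 mul1r expR_gt0. Qed.

Lemma step_den_gt0 x : 0 < step_den x.
Proof.
rewrite /step_den; have [x0|x0] := ltP 0 x.
  by rewrite ltr_pwDl ?expinv_ge0// expinv0_gt0.
by rewrite ltr_wpDl ?expinv_ge0// expinv0_gt0; lra.
Qed.

Lemma smooth_step_smooth : smooth_real smooth_step.
Proof.
move=> n; apply: times_derivableM; first exact: times_derivable_expinv.
apply: times_derivableV; first by move=> x; rewrite gt_eqF ?step_den_gt0.
apply: times_derivableD; first exact: times_derivable_expinv.
by apply: (times_derivable_affine (-1) 1); exact: times_derivable_expinv.
Qed.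

Lemma smooth_step_le0 x : x <= 0 -> smooth_step x = 0.
Proof. by move=> x0; rewrite /smooth_step /expinv ltNge x0 mul0r. Qed.

Lemma smooth_step_ge1 x : 1 <= x -> smooth_step x = 1.
Proof.
move=> x1; rewrite /smooth_step /step_den.
have -> : expinv 0 (-1 * x + 1) = 0.
  by rewrite /expinv; case: ifPn => //; lra.
by rewrite addr0 mulfV// gt_eqF// expinv0_gt0//; lra.
Qed.

Lemma smooth_step_01 x : 0 <= smooth_step x <= 1.
Proof.
apply/andP; split.
  by rewrite mulr_ge0 ?expinv_ge0// invr_ge0 ltW// step_den_gt0.
by rewrite /smooth_step ler_pdivrMr ?step_den_gt0// mul1r /step_den lerDl expinv_ge0.
Qed.

Definition plateau x := smooth_step (2 * x + 2) * smooth_step (-2 * x + 2).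

Lemma plateau_smooth : smooth_real plateau.
Proof.
by move=> n; apply: times_derivableM; apply: times_derivable_affine; exact: smooth_step_smooth.
Qed.

Lemma plateau1 x : `|x| <= 2^-1 -> plateau x = 1.
Proof.
rewrite ler_norml => /andP[h1 h2].
have a1 : 1 <= 2 * x + 2 by lra.
have a2 : 1 <= -2 * x + 2 by lra.
by rewrite /plateau !smooth_step_ge1// mulr1.
Qed.

Lemma plateau0 x : 1 <= `|x| -> plateau x = 0.
Proof.
case: ger0P => x0 h.
  have a1 : -2 * x + 2 <= 0 by lra.
  by rewrite /plateau (smooth_step_le0 a1) mulr0.
have a1 : 2 * x + 2 <= 0 by lra.
by rewrite /plateau (smooth_step_le0 a1) mul0r.
Qed.

Lemma plateau_01 x : 0 <= plateau x <= 1.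
Proof.
have /andP[a1 a2] := smooth_step_01 (2 * x + 2).
have /andP[b1 b2] := smooth_step_01 (-2 * x + 2).
by rewrite mulr_ge0//= mulr_ile1.
Qed.

Lemma smooth_cst (c : R) : smooth_real (fun=> c).
Proof. by move=> n; exact: times_derivable_cst. Qed.
Lemma smooth_id : smooth_real (fun x : R => x).
Proof. by move=> n; exact: times_derivable_id. Qed.
Lemma smoothD f g : smooth_real f -> smooth_real g -> smooth_real (fun x => f x + g x).
Proof. by move=> sf sg n; exact: times_derivableD. Qed.
Lemma smoothM f g : smooth_real f -> smooth_real g -> smooth_real (fun x => f x * g x).
Proof. by move=> sf sg n; exact: times_derivableM. Qed.
Lemma smooth_affine f (a b : R) : smooth_real f -> smooth_real (fun x => f (a * x + b)).
Proof. by move=> sf n; exact: times_derivable_affine. Qed.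

End Smooth.

(** * Pairings of real test functions *)

Section RealL2Bounds.
Context d (T : measurableType d) (R : realType) (mu : {measure set T -> \bar R}).
Local Notation L2r := (Lfun mu 2%:E).
Implicit Types f g h : T -> R.

Lemma rip_cauchy_schwarz f g : f \in L2r -> g \in L2r ->
  rip mu f g ^+ 2 <= rip mu f f * rip mu g g.
Proof.
move=> hf hg.
have sP : semi_inner (fun p q : LfunType mu (lee1n 2 : (1 <= 2%:E :> \bar R)%E) => rip mu p q).
  split=> [u v|a u v w|u].
  - exact: rip_sym.
  - have -> : (a *: u + v : LfunType _ _) = (fun x => a * u x + v x) :> (T -> R) by reflexivity.
    by rewrite (@ripD _ _ _ mu (fun x => a * u x)) ?ripZ//; try exact: LfunP; apply: Lfun2Z; exact: LfunP.
  - exact: rip_ge0.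
exact: (cauchy_schwarz sP (Lfun_Sub (lee1n 2) hf) (Lfun_Sub (lee1n 2) hg)).
Qed.

(** Stated with an almost everywhere bound because elements of the domain of [A]
are only known up to null sets. *)
Lemma Lfun2_ae_bounded f (S : set T) (C s : R) : measurable_fun setT f ->
  measurable S -> (mu S <= s%:E)%E -> (forall x, ~ S x -> f x = 0) ->
  {ae mu, forall x, S x -> `|f x| <= C} -> f \in L2r /\ rip mu f f <= C ^+ 2 * s.
Proof.
move=> mf mS muS fS fC.
have C2 : 0 <= C ^+ 2 by exact: sqr_ge0.
have h : (\int[mu]_x (f x ^+ 2)%:E <= (C ^+ 2 * s)%:E)%E.
  rewrite EFinM; apply: (@le_trans _ _ ((C ^+ 2)%:E * mu S)%E); last by rewrite lee_wpmul2l.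
  rewrite -[S in mu S]setIT -integral_indic//.
  have mi : measurable_fun setT (fun x => (\1_S x : R)%:E).
    by apply/measurable_EFinP; exact: measurable_indic.
  have i0 x : setT x -> (0 <= (\1_S x : R)%:E)%E by rewrite lee_fin.
  rewrite -(ge0_integralZl_EFin mu measurableT i0 mi C2).
  apply: ae_ge0_le_integral => //.
  - by move=> x _; rewrite lee_fin sqr_ge0.
  - by apply/measurable_EFinP; exact: measurable_funX.
  - by move=> x _; rewrite -EFinM lee_fin mulr_ge0.
  - by apply: measurable_funeM.
  move: fC; apply: filterS => x fC _; rewrite -EFinM lee_fin indicE.
  have [Sx|Sx] := pselect (S x).
    rewrite mem_set// mulr1 -[leLHS]real_normK ?num_real//.
    by rewrite ler_pXn2r ?nnegrE ?fC// (le_trans _ (fC Sx)).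
  by rewrite fS// expr0n/= mulr_ge0.
have hf : f \in L2r by apply: Lfun2P => //; apply: le_lt_trans h _; rewrite ltry.
by split => //; rewrite -lee_fin rip_EFin.
Qed.

Lemma Lfun2_bounded f (S : set T) (C s : R) : measurable_fun setT f ->
  measurable S -> (mu S <= s%:E)%E -> (forall x, ~ S x -> f x = 0) ->
  (forall x, S x -> `|f x| <= C) -> f \in L2r /\ rip mu f f <= C ^+ 2 * s.
Proof. by move=> mf mS muS fS fC; apply: (Lfun2_ae_bounded mf mS muS fS); exact: (@filterE _ _ (ae_filter_ringOfSetsType mu)). Qed.

Lemma Rintegral_support f (D : set T) : (forall x, ~ D x -> f x = 0) ->
  \int[mu]_x f x = \int[mu]_(x in D) f x.
Proof.
move=> fD; rewrite [RHS]Rintegral_mkcond; congr (Rintegral _ _ _).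
apply/funext => x; rewrite patchE; case: ifPn => //.
by rewrite notin_setE => /fD.
Qed.

Lemma ripB2 f g f' g' : f \in L2r -> g \in L2r -> f' \in L2r -> g' \in L2r ->
  rip mu f g - rip mu f' g' = \int[mu]_x (f x * g x - f' x * g' x).
Proof.
by move=> hf hg hf' hg'; rewrite -RintegralB//; apply: Lfun2_mul_integrable.
Qed.

End RealL2Bounds.

Section Calculus.
Context {R : realType}.
Local Notation mu := (@lebesgue_measure R).
Local Notation L2r := (Lfun mu 2%:E).
Implicit Types (f g : R -> R) (x : R).

Lemma mu_segment (a b : R) : a <= b -> mu `[a, b] = (b - a)%:E.
Proof.
move=> ab; have /= := lebesgue_measure_itv `[a, b].
rewrite lte_fin; case: ltP => [_|ba]; first by rewrite EFinB.
by have -> : a = b by [apply/eqP; rewrite eq_le ab ba]; rewrite subrr.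
Qed.

Lemma mu_segment_le (a b : R) : a <= b -> (mu `[a, b] <= (b - a)%:E)%E.
Proof. by move=> ab; rewrite mu_segment. Qed.

Lemma derive1_eq_on (O : set R) f g : open O -> (forall x, O x -> f x = g x) ->
  forall x, O x -> derive1 f x = derive1 g x.
Proof.
move=> oO fg x Ox; rewrite !derive1E; apply: near_eq_derive.
by move: (open_nbhs_nbhs (conj oO Ox)); apply: filterS => y /fg.
Qed.

Lemma FTC (F : R -> R) f (a b : R) : a <= b -> (forall x, is_derive x 1 F (f x)) ->
  continuous f -> \int[mu]_(x in `[a, b]) f x = F b - F a.
Proof.
rewrite le_eqVlt => /predU1P[->|ab] Ff cf.
  by rewrite subrr set_itv1 Rintegral_set1.
have cF : continuous F.
  move=> x; apply: differentiable_continuous; apply/derivable1_diffP.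
  exact: ex_derive.
rewrite /Rintegral (@continuous_FTC2 _ f F)//.
- exact: continuous_subspaceT.
- split.
  + by move=> x _; exact: ex_derive.
  + by apply: cvg_at_right_filter; exact: cF.
  + by apply: cvg_at_left_filter; exact: cF.
- by move=> x _; rewrite derive1E derive_val.
Qed.

(** The real counterpart of [test_function]. *)
Definition real_test (O : set R) g := smooth_real g /\
  exists K : set R, [/\ compact K, K `<=` O & forall x, ~ K x -> g x = 0].

Lemma continuous_bounded f (M : R) : continuous f ->
  exists C, 0 <= C /\ forall x, `|x| <= M -> `|f x| <= C.
Proof.
move=> cf; have [M0|M0] := ltP M 0.
  exists 0; split => // x; move/le_lt_trans => /(_ _ M0).
  by rewrite normr_lt0.
have cn : {within `[- M, M], continuous (fun x => `|f x|)}.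
  by apply: continuous_subspaceT => x; apply: cvg_norm; exact: cf.
have le : - M <= M by lra.
have [c _ hc] := EVT_max le cn.
exists `|f c|; split => // x xM; apply: hc.
by rewrite in_itv/= -ler_norml.
Qed.

Lemma real_test_support O g : real_test O g ->
  exists2 M, 0 < M & forall x, M < `|x| -> g x = 0.
Proof.
move=> [_ [K [/compact_bounded [M [_ hM]] _ gK]]].
exists (Num.max 1 (M + 1)); first by rewrite lt_max ltr01.
move=> x xM; apply: gK => Kx.
have := hM (M + 1) _ x Kx; rewrite ltrDl ltr01 => /(_ isT) /= h.
by move: xM; rewrite gt_max => /andP[_]; rewrite ltNge h.
Qed.

Lemma real_test_L2 O g : real_test O g -> g \in L2r.
Proof.
move=> tg; have [sg _] := tg; have [M M0 gM] := real_test_support tg.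
have [C [C0 hC]] := continuous_bounded M (smooth_continuous sg).
have [] // := @Lfun2_bounded _ _ R mu g `[- M, M] C (M - (- M)).
- apply: continuous_measurable_fun; exact: smooth_continuous.
- by apply: mu_segment_le; lra.
- by move=> x /=; rewrite in_itv/= -ler_norml => /negP; rewrite -ltNge => /gM.
- by move=> x /=; rewrite in_itv/= -ler_norml; exact: hC.
Qed.

Lemma real_test_derive O g : real_test O g -> real_test O (derive1 g).
Proof.
move=> [sg [K [cK KO gK]]]; split; first exact: derive1_smooth.
exists K; split => // x Kx.
rewrite (@derive1_eq_on (~` K) g (cst 0))//; first exact: derive1_cst.
by apply: closed_openC; exact: (compact_closed (@norm_hausdorff _ _)).
Qed.

Lemma real_test_sub O O' g : O `<=` O' -> real_test O g -> real_test O' g.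
Proof.
move=> OO' [sg [K [cK KO gK]]]; split => //; exists K; split => //.
exact: subset_trans OO'.
Qed.

Lemma is_derive_wronskian (f g f1 g1 : R -> R) (x a b : R) :
  is_derive x 1 f (f1 x) -> is_derive x 1 g (g1 x) ->
  is_derive x 1 f1 a -> is_derive x 1 g1 b ->
  is_derive x 1 (fun x => f1 x * g x - f x * g1 x) (a * g x - f x * b).
Proof.
move=> hf hg hf1 hg1.
have := is_deriveB (is_deriveM hf1 hg) (is_deriveM hf hg1).
by move/is_derive_eq; apply; rewrite /GRing.scale/=; ring.
Qed.

(** The Wronskian [f' g - f g'] is an antiderivative of the difference of the
integrands and vanishes far away. *)
Lemma green f g : real_test setT f -> real_test setT g ->
  rip mu (derive1 (derive1 f)) g = rip mu f (derive1 (derive1 g)).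
Proof.
move=> tf tg; have [sf _] := tf; have [sg _] := tg.
have tf2 := real_test_derive (real_test_derive tf).
have tg2 := real_test_derive (real_test_derive tg).
apply/eqP; rewrite -subr_eq0; apply/eqP.
have L2f := real_test_L2 tf; have L2g := real_test_L2 tg.
rewrite (ripB2 (real_test_L2 tf2) L2g L2f (real_test_L2 tg2)).
have [M M0 gM] := real_test_support tg.
have [M' M0' gM'] := real_test_support (real_test_derive tg).
have [M'' M0'' gM''] := real_test_support tg2.
pose B := M + M' + M''.
have gB x : B < `|x| -> [/\ g x = 0, derive1 g x = 0 & derive1 (derive1 g) x = 0].
  by move=> xB; split; [apply: gM|apply: gM'|apply: gM'']; rewrite /B in xB; lra.
pose F x := derive1 f x * g x - f x * derive1 g x.
pose F' x := derive1 (derive1 f) x * g x - f x * derive1 (derive1 g) x.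
have FF' x : is_derive x 1 F (F' x).
  apply: is_derive_wronskian; apply: smooth_is_derive => //; exact: derive1_smooth.
have cF' : continuous F'.
  have [sf2 _] := tf2; have [sg2 _] := tg2.
  move=> x; apply: cvgB; apply: cvgM; exact: smooth_continuous.
have BB : - (B + 1) <= B + 1 by rewrite /B; lra.
rewrite (@Rintegral_support _ _ _ mu _ `[- (B + 1), B + 1]); last first.
  move=> x /=; rewrite in_itv/= -ler_norml => /negP; rewrite -ltNge => xB.
  have [|g0 _ g2] := gB x; first by lra.
  by rewrite g0 g2 !mulr0 subrr.
rewrite (FTC BB FF' cF').
have FB x : `|x| = B + 1 -> F x = 0.
  move=> xB; have [|g0 g1 _] := gB x; first by rewrite xB ltrDl.
  by rewrite /F g0 g1 !mulr0 subrr.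
by rewrite !FB ?subrr// ?normrN ger0_norm// /B; lra.
Qed.

End Calculus.

(** * A function orthogonal to test functions off a null set *)

Section DuBoisReymond.
Context {R : realType}.
Local Notation mu := (@lebesgue_measure R).
Local Notation L2r := (Lfun mu 2%:E).
Implicit Types (f g : R -> R) (x : R).

Lemma indic_segment_L2 (a b : R) : a <= b -> (\1_(`[a, b]) : R -> R) \in L2r.
Proof.
move=> ab; have [] // := @Lfun2_bounded _ _ R mu (\1_(`[a, b])) `[a, b] 1 (b - a).
- exact: mu_segment_le.
- by move=> x abx; rewrite indicE memNset.
- by move=> x abx; rewrite indicE mem_set//= normr1.
Qed.

Lemma rip_indic g (a b : R) : rip mu g (\1_(`[a, b]) : R -> R) = \int[mu]_(x in `[a, b]) g x.
Proof.
rewrite /rip (@Rintegral_support _ _ _ mu _ `[a, b]).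
  apply: eq_Rintegral => x; rewrite inE => abx.
  by rewrite indicE mem_set// mulr1.
by move=> x abx; rewrite indicE memNset// mulr0.
Qed.

Let small_square_absurd (r q h : R) : 0 <= r -> 0 < h ->
  h * (4 * (r + 1)) <= q -> q <= r * (2 * h) -> False.
Proof. by move=> r0 h0 h1 h2; have := mulr_ge0 r0 (ltW h0); lra. Qed.

(** The indicator of the segment differs from a test function on two
intervals of length [h], which by Cauchy-Schwarz costs at most a multiple of the
square root of [h]. *)
Lemma segment_integral_eq0 (O : set R) g (a b : R) : g \in L2r ->
  (forall phi, real_test O phi -> rip mu g phi = 0) -> a < b ->
  `[a, b] `<=` O -> \int[mu]_(x in `[a, b]) g x = 0.
Proof.
move=> hg gO ab abO; rewrite -rip_indic.
have hI := indic_segment_L2 (ltW ab).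
set I := (\1_(`[a, b]) : R -> R) in hI *.
have key h : 0 < h -> 2 * h <= b - a -> rip mu g I ^+ 2 <= rip mu g g * (2 * h).
  move=> h0 hab.
  pose phi x := smooth_step (h^-1 * x + - (h^-1 * a)) * smooth_step (- h^-1 * x + h^-1 * b).
  have tphi : real_test O phi.
    split.
      by apply: smoothM; apply: smooth_affine; exact: smooth_step_smooth.
    exists `[a, b]%classic; split => //; first exact: segment_compact.
    move=> x /=; rewrite in_itv/= => /negP; rewrite negb_and -!ltNge => /orP[xa|xb].
      rewrite /phi smooth_step_le0 ?mul0r// -mulrBr.
      by rewrite pmulr_rle0 ?invr_gt0// subr_le0 ltW.
    rewrite /phi [X in _ * X]smooth_step_le0 ?mulr0// mulNr addrC -mulrBr.
    by rewrite pmulr_rle0 ?invr_gt0// subr_le0 ltW.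
  have phi01 x : 0 <= phi x <= 1.
    rewrite /phi; have /andP[a1 a2] := smooth_step_01 (h^-1 * x + - (h^-1 * a)).
    have /andP[b1 b2] := smooth_step_01 (- h^-1 * x + h^-1 * b).
    by rewrite mulr_ge0//= mulr_ile1.
  have phi1 x : a + h <= x -> x <= b - h -> phi x = 1.
    move=> xa xb; rewrite /phi !smooth_step_ge1 ?mulr1//.
      by rewrite mulNr addrC -mulrBr ler_pdivlMl// mulr1; lra.
    by rewrite -mulrBr ler_pdivlMl// mulr1; lra.
  have phi0 x : ~ `[a, b]%classic x -> phi x = 0.
    move=> /=; rewrite in_itv/= => /negP; rewrite negb_and -!ltNge => /orP[xa|xb].
      rewrite /phi smooth_step_le0 ?mul0r// -mulrBr.
      by rewrite pmulr_rle0 ?invr_gt0// subr_le0 ltW.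
    rewrite /phi [X in _ * X]smooth_step_le0 ?mulr0// mulNr addrC -mulrBr.
    by rewrite pmulr_rle0 ?invr_gt0// subr_le0 ltW.
  have hphi := real_test_L2 tphi.
  pose D x := I x - phi x.
  have hD : D \in L2r by exact: Lfun2B.
  have gD : rip mu g I = rip mu g D.
    rewrite (rip_sym mu g I) (rip_sym mu g D).
    have -> : I = fun x => D x + phi x by apply/funext => x; rewrite /D subrK.
    by rewrite ripD// (rip_sym mu phi) gO// addr0.
  rewrite gD; apply: le_trans (rip_cauchy_schwarz hg hD) _.
  rewrite ler_wpM2l ?rip_ge0//.
  have [] := @Lfun2_bounded _ _ R mu D (`[a, a + h] `|` `[b - h, b]) 1 (2 * h).
  - exact: (Lfun2_measurable hD).
  - exact: measurableU.
  - apply: le_trans (measureU2 _ _ _) _ => //.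
    have le1 : a <= a + h by lra.
    have le2 : b - h <= b by lra.
    have m1 := mu_segment_le le1; have m2 := mu_segment_le le2.
    apply: le_trans (leeD m1 m2) _; rewrite -EFinD lee_fin; lra.
  - move=> x /not_orP[] /=; rewrite !in_itv/= => xa xb.
    rewrite /D /I indicE.
    have [abx|abx] := pselect (`[a, b]%classic x); last first.
      by rewrite memNset//= phi0// subr0.
    rewrite mem_set//= phi1 ?subrr//; move: abx; rewrite /= in_itv/= => /andP[ax xb'].
      by rewrite leNgt; apply/negP => h1; apply: xa; rewrite ax/= ltW.
    by rewrite leNgt; apply/negP => h1; apply: xb; rewrite xb' andbT ltW.
  - move=> x _; rewrite /D /I indicE; have /andP[p0 p1] := phi01 x.
    have [abx|abx] := pselect (`[a, b]%classic x).
      by rewrite mem_set//= ger0_norm; lra.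
    by rewrite memNset//= phi0// subr0 normr0.
  - by move=> _; rewrite expr1n mul1r.
apply/eqP; rewrite -sqrf_eq0 eq_le sqr_ge0 andbT leNgt; apply/negP => I0.
pose h := Num.min ((b - a) / 2) (rip mu g I ^+ 2 / (4 * (rip mu g g + 1))).
have gg0 : 0 <= rip mu g g by exact: rip_ge0.
have g4 : 0 < 4 * (rip mu g g + 1) by lra.
have h0 : 0 < h by rewrite lt_min !divr_gt0// subr_gt0.
have hab : 2 * h <= b - a.
  have : h <= (b - a) / 2 by rewrite ge_min lexx.
  lra.
have hq : h * (4 * (rip mu g g + 1)) <= rip mu g I ^+ 2.
  by rewrite -ler_pdivlMr// ge_min lexx orbT.
exact: (small_square_absurd gg0 h0 hq (key h h0 hab)).
Qed.

Lemma L2_integrable_segment g (a b : R) (K : set R) : g \in L2r -> a <= b ->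
  measurable (K : set (measurableTypeR R)) -> K `<=` `[a, b]%classic ->
  mu.-integrable K (EFin \o g).
Proof.
move=> hg ab mK KB.
have := Lfun2_mul_integrable hg (indic_segment_L2 ab).
move=> /integrableS => /(_ K measurableT mK (@subsetT _ _)).
apply: eq_integrable => // x.
by rewrite inE => /KB Bx /=; rewrite indicE mem_set// mulr1.
Qed.

Lemma L2_locally_integrable g : g \in L2r -> locally_integrable setT g.
Proof.
move=> hg; have mg := Lfun2_measurable hg; split; [exact: mg|exact: openT|].
move=> K _ cK; have [M [_ hM]] := compact_bounded cK.
pose B := `|M| + 1.
have KB x : K x -> `[- B, B]%classic x.
  move=> Kx; rewrite /= in_itv/= -ler_norml; apply: (hM B) => //.
  by rewrite /B ltr_pwDr// ler_norm.
have B0 : - B <= B by rewrite /B; have := normr_ge0 M; lra.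
have mK : measurable (K : set (measurableTypeR R)).
  by apply: closed_measurable; exact: (compact_closed (@norm_hausdorff _ _)).
by have /integrableP[] := L2_integrable_segment hg B0 mK KB.
Qed.

Let ball_double (q x y : R) : 0 < 2 * q -> x - q <= y -> y <= x + q ->
  `|x - y| < 2 * q.
Proof. by move=> *; rewrite ltr_norml; apply/andP; split; lra. Qed.

Let ball_lt (q r x y : R) : q < r -> x - q <= y -> y <= x + q -> `|x - y| < r.
Proof. by move=> *; rewrite ltr_norml; apply/andP; split; lra. Qed.

(** Almost every point is off [Gamma] and is a Lebesgue point of [g], where [g] is
the limit of its averages over small segments; these averages are 0. *)
Lemma du_Bois_Reymond (Gamma : set R) g : closed Gamma -> mu Gamma = 0%E ->
  g \in L2r -> (forall phi, real_test (~` Gamma) phi -> rip mu g phi = 0) ->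
  g = (fun=> 0) %[ae mu].
Proof.
move=> cG G0 hg gG.
have lg := L2_locally_integrable hg.
have aeG : {ae mu, forall x, ~ Gamma x}.
  exists Gamma; split => //; first exact: closed_measurable.
  by move=> x /contrapT.
have rp n : 0 < 2 * (n.+1%:R^-1 : R) by rewrite mulr_gt0 ?invr_gt0.
pose E x n : set R := `[x - n.+1%:R^-1, x + n.+1%:R^-1]%classic.
have in0 (n : nat) : 0 <= (n.+1%:R^-1 : R) by rewrite invr_ge0.
have muE x n : mu (E x n) = (2 * n.+1%:R^-1)%:E.
  have seg (y q : R) : 0 <= q -> y - q <= y + q by lra.
  have len (y q : R) : y + q - (y - q) = 2 * q by ring.
  by rewrite -(len x) -mu_segment//; exact: seg.
have hE x : nicely_shrinking x (E x).
  split; first by move=> n; exact: measurable_itv.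
  exists (2, fun n => PosNum (rp n)); split => //=.
  - rewrite -[0 in X in _ --> X](mulr0 2); apply: cvgMl_tmp; exact: cvg_harmonic.
  - move=> n y; rewrite /E /= in_itv/= => /andP[y1 y2].
    exact: (ball_double (rp n) y1 y2).
  - move=> n; rewrite lebesgue_measure_ball; last by rewrite ltW.
    by rewrite muE -EFinM lee_fin !mulr_natl.
have := lebesgue_differentiation lg.
move: aeG; apply: (@filterS2 _ _ (ae_filter_ringOfSetsType mu)) => x Gx ptx _.
have cvx := nice_lebesgue_differentiation hE lg ptx.
have [r /= r0 rG] : exists2 r : R, 0 < r & ball x r `<=` ~` Gamma.
  have : nbhs x (~` Gamma) by apply: open_nbhs_nbhs; split => //; exact: closed_openC.
  by move=> /nbhs_ballP[r /= r0 rG]; exists r.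
suff : (0 : \bar R)%E = (g x)%:E by move=> [].
apply: (cvg_unique (@ereal_hausdorff R) _ cvx).
apply: (@cvg_near_cst _ _ _ _ _ _).
have : \forall n \near \oo, (n.+1%:R^-1 : R) < r.
  have /cvgrPdist_lt/(_ r r0) := @cvg_harmonic R; apply: filterS => n /=.
  by rewrite sub0r normrN ger0_norm ?invr_ge0.
apply: filterS => n nr.
have EG : E x n `<=` ~` Gamma.
  apply: subset_trans rG => y; rewrite /E /= in_itv/= => /andP[y1 y2].
  exact: (ball_lt nr y1 y2).
have seg (y q : R) : 0 < q -> y - q < y + q by lra.
have in1 : 0 < (n.+1%:R^-1 : R) by rewrite invr_gt0.
have h := seg x _ in1.
have := segment_integral_eq0 hg gG h EG.
rewrite /Rintegral => e0.
have mE : measurable (E x n : set (measurableTypeR R)) by exact: measurable_itv.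
have iE : mu.-integrable (E x n) (EFin \o g).
  by apply: (L2_integrable_segment hg (ltW h)).
have := integrable_fin_num mE iE.
move=> /fineK; rewrite e0 => intE.
have -> : (\int[mu]_(y in E x n) (g y)%:E = 0)%E by rewrite -intE.
by rewrite mule0.
Qed.

End DuBoisReymond.

(** * The action of the operator on cutoff functions *)

Section Embedding.
Local Open Scope complex_scope.
Context {R : realType}.
Local Notation mu := (@lebesgue_measure R).
Local Notation L2r := (Lfun mu 2%:E).
Implicit Types (f g : R -> R) (x : R).

(** All test and trial functions are real valued. *)
Definition emb g : R -> R[i] := fun x => (g x)%:C.

Lemma reF_emb g : reF (emb g) = g. Proof. by []. Qed.
Lemma imF_emb g : imF (emb g) = fun=> 0. Proof. by []. Qed.

Lemma cderiv_emb g : cderiv (emb g) = emb (derive1 g).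
Proof.
apply/funext => x; rewrite /cderiv reF_emb imF_emb.
by rewrite (_ : derive1 (fun=> 0) x = 0)//; exact: derive1_cst.
Qed.

Lemma iter_cderiv_emb n g : iter n cderiv (emb g) = emb (derive1n n g).
Proof. by elim: n => //= n ->; rewrite cderiv_emb. Qed.

Lemma smooth_emb g : smooth_real g -> smooth (emb g).
Proof.
move=> sg n x; rewrite iter_cderiv_emb; split.
  by rewrite reF_emb; have h := smooth_is_derive x (smooth_iter n sg); exact: ex_derive.
by rewrite imF_emb; exact: derivable_cst.
Qed.

Lemma test_emb O g : real_test O g -> test_function O (emb g).
Proof.
move=> [sg [K [cK KO gK]]]; split; first exact: smooth_emb.
by exists K; split => // x /gK; rewrite /emb => ->.
Qed.

Lemma L2_emb g : g \in L2r -> L2 mu (emb g).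
Proof. by move=> hg; split; [rewrite reF_emb|rewrite imF_emb; exact: Lfun2_0]. Qed.

Lemma inner_emb u g : L2 mu u -> g \in L2r ->
  inner mu u (emb g) = rip mu (reF u) g +i* rip mu (imF u) g.
Proof.
move=> Lu hg; rewrite innerE//; last exact: L2_emb.
rewrite reF_emb imF_emb (rip_sym mu (imF u) (fun=> 0)) (rip_sym mu (reF u) (fun=> 0)).
by rewrite !rip0 addr0 subr0.
Qed.

Variables (Gamma : set R) (A : set ((R -> R[i]) * (R -> R[i]))).
Hypotheses (Gamma_closed : closed Gamma) (Gamma_null : mu Gamma = 0%E).
Hypotheses (A_sa : self_adjoint mu A) (A_delta' : delta'_interaction Gamma A).

(** A cutoff function is in the domain by hypothesis, but its image is not given.
Pairing with test functions supported off [Gamma], which belong to [Lmin] and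
hence to [A], identifies the image with [- chi''] up to a function orthogonal to
all of them. *)
Lemma cutoff_image chi : real_test setT chi -> real_test (~` Gamma) (derive1 chi) ->
  A (emb chi, emb (fun x => - derive1 (derive1 chi) x)).
Proof.
move=> tchi tchi'; have [Lmin_A _ _ cut] := A_delta'.
have [[AL2 Asat _ _ _] _ Aadj] := A_sa.
have [w Aw] : dom A (emb chi).
  by apply: cut; split; [exact: test_emb|rewrite cderiv_emb; exact: test_emb].
have [_ Lw] := AL2 _ Aw; rewrite /= in Lw.
have [Lwr Lwi] := Lw.
have L2chi := real_test_L2 tchi.
have L2chi2 := real_test_L2 (real_test_derive (real_test_derive tchi)).
have pair phi : real_test (~` Gamma) phi ->
    rip mu (reF w) phi = - rip mu (derive1 (derive1 chi)) phi /\ rip mu (imF w) phi = 0.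
  move=> tphi; have L2phi := real_test_L2 tphi.
  have tphiT : real_test setT phi by exact: real_test_sub tphi.
  have L2phi2 := real_test_L2 (real_test_derive (real_test_derive tphi)).
  have : A (emb phi, emb (fun x => - derive1 (derive1 phi) x)).
    apply: Lmin_A; exists (emb phi); first exact: test_emb.
    congr (_, _); apply/funext => x; rewrite !cderiv_emb /emb.
    by rewrite rmorphN.
  rewrite {1}Aadj => -[_ _ /(_ _ _ Aw)] /=.
  rewrite inner_emb// inner_emb//; [|exact: L2_emb|exact: Lfun2N].
  rewrite reF_emb imF_emb rip0 => -[-> ->]; split => //.
  by rewrite (green tchi tphiT) ripNr.
apply: (Asat _ _ _ _ Aw).
- exact: L2_emb.
- by apply: L2_emb; exact: Lfun2N.
- exact: ae_eq_refl.
have hr : (fun x => reF w x + derive1 (derive1 chi) x) = (fun=> 0) %[ae mu].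
  apply: (du_Bois_Reymond Gamma_closed Gamma_null).
    exact: Lfun2D.
  move=> phi tphi; have [h1 _] := pair _ tphi.
  by rewrite ripD ?h1 ?addNr//; exact: real_test_L2 tphi.
have hi : imF w = (fun=> 0) %[ae mu].
  apply: (du_Bois_Reymond Gamma_closed Gamma_null) => // phi tphi.
  by have [] := pair _ tphi.
move: hr hi; apply: (@filterS2 _ _ (ae_filter_ringOfSetsType mu)) => x /= + + _.
move=> /(_ I) /eqP; rewrite addr_eq0 => /eqP h1 /(_ I); move: h1; rewrite /reF /imF /emb.
by case: (w x) => a b /= -> ->.
Qed.

End Embedding.

(** * One-sided expansions at a point *)

Section OneSided.
Context {R : realType}.
Local Notation mu := (@lebesgue_measure R).
Local Notation L2r := (Lfun mu 2%:E).
Implicit Types (f g : R -> R) (x : R).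

Lemma mean_value_deviation f (d delta a b : R) : a < b ->
  (forall x, a <= x <= b -> derivable f x 1 /\ `|derive1 f x - d| <= delta) ->
  `|f b - f a - d * (b - a)| <= delta * (b - a).
Proof.
move=> ab fd.
have ba0 : 0 < b - a by rewrite subr_gt0.
have der x : x \in `]a, b[ -> is_derive x 1 f (derive1 f x).
  rewrite in_itv/= => /andP[xa xb].
  have [dx _] : derivable f x 1 /\ `|derive1 f x - d| <= delta.
    by apply: fd; rewrite !ltW.
  by apply: DeriveDef => //; rewrite derive1E.
have cont : {within `[a, b], continuous f}.
  apply: derivable_within_continuous => x; rewrite in_itv/= => /fd[].
  by [].
have [c] := MVT ab der cont.
rewrite in_itv/= => /andP[ca cb] ->.
have [_ dc] : derivable f c 1 /\ `|derive1 f c - d| <= delta.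
  by apply: fd; rewrite !ltW.
by rewrite -mulrBl normrM (gtr0_norm ba0) ler_wpM2r// ltW.
Qed.

(** Apply the mean value inequality between [s] and [x] and let [s] tend to [x0]:
[f] itself is not continuous at [x0]. *)
Lemma right_expansion f (x0 a d : R) :
  (\forall x \near x0^'+, derivable f x 1) ->
  f x @[x --> x0^'+] --> a -> derive1 f x @[x --> x0^'+] --> d ->
  forall delta, 0 < delta -> exists2 rho, 0 < rho & forall x, x0 < x < x0 + rho ->
    `|f x - a - d * (x - x0)| <= delta * (x - x0).
Proof.
move=> df fa f'd delta delta0.
have : \forall x \near x0^'+, derivable f x 1 /\ `|derive1 f x - d| <= delta.
  move/cvgrPdist_le : f'd => /(_ _ delta0); move: df; apply: filterS2 => x ? h; split => //.
  by rewrite distrC.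
rewrite /at_right near_withinE => /nbhs_ballP[rho /= rho0 H].
exists rho => // x /andP[x0x xrho].
have hs s : x0 < s -> s < x -> `|f x - f s - d * (x - s)| <= delta * (x - s).
  move=> x0s sx; apply: mean_value_deviation => // y /andP[sy yx].
  apply: H => /=; last exact: lt_le_trans sy.
  by rewrite /ball/= ltr_norml; apply/andP; split; lra.
have c1 : `|f x - f s - d * (x - s)| @[s --> x0^'+] --> `|f x - a - d * (x - x0)|.
  have cid : s @[s --> x0^'+] --> x0 by apply: cvg_at_right_filter; exact: cvg_id.
  apply: cvg_norm; apply: cvgB.
    by apply: cvgB => //; exact: cvg_cst.
  by apply: cvgMl_tmp; apply: cvgB => //; exact: cvg_cst.
have c2 : delta * (x - s) @[s --> x0^'+] --> delta * (x - x0).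
  have cid : s @[s --> x0^'+] --> x0 by apply: cvg_at_right_filter; exact: cvg_id.
  by apply: cvgMl_tmp; apply: cvgB => //; exact: cvg_cst.
apply: (ler_cvg_to c1 c2).
near=> s; apply: hs; near: s; [exact: nbhs_right_gt|exact: nbhs_right_lt].
Unshelve. all: by end_near. Qed.

Lemma left_expansion f (x0 a d : R) :
  (\forall x \near x0^'-, derivable f x 1) ->
  f x @[x --> x0^'-] --> a -> derive1 f x @[x --> x0^'-] --> d ->
  forall delta, 0 < delta -> exists2 rho, 0 < rho & forall x, x0 - rho < x < x0 ->
    `|f x - a - d * (x - x0)| <= delta * (x0 - x).
Proof.
move=> df fa f'd delta delta0.
have : \forall x \near x0^'-, derivable f x 1 /\ `|derive1 f x - d| <= delta.
  move/cvgrPdist_le : f'd => /(_ _ delta0); move: df; apply: filterS2 => x ? h; split => //.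
  by rewrite distrC.
rewrite /at_left near_withinE => /nbhs_ballP[rho /= rho0 H].
exists rho => // x /andP[xrho x0x].
have hs s : x < s -> s < x0 -> `|f s - f x - d * (s - x)| <= delta * (s - x).
  move=> xs sx0; apply: mean_value_deviation => // y /andP[sy yx].
  apply: H => /=; last exact: le_lt_trans sx0.
  by rewrite /ball/= ltr_norml; apply/andP; split; lra.
have cid : s @[s --> x0^'-] --> x0 by apply: cvg_at_left_filter; exact: cvg_id.
have c1 : `|f s - f x - d * (s - x)| @[s --> x0^'-] --> `|a - f x - d * (x0 - x)|.
  apply: cvg_norm; apply: cvgB.
    by apply: cvgB => //; exact: cvg_cst.
  by apply: cvgMl_tmp; apply: cvgB => //; exact: cvg_cst.
have c2 : delta * (s - x) @[s --> x0^'-] --> delta * (x0 - x).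
  by apply: cvgMl_tmp; apply: cvgB => //; exact: cvg_cst.
have -> : f x - a - d * (x - x0) = - (a - f x - d * (x0 - x)) by ring.
rewrite normrN.
apply: (ler_cvg_to c1 c2).
near=> s; apply: hs; near: s; [exact: nbhs_left_gt|exact: nbhs_left_lt].
Unshelve. all: by end_near. Qed.

(** If [v] is exactly [c + d (x - x0)] on the segment, the integral against
[Psi''] is the difference of the boundary values of
[(c + d (x - x0)) Psi' - d Psi]; the deviation [delta] costs at most its product
with the integral of [|Psi''|]. *)
Lemma half_pairing v (Psi : R -> R) (x0 c d a b delta B : R) :
  v \in L2r -> smooth_real Psi -> a <= b -> 0 <= delta ->
  {ae mu, forall x, a <= x <= b -> `|v x - c - d * (x - x0)| <= delta} ->
  (forall x, a <= x <= b -> `|derive1 (derive1 Psi) x| <= B) ->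
  `| \int[mu]_(x in `[a, b]) (v x * derive1 (derive1 Psi) x) -
     ((c + d * (b - x0)) * derive1 Psi b - d * Psi b -
      ((c + d * (a - x0)) * derive1 Psi a - d * Psi a)) | <= delta * B * (b - a).
Proof.
move=> hv sPsi ab delta0 vl PB.
set P := derive1 (derive1 Psi) in PB *.
have sP : smooth_real P by do 2 apply: derive1_smooth.
pose l x := d * x + (c - d * x0).
have lE x : l x = c + d * (x - x0) by rewrite /l; ring.
have sl : smooth_real l by exact: (smooth_affine d (c - d * x0) smooth_id).
have B0 : 0 <= B.
  by apply: le_trans (PB a _); [exact: normr_ge0|rewrite lexx].
pose I := (\1_(`[a, b]) : R -> R).
have IE1 x : a <= x <= b -> I x = 1.
  by move=> abx; rewrite /I indicE mem_set//= in_itv.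
have IE0 x : ~ `[a, b]%classic x -> I x = 0.
  by move=> abx; rewrite /I indicE memNset.
have mI : measurable_fun setT (I : measurableTypeR R -> R) by exact: measurable_indic.
have mP : measurable_fun setT (P : measurableTypeR R -> R).
  by apply: continuous_measurable_fun; exact: smooth_continuous.
have ml : measurable_fun setT (l : measurableTypeR R -> R).
  by apply: continuous_measurable_fun; exact: smooth_continuous.
have mv := Lfun2_measurable hv.
pose Q x := P x * I x.
have [hQ QQ] : Q \in L2r /\ rip mu Q Q <= B ^+ 2 * (b - a).
  apply: (@Lfun2_bounded _ _ R mu Q `[a, b]%classic) => //.
  - exact: measurable_funM.
  - exact: mu_segment_le.
  - by move=> x /IE0; rewrite /Q => ->; rewrite mulr0.
  - by move=> x /=; rewrite in_itv/= => abx; rewrite /Q IE1// mulr1; exact: PB.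
pose D x := (v x - l x) * I x.
have [hD DD] : D \in L2r /\ rip mu D D <= delta ^+ 2 * (b - a).
  apply: (@Lfun2_ae_bounded _ _ R mu D `[a, b]%classic) => //.
  - by apply: measurable_funM => //; exact: measurable_funB.
  - exact: mu_segment_le.
  - by move=> x /IE0; rewrite /D => ->; rewrite mulr0.
  - move: vl; apply: (@filterS _ _ (ae_filter_ringOfSetsType mu)) => x + /=.
    rewrite in_itv/= => + abx => /(_ abx).
    by rewrite /D IE1// mulr1 lE opprD addrA.
have [M [M0 lM]] := continuous_bounded (`|a| + `|b|) (smooth_continuous sl).
pose L x := l x * I x.
have hL : L \in L2r.
  have [] // := @Lfun2_bounded _ _ R mu L `[a, b]%classic M (b - a).
  - exact: measurable_funM.
  - exact: mu_segment_le.
  - by move=> x /IE0; rewrite /L => ->; rewrite mulr0.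
  - move=> x /=; rewrite in_itv/= => abx; rewrite /L IE1// mulr1; apply: lM.
    have /andP[ax xb] := abx.
    have := ler_norm b; have := ler_norm (- a); rewrite normrN => h1 h2.
    by have := normr_ge0 a; have := normr_ge0 b => h3 h4; rewrite ler_norml; apply/andP; split; lra.
have iE (f : R -> R) : \int[mu]_(x in `[a, b]) (f x * P x) = rip mu f Q.
  rewrite /rip (@Rintegral_support _ _ _ mu _ `[a, b]%classic); last first.
    by move=> x /IE0; rewrite /Q => ->; rewrite !mulr0.
  apply: eq_Rintegral => x; rewrite inE /= in_itv/= => abx.
  by rewrite /Q IE1// mulr1.
have hvQ : rip mu v Q = rip mu D Q + rip mu L Q.
  rewrite -ripD// /rip; apply: eq_Rintegral => x _; rewrite /Q /D /L.
  have [abx|abx] := pselect (`[a, b]%classic x).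
    by rewrite IE1; [ring|move: abx; rewrite /= in_itv].
  by rewrite IE0//; ring.
have lQ : rip mu L Q = l b * derive1 Psi b - d * Psi b - (l a * derive1 Psi a - d * Psi a).
  have Fder x : is_derive x 1 (fun x => l x * derive1 Psi x - d * Psi x) (l x * P x).
    have dl : is_derive x 1 l d.
      have := is_deriveD (@is_deriveZ _ _ _ (fun x : R => x) d x 1 1 (is_derive_id x 1)) (@is_derive_cst _ _ _ (c - d * x0) x 1).
      by move/is_derive_eq; apply; rewrite addr0 /GRing.scale/= mulr1.
    have h1 := is_deriveM dl (smooth_is_derive x (derive1_smooth sPsi)).
    have h2 := @is_deriveZ _ _ _ Psi d x 1 _ (smooth_is_derive x sPsi).
    have := is_deriveB h1 h2; move/is_derive_eq; apply.
    by rewrite /GRing.scale/= -/P [_ * d]mulrC addrK.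
  have Fcont : continuous (fun x => l x * P x).
    by move=> x; apply: cvgM; exact: smooth_continuous.
  rewrite -(FTC ab Fder Fcont) iE /rip; apply: eq_Rintegral => x _; rewrite /L /Q.
  have [abx|abx] := pselect (`[a, b]%classic x).
    by rewrite IE1; [ring|move: abx; rewrite /= in_itv].
  by rewrite IE0//; ring.
rewrite iE hvQ lQ -!lE addrK.
have ba : 0 <= b - a by rewrite subr_ge0.
have dB : 0 <= delta * B * (b - a) by rewrite !mulr_ge0.
rewrite -(ler_pXn2r (_ : (0 < 2)%N))// ?nnegrE// real_normK ?num_real//.
apply: le_trans (rip_cauchy_schwarz hD hQ) _.
apply: le_trans (_ : _ <= (delta ^+ 2 * (b - a)) * (B ^+ 2 * (b - a))) _.
  by apply: ler_pM => //; exact: rip_ge0.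
by rewrite le_eqVlt; apply/orP; left; apply/eqP; ring.
Qed.

End OneSided.

(** * Trial functions with a jump and their smoothings *)

Section Derive1.
Context {R : realType}.
Implicit Types (f g : R -> R) (x : R).

Lemma derive1_is_derive f x (d : R) : is_derive x 1 f d -> derive1 f x = d.
Proof. by move=> h; rewrite derive1E; exact: derive_val. Qed.

Lemma derive1_comb f g (a : R) : smooth_real f -> smooth_real g ->
  derive1 (fun x => a * f x + g x) = fun x => a * derive1 f x + derive1 g x.
Proof.
move=> sf sg; apply/funext => x; apply: derive1_is_derive.
have h := @is_deriveZ _ _ _ f a x 1 _ (smooth_is_derive x sf).
exact: (is_deriveD h (smooth_is_derive x sg)).
Qed.

Lemma derive1_affine f (a b : R) : smooth_real f ->
  derive1 (fun x => f (a * x + b)) = fun x => a * derive1 f (a * x + b).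
Proof.
move=> sf; apply/funext => x; apply: derive1_is_derive.
have h1 := is_deriveD (@is_deriveZ _ _ _ (fun x : R => x) a x 1 1 (is_derive_id x 1)) (@is_derive_cst _ _ _ b x 1).
have h2 := smooth_is_derive (a * x + b) sf.
have := @is_derive1_comp _ f (fun x => a * x + b) x _ _ h2 h1.
by move/is_derive_eq; apply; rewrite addr0 /GRing.scale/= mulr1 mulrC.
Qed.

Lemma derive1_line (c x0 : R) : derive1 (fun x => c + (x - x0)) = fun=> 1.
Proof.
have -> : (fun x => c + (x - x0)) = (fun x => 1 * x + (c - x0)).
  by apply/funext => x; ring.
rewrite (derive1_comb 1 smooth_id (smooth_cst (c - x0))).
apply/funext => x; rewrite (derive1_is_derive (is_derive_id x 1)).
by rewrite (derive1_is_derive (is_derive_cst _ _ _)) addr0 mulr1.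
Qed.

Lemma derive1_cst0 (c : R) : derive1 (fun _ : R => c) = fun=> 0.
Proof. by apply/funext => x; exact: derive1_cst. Qed.

Lemma derive_scaled (k : R -> R) (c a b : R) : smooth_real k ->
  derive1 (fun x => c * k (a * x + b)) = fun x => (c * a) * derive1 k (a * x + b).
Proof.
move=> sk; have sk' : smooth_real (fun x => k (a * x + b)) by exact: smooth_affine.
have := derive1_comb c sk' (smooth_cst 0).
under [in X in X -> _]eq_fun do rewrite addr0.
move=> ->; apply/funext => x; rewrite derive1_cst0 addr0 derive1_affine//.
by rewrite mulrA.
Qed.

Lemma derive2_scaled (k : R -> R) (c a b : R) : smooth_real k ->
  derive1 (derive1 (fun x => c * k (a * x + b))) =
  fun x => (c * a * a) * derive1 (derive1 k) (a * x + b).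
Proof.
by move=> sk; rewrite derive_scaled// derive_scaled//; exact: derive1_smooth.
Qed.

Lemma open_gtx (c : R) : open [set x | c < x].
Proof. exact: open_gt. Qed.
Lemma open_ltx (c : R) : open [set x | x < c].
Proof. exact: open_lt. Qed.

Lemma open_ballx (c r : R) : open [set x | `|x - c| < r].
Proof.
have -> : [set x | `|x - c| < r] = [set x | c - r < x] `&` [set x | x < c + r].
  apply/seteqP; split => x /=.
    by rewrite ltr_norml => /andP[h1 h2]; split; lra.
  by move=> [h1 h2]; rewrite ltr_norml; apply/andP; split; lra.
by apply: openI; [exact: open_gt|exact: open_lt].
Qed.

End Derive1.
Arguments open_gtx {R} c.
Arguments open_ltx {R} c.
Arguments open_ballx {R} c r.

Section Trial.
Context {R : realType}.
Local Notation mu := (@lebesgue_measure R).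
Local Notation L2r := (Lfun mu 2%:E).
Implicit Types (f g : R -> R) (x : R).

Definition heaviside (x0 x : R) : R := if x0 < x then 1 else 0.

(** [trial] of [f''] and [g''] is the second derivative of [trial] of [f] and [g]
away from [x0], as [f] is constant near [x0] in all uses. *)
Definition trial (beta x0 : R) f g : R -> R :=
  fun x => beta * (heaviside x0 x * f x) + g x.

(** A smooth function close to [trial beta x0 f g]: the step is replaced by one
that rises on [x0 + h/2, x0 + h], and [g] is cut to 0 within [h/2] of [x0], so that
the derivative vanishes near [x0].  The arguments of the profiles are written
[a * x + b] to fit [smooth_affine]. *)
Definition smoothed (beta x0 h : R) f g : R -> R := fun x =>
  beta * (smooth_step (2 / h * x + (- (2 / h) * x0 - 1)) * f x) +
  g x * (1 + (-1) * plateau (h^-1 * x + - (h^-1 * x0))).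

Lemma heaviside_L2 x0 f : f \in L2r -> (fun x => heaviside x0 x * f x) \in L2r.
Proof.
move=> hf; apply: (Lfun2_le _ hf) => [|x].
  apply: measurable_funM; last exact: (Lfun2_measurable hf).
  have -> : heaviside x0 = \1_([set x | x0 < x]) :> (R -> R).
    apply/funext => x; rewrite /heaviside indicE; case: ifPn => x0x.
      by rewrite mem_set.
    by rewrite memNset//; apply/negP.
  apply: measurable_indic; have -> : [set x | x0 < x] = `]x0, +oo[%classic.
    by apply/seteqP; split => x /=; rewrite in_itv/= andbT.
  exact: measurable_itv.
rewrite normrM /heaviside; case: ifP => _; rewrite ?normr1 ?mul1r//.
by rewrite normr0 mul0r.
Qed.

Lemma trial_L2 beta x0 f g : f \in L2r -> g \in L2r -> trial beta x0 f g \in L2r.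
Proof. by move=> hf hg; apply: Lfun2D => //; apply: Lfun2Z; exact: heaviside_L2. Qed.

Lemma smoothed_smooth beta x0 h f g : smooth_real f -> smooth_real g ->
  smooth_real (smoothed beta x0 h f g).
Proof.
move=> sf sg; apply: smoothD; apply: smoothM => //.
- exact: smooth_cst.
- by apply: smoothM => //; apply: smooth_affine; exact: smooth_step_smooth.
apply: smoothD; first exact: smooth_cst.
by apply: smoothM; [exact: smooth_cst|apply: smooth_affine; exact: plateau_smooth].
Qed.

Lemma smoothed_test beta x0 h f g : real_test setT f -> real_test setT g ->
  real_test setT (smoothed beta x0 h f g).
Proof.
move=> [sf [K1 [cK1 _ K1f]]] [sg [K2 [cK2 _ K2g]]]; split.
  exact: smoothed_smooth.
exists (K1 `|` K2); split => //; first exact: compactU.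
by move=> x /not_orP[xK1 xK2]; rewrite /smoothed K1f// K2g// !mulr0 mul0r addr0.
Qed.

Section Shape.
Variables (beta x0 h : R) (f g : R -> R).
Hypotheses (sf : smooth_real f) (sg : smooth_real g) (h0 : 0 < h).
Local Notation Psi := (smoothed beta x0 h f g).

Let argE x : 2 / h * x + (- (2 / h) * x0 - 1) = 2 * ((x - x0) / h) - 1.
Proof. by ring. Qed.
Let argE' x : h^-1 * x + - (h^-1 * x0) = (x - x0) / h.
Proof. by ring. Qed.

Lemma smoothed_right x : x0 + h <= x -> Psi x = beta * f x + g x.
Proof.
move=> xh; rewrite /smoothed argE argE'.
have z1 : 1 <= (x - x0) / h by rewrite ler_pdivlMr// mul1r; lra.
rewrite smooth_step_ge1; last by lra.
rewrite plateau0; last by apply: le_trans z1 (ler_norm _).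
by rewrite mulr0 addr0 mulr1 mul1r.
Qed.

Lemma smoothed_left x : x <= x0 - h -> Psi x = g x.
Proof.
move=> xh; rewrite /smoothed argE argE'.
have z1 : (x - x0) / h <= -1 by rewrite ler_pdivrMr// mulN1r; lra.
rewrite smooth_step_le0; last by lra.
rewrite plateau0; last by rewrite ler0_norm; lra.
by rewrite mulr0 addr0 mulr1 mul0r mulr0 add0r.
Qed.

Lemma smoothed_center x : `|x - x0| <= h / 2 -> Psi x = 0.
Proof.
move=> xh; rewrite /smoothed argE argE'.
have z1 : `|(x - x0) / h| <= 2^-1.
  by rewrite normrM normfV (gtr0_norm h0) ler_pdivrMr// mulrC.
have /andP[z2 z3] : - 2^-1 <= (x - x0) / h <= 2^-1 by rewrite -ler_norml.
rewrite smooth_step_le0; last by lra.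
by rewrite plateau1// mulr1 subrr mulr0 mul0r mulr0 addr0.
Qed.

Lemma derive_smoothed_right x : x0 + h < x ->
  derive1 Psi x = beta * derive1 f x + derive1 g x /\
  derive1 (derive1 Psi) x = beta * derive1 (derive1 f) x + derive1 (derive1 g) x.
Proof.
have h1 y : x0 + h < y -> derive1 Psi y = beta * derive1 f y + derive1 g y.
  move=> hy; rewrite (@derive1_eq_on _ _ _ (fun x => beta * f x + g x) (open_gtx (x0 + h)))//.
    by rewrite derive1_comb.
  by move=> z /ltW; exact: smoothed_right.
move=> hx; split; first exact: h1.
rewrite (@derive1_eq_on _ _ _ _ (open_gtx (x0 + h)) h1)//.
by rewrite derive1_comb//; exact: derive1_smooth.
Qed.

Lemma derive_smoothed_left x : x < x0 - h ->
  derive1 Psi x = derive1 g x /\ derive1 (derive1 Psi) x = derive1 (derive1 g) x.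
Proof.
have h1 y : y < x0 - h -> derive1 Psi y = derive1 g y.
  move=> hy; apply: (@derive1_eq_on _ _ _ _ (open_ltx (x0 - h))) => //.
  by move=> z /ltW; exact: smoothed_left.
move=> hx; split; first exact: h1.
exact: (@derive1_eq_on _ _ _ _ (open_ltx (x0 - h)) h1).
Qed.

Lemma derive_smoothed_center x : `|x - x0| < h / 2 ->
  derive1 Psi x = 0 /\ derive1 (derive1 Psi) x = 0.
Proof.
have h1 y : `|y - x0| < h / 2 -> derive1 Psi y = 0.
  move=> hy; rewrite (@derive1_eq_on _ _ _ (fun=> 0) (open_ballx x0 (h / 2)))//.
    by rewrite derive1_cst0.
  by move=> z /ltW; exact: smoothed_center.
move=> hx; split; first exact: h1.
rewrite (@derive1_eq_on _ _ _ (fun=> 0) (open_ballx x0 (h / 2)) h1)//.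
by rewrite derive1_cst0.
Qed.

Lemma derive2_smoothed_off x : 2 * h <= `|x - x0| ->
  derive1 (derive1 Psi) x = trial beta x0 (derive1 (derive1 f)) (derive1 (derive1 g)) x.
Proof.
rewrite /trial /heaviside; case: ifPn => [x0x|].
  rewrite ger0_norm ?subr_ge0 ?(ltW x0x)// => hx.
  have hx' : x0 + h < x by move: hx h0; lra.
  by have [_ ->] := derive_smoothed_right hx'; rewrite mul1r.
rewrite -leNgt => xx0; rewrite ler0_norm ?subr_le0// => hx.
have hx' : x < x0 - h by move: hx h0; lra.
by have [_ ->] := derive_smoothed_left hx'; rewrite mul0r mulr0 add0r.
Qed.

End Shape.

Section NearPoint.
Variables (beta x0 r : R) (f g : R -> R).
Hypotheses (tf : real_test setT f) (tg : real_test setT g) (r0 : 0 < r).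
Hypothesis near_x0 : forall x, `|x - x0| <= r -> f x = 1 /\ g x = x - x0.
Local Notation Psi h := (smoothed beta x0 h f g).
Let sf : smooth_real f. Proof. by case: tf. Qed.
Let sg : smooth_real g. Proof. by case: tg. Qed.

Let near_derive x : `|x - x0| < r ->
  [/\ derive1 f x = 0, derive1 g x = 1, derive1 (derive1 f) x = 0 & derive1 (derive1 g) x = 0].
Proof.
have f1 y : `|y - x0| < r -> derive1 f y = 0.
  move=> hy; rewrite (@derive1_eq_on _ _ _ (fun=> 1) (open_ballx x0 r))//.
    by rewrite derive1_cst0.
  by move=> z /ltW/near_x0[].
have g1 y : `|y - x0| < r -> derive1 g y = 1.
  move=> hy; rewrite (@derive1_eq_on _ _ _ (fun x => 0 + (x - x0)) (open_ballx x0 r))//.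
    by rewrite derive1_line.
  by move=> z /ltW/near_x0[_ ->]; rewrite add0r.
move=> hx; split; [exact: f1|exact: g1| |].
  rewrite (@derive1_eq_on _ _ _ (fun=> 0) (open_ballx x0 r) f1)//.
  by rewrite derive1_cst0.
rewrite (@derive1_eq_on _ _ _ (fun=> 1) (open_ballx x0 r) g1)//.
by rewrite derive1_cst0.
Qed.

Lemma trial2_near x : `|x - x0| < r ->
  trial beta x0 (derive1 (derive1 f)) (derive1 (derive1 g)) x = 0.
Proof. by move=> /near_derive[_ _ f2 g2]; rewrite /trial f2 g2 !mulr0 addr0. Qed.

(** The support is in [K] minus the ball of radius [h/2] around [x0], on which the
function is 0; and [K] meets [Gamma] only at [x0]. *)
Lemma smoothed_cutoff (Gamma K : set R) h : 0 < h -> 2 * h < r -> compact K ->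
  K `&` Gamma `<=` [set x0] ->
  (forall x, ~ K x -> derive1 f x = 0 /\ derive1 g x = 0) ->
  real_test (~` Gamma) (derive1 (Psi h)).
Proof.
move=> h0 hr cK KG Kfg; split; first exact/derive1_smooth/smoothed_smooth.
pose C := [set x | `|x - x0| < h / 2].
exists (K `&` ~` C); split.
- apply: (subclosed_compact _ cK); last by move=> x [].
  apply: closedI; first exact: (compact_closed (@norm_hausdorff _ _)).
  by apply: open_closedC; exact: open_ballx.
- move=> x [Kx Cx] Gx; apply: Cx; rewrite /C/= (KG x (conj Kx Gx)).
  by rewrite subrr normr0 divr_gt0.
move=> x; have [xC _|xC] := pselect (C x).
  by have [] := @derive_smoothed_center beta x0 h f g h0 x xC.
move=> /not_andP[Kx|]; last by move/contrapT.
have [f1 g1] := Kfg x Kx.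
have xr : r <= `|x - x0|.
  rewrite leNgt; apply/negP => /near_derive[_ + _ _]; rewrite g1 => /eqP.
  by rewrite eq_sym oner_eq0.
have [xx0|xx0] := leP x0 x.
  rewrite ger0_norm ?subr_ge0// in xr.
  have [|-> _] := @derive_smoothed_right beta x0 h f g sf sg h0 x; first by lra.
  by rewrite f1 g1 mulr0 addr0.
rewrite ltr0_norm ?subr_lt0// in xr.
by have [|-> _] := @derive_smoothed_left beta x0 h f g h0 x; first by lra.
Qed.

Lemma smoothed_values h : 0 < h -> 2 * h < r ->
  [/\ Psi h x0 = 0 /\ derive1 (Psi h) x0 = 0,
   Psi h (x0 + 2 * h) = beta + 2 * h /\ derive1 (Psi h) (x0 + 2 * h) = 1 &
   Psi h (x0 - 2 * h) = - (2 * h) /\ derive1 (Psi h) (x0 - 2 * h) = 1].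
Proof.
move=> h0 hr.
have c0 : `|x0 - x0| < h / 2 by rewrite subrr normr0 divr_gt0.
have h20 : 0 < 2 * h by rewrite mulr_gt0.
have np : `|x0 + 2 * h - x0| < r by rewrite addrAC subrr add0r gtr0_norm.
have nm : `|x0 - 2 * h - x0| < r by rewrite addrAC subrr add0r normrN gtr0_norm.
have gtp : x0 + h < x0 + 2 * h by lra.
have ltm : x0 - 2 * h < x0 - h by lra.
have [f1 g1] := near_x0 (ltW np); have [f2 g2] := near_x0 (ltW nm).
have [f1' g1' _ _] := near_derive np; have [f2' g2' _ _] := near_derive nm.
have [d0 _] := @derive_smoothed_center beta x0 h f g h0 x0 c0.
have [d1 _] := @derive_smoothed_right beta x0 h f g sf sg h0 _ gtp.
have [d2 _] := @derive_smoothed_left beta x0 h f g h0 _ ltm.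
split; split=> //.
- by apply: smoothed_center => //; exact: ltW.
- by rewrite smoothed_right ?(ltW gtp)// f1 g1; ring.
- by rewrite d1 f1' g1'; ring.
- by rewrite smoothed_left ?(ltW ltm)// g2; ring.
- by rewrite d2 g2'.
Qed.

(** Near [x0] the function is [beta] times a step at scale [h] plus [h] times a
fixed profile at scale [h], so its second derivative is of order [h^-2]. *)
Lemma smoothed_bound : exists2 B, 0 <= B & forall h x, 0 < h -> h <= 1 -> 2 * h < r ->
  `|x - x0| <= 2 * h -> `|derive1 (derive1 (Psi h)) x| <= B / h ^+ 2.
Proof.
pose q (z : R) := z * (1 + (-1) * plateau z).
have sq : smooth_real q.
  apply: smoothM; first exact: smooth_id.
  apply: smoothD; first exact: smooth_cst.
  by apply: smoothM; [exact: smooth_cst|exact: plateau_smooth].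
have sq2 : smooth_real (derive1 (derive1 q)) by do 2 apply: derive1_smooth.
have ss := @smooth_step_smooth R.
have ss2 : smooth_real (derive1 (derive1 (@smooth_step R))) by do 2 apply: derive1_smooth.
(* If |x - x0| <= 2 h, the argument of the step is at most 2 * 2 + 1 in absolute
   value, and that of the profile at most 2. *)
have [C1 [C10 hC1]] := continuous_bounded 5 (smooth_continuous ss2).
have [C2 [C20 hC2]] := continuous_bounded 2 (smooth_continuous sq2).
exists (4 * `|beta| * C1 + C2); first by rewrite addr_ge0// mulr_ge0// mulr_ge0.
move=> h x h0 h1 hr xh.
have hn0 : h != 0 by rewrite gt_eqF.
pose b1 := - (2 / h) * x0 - 1; pose b2 := - (h^-1 * x0).
pose G y := beta * smooth_step (2 / h * y + b1) + h * q (h^-1 * y + b2).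
have PG y : `|y - x0| < r -> Psi h y = G y.
  move=> /ltW/near_x0[fy gy]; rewrite /smoothed fy gy /G /q -/b1 -/b2.
  have -> : h^-1 * y + b2 = (y - x0) / h by rewrite /b2; ring.
  rewrite mulr1; congr (_ + _); set pl := 1 + _.
  by field.
have xr : `|x - x0| < r by apply: le_lt_trans hr.
have sG1 : smooth_real (fun y => smooth_step (2 / h * y + b1)) by exact: smooth_affine.
have sG2 : smooth_real (fun y => q (h^-1 * y + b2)) by exact: smooth_affine.
have sG2' : smooth_real (fun y => h * q (h^-1 * y + b2)).
  by apply: smoothM => //; exact: smooth_cst.
have DG : derive1 (derive1 G) x =
    beta * ((2 / h) ^+ 2 * derive1 (derive1 smooth_step) (2 / h * x + b1)) +
    h * (h ^- 2 * derive1 (derive1 q) (h^-1 * x + b2)).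
  rewrite (derive1_comb beta sG1 sG2').
  rewrite (derive1_comb beta (derive1_smooth sG1) (derive1_smooth sG2')).
  rewrite (derive2_scaled h _ _ sq) (derive1_affine _ _ ss).
  rewrite (derive_scaled _ _ _ (derive1_smooth ss)).
  set s2 := derive1 (derive1 smooth_step) _; set q2 := derive1 (derive1 q) _.
  by field.
have -> : derive1 (derive1 (Psi h)) x = derive1 (derive1 G) x.
  apply: (@derive1_eq_on _ _ _ _ (open_ballx x0 r)) => // y hy.
  exact: (@derive1_eq_on _ _ _ _ (open_ballx x0 r)).
rewrite DG; set s2 := derive1 _ _; set q2 := derive1 _ (h^-1 * x + b2).
have z2 : `|(x - x0) / h| <= 2.
  by rewrite normrM normfV (gtr0_norm h0) ler_pdivrMr.
have hs : `|s2| <= C1.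
  apply: hC1; have -> : 2 / h * x + b1 = 2 * ((x - x0) / h) - 1 by rewrite /b1; ring.
  apply: le_trans (ler_normB _ _) _; rewrite normrM normr1 ger0_norm//.
  have -> : (5 : R) = 2 * 2 + 1 by ring.
  by rewrite lerD2r ler_wpM2l.
have hq : `|q2| <= C2.
  by apply: hC2; have -> : h^-1 * x + b2 = (x - x0) / h by rewrite /b2; ring.
apply: le_trans (ler_normD _ _) _.
rewrite ler_pdivlMr ?exprn_gt0// mulrDl; apply: lerD.
  have -> : beta * ((2 / h) ^+ 2 * s2) = 4 * beta * s2 / h ^+ 2 by field.
  rewrite normrM normfV [`|h ^+ 2|]gtr0_norm ?exprn_gt0// divfK ?expf_neq0//.
  by rewrite !normrM (ger0_norm (_ : 0 <= 4))// ler_wpM2l// mulr_ge0.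
have -> : h * (h ^- 2 * q2) = h * q2 / h ^+ 2 by field.
rewrite normrM normfV [`|h ^+ 2|]gtr0_norm ?exprn_gt0// divfK ?expf_neq0//.
rewrite normrM (gtr0_norm h0); apply: le_trans hq.
by rewrite ler_piMl.
Qed.

Lemma smoothed_error h : 0 < h -> 2 * h < r ->
  rip mu (fun x => trial beta x0 f g x - Psi h x) (fun x => trial beta x0 f g x - Psi h x)
  <= (`|beta| + r) ^+ 2 * (4 * h).
Proof.
move=> h0 hr.
have hD : (fun x => trial beta x0 f g x - Psi h x) \in L2r.
  apply: Lfun2B.
    by apply: trial_L2; [exact: (real_test_L2 tf)|exact: (real_test_L2 tg)].
  exact: (real_test_L2 (smoothed_test beta x0 h tf tg)).
have seg : x0 - 2 * h <= x0 + 2 * h by lra.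
have [] // := @Lfun2_bounded _ _ R mu (fun x => trial beta x0 f g x - Psi h x)
  `[x0 - 2 * h, x0 + 2 * h]%classic (`|beta| + r) (4 * h).
- exact: (Lfun2_measurable hD).
- apply: le_trans (mu_segment_le seg) _; rewrite lee_fin; lra.
- move=> x /=; rewrite in_itv/= => /negP; rewrite negb_and -!ltNge /trial /heaviside => /orP[xl|xr].
    have xl' : x <= x0 - h by lra.
    rewrite smoothed_left// ifF; last by apply/negbTE; rewrite -leNgt; lra.
    by rewrite mul0r mulr0 add0r subrr.
  have xr' : x0 + h <= x by lra.
  rewrite smoothed_right// ifT; last by lra.
  by rewrite mul1r subrr.
move=> x /=; rewrite in_itv/= => /andP[xl xr].
have xh : `|x - x0| < r by apply: le_lt_trans hr; rewrite ler_norml; apply/andP; split; lra.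
have [fx gx] := near_x0 (ltW xh).
rewrite /trial /smoothed fx gx !mulr1.
set s := smooth_step _; set p := plateau _.
have -> : beta * heaviside x0 x + (x - x0) - (beta * s + (x - x0) * (1 + -1 * p)) =
   beta * (heaviside x0 x - s) + (x - x0) * p by ring.
apply: le_trans (ler_normD _ _) _; rewrite (normrM beta) (normrM (x - x0)).
have /andP[s0 s1] : 0 <= s <= 1 by exact: smooth_step_01.
have /andP[p0 p1] : 0 <= p <= 1 by exact: plateau_01.
apply: lerD.
  rewrite ler_piMr// ler_norml /heaviside; case: ifP => _; apply/andP; split; lra.
by apply: le_trans (ltW xh); rewrite ler_piMr// ger0_norm.
Qed.

End NearPoint.

End Trial.

(** * Passing to the limit at the jump *)

Section Boundary.
Context {R : realType}.
Local Notation mu := (@lebesgue_measure R).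
Local Notation L2r := (Lfun mu 2%:E).
Implicit Types (x : R).

Lemma ae_neq (x0 : R) : {ae mu, forall x, x != x0}.
Proof.
exists [set x0]; split => //.
- exact: lebesgue_measure_set1.
- by move=> x /= /negP; rewrite negbK => /eqP.
Qed.

Lemma le0_of_small (X C : R) : 0 <= C ->
  (forall e, 0 < e -> e <= 1 -> X <= C * e) -> X <= 0.
Proof.
move=> C0 h; rewrite leNgt; apply/negP => X0.
have C1 : 0 < C + 1 by rewrite ltr_wpDl.
pose e := Num.min 1 (X / (2 * (C + 1))).
have e0 : 0 < e by rewrite lt_min ltr01 divr_gt0// mulr_gt0.
have e1 : e <= 1 by rewrite ge_min lexx.
have e2 : e * (2 * (C + 1)) <= X.
  by rewrite -ler_pdivlMr ?mulr_gt0// ge_min lexx orbT.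
have := h e e0 e1; have := mulr_ge0 C0 (ltW e0).
by move: X0 e2 e0; lra.
Qed.

Variables (beta x0 r : R) (f g : R -> R).
Hypotheses (tf : real_test setT f) (tg : real_test setT g) (r0 : 0 < r).
Hypothesis near_x0 : forall x, `|x - x0| <= r -> f x = 1 /\ g x = x - x0.
Local Notation Psi h := (smoothed beta x0 h f g).
Local Notation f2 := (derive1 (derive1 f)).
Local Notation g2 := (derive1 (derive1 g)).

Variables (v w : R -> R) (up um d : R).
Hypotheses (hv : v \in L2r) (hw : w \in L2r).
Hypothesis right_v : forall delta, 0 < delta -> exists2 rho, 0 < rho &
  {ae mu, forall x, x0 < x < x0 + rho -> `|v x - up - d * (x - x0)| <= delta * (x - x0)}.
Hypothesis left_v : forall delta, 0 < delta -> exists2 rho, 0 < rho &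
  {ae mu, forall x, x0 - rho < x < x0 -> `|v x - um - d * (x - x0)| <= delta * (x0 - x)}.
Hypothesis jump_v : up - um = beta * d.

Let Psi2_L2 h : derive1 (derive1 (Psi h)) \in L2r.
Proof.
exact: (real_test_L2 (real_test_derive (real_test_derive (smoothed_test beta x0 h tf tg)))).
Qed.

Let trial2_L2 : trial beta x0 f2 g2 \in L2r.
Proof.
have h1 := real_test_L2 (real_test_derive (real_test_derive tf)).
have h2 := real_test_L2 (real_test_derive (real_test_derive tg)).
exact: (trial_L2 beta x0 h1 h2).
Qed.

(* Psi_h'' agrees with the second derivative of the trial function at distance
   at least 2 h from x0, and the latter vanishes closer to x0. *)
Let segment_split h : 0 < h -> 2 * h < r ->
  rip mu v (derive1 (derive1 (Psi h))) - rip mu v (trial beta x0 f2 g2) =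
  \int[mu]_(x in `[x0 - 2 * h, x0]) (v x * derive1 (derive1 (Psi h)) x) +
  \int[mu]_(x in `[x0, x0 + 2 * h]) (v x * derive1 (derive1 (Psi h)) x).
Proof.
move=> h0 hr; set P := derive1 (derive1 (Psi h)).
have hP : P \in L2r by exact: Psi2_L2.
have [sf _] := tf; have [sg _] := tg.
have P0 : P x0 = 0.
  have c0 : `|x0 - x0| < h / 2 by rewrite subrr normr0 divr_gt0.
  by have [_] := @derive_smoothed_center R beta x0 h f g h0 x0 c0.
have vP : mu.-integrable setT (EFin \o (fun x => v x * P x)).
  exact: Lfun2_mul_integrable.
have int_seg (a b : R) : \int[mu]_(x in `[a, b]) (v x * P x) =
    \int[mu]_x (v x * P x * (\1_(`[a, b]) x : R)).
  by rewrite -/(rip mu (fun x => v x * P x) (\1_(`[a, b]) : R -> R)) rip_indic.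
have intI (a b : R) : mu.-integrable setT (EFin \o (fun x => v x * P x * (\1_(`[a, b]) x : R))).
  have mab : measurable (`[a, b]%classic : set (measurableTypeR R)) by exact: measurable_itv.
  have := @integrableS _ _ _ mu setT `[a, b]%classic (EFin \o (fun x => v x * P x)) measurableT mab (@subsetT _ _) vP.
  move/(integrable_mkcond _ mab); apply: eq_integrable => // x _.
  rewrite /= patchE indicE; case: ifPn => xab; first by rewrite mulr1.
  by rewrite mulr0.
rewrite !int_seg -RintegralD//.
rewrite ripB2//; apply: eq_Rintegral => x _.
rewrite !indicE !mem_setE !in_itv/=.
have [far|near] := leP (2 * h) `|x - x0|.
  have -> : P x = trial beta x0 f2 g2 x by exact: derive2_smoothed_off.
  have [xx0|xx0] := leP x0 x.
    rewrite ger0_norm ?subr_ge0// in far.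
    have [->|xn] := eqVneq x (x0 + 2 * h).
      have np : `|x0 + 2 * h - x0| < r.
        by rewrite addrAC subrr add0r gtr0_norm// mulr_gt0.
      by rewrite (@trial2_near R beta x0 r f g near_x0 _ np); ring.
    rewrite [x <= x0]leNgt [x <= _ + _]leNgt.
    have -> : x0 < x by move: far h0; lra.
    have -> : x0 + 2 * h < x by rewrite lt_neqAle eq_sym xn/=; move: far; lra.
    by rewrite /= !andbF !mulr0 addr0 subrr.
  rewrite ltr0_norm ?subr_lt0// in far.
  have [->|xn] := eqVneq x (x0 - 2 * h).
    have nm : `|x0 - 2 * h - x0| < r.
      by rewrite addrAC subrr add0r normrN gtr0_norm// mulr_gt0.
    by rewrite (@trial2_near R beta x0 r f g near_x0 _ nm); ring.
  have -> : (x0 - 2 * h <= x) = false.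
    by apply/negbTE; rewrite -ltNge lt_neqAle xn/=; move: far; lra.
  by rewrite /= !mulr0 addr0 subrr.
rewrite (@trial2_near R beta x0 r f g near_x0 _ (lt_trans near hr)).
move: near; rewrite ltr_norml => /andP[n1 n2].
have -> : x0 - 2 * h <= x by move: n1; lra.
have -> : x <= x0 + 2 * h by move: n2; lra.
by rewrite andbT /=; case: (ltgtP x x0) => [_|_|->]; rewrite ?P0/=; ring.
Qed.

Let pairing_algebra (D vP vT IL IR a b c : R) : vP - vT = IL + IR ->
  a - b = beta * c -> D - vP + vT = D - ((IL + b) + (IR - (a - c * beta))).
Proof. by move=> h1 h2; lra. Qed.

(** On each side of [x0] the hypothesis on [v] gives [v] up to [o(h)] within [2 h] of
[x0], while [Psi_h''] is [O(h^-2)] on a segment of length [2 h]; so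
[half_pairing] has an error [o(1)], and its boundary terms are
[up - d * beta] on the right and [- um] on the left.  Their sum is 0 by
[jump_v]. *)
Lemma boundary_identity :
  (forall h, 0 < h -> 2 * h < r ->
    rip mu w (Psi h) = - rip mu v (derive1 (derive1 (Psi h)))) ->
  rip mu w (trial beta x0 f g) = - rip mu v (trial beta x0 f2 g2).
Proof.
move=> green_h.
have [B B0 hB] := smoothed_bound beta near_x0.
pose M := `|beta| + r.
have M0 : 0 <= M by rewrite addr_ge0// ltW.
pose Nw := rip mu w w.
have Nw0 : 0 <= Nw by exact: rip_ge0.
have hT : trial beta x0 f g \in L2r.
  by apply: trial_L2; [exact: (real_test_L2 tf)|exact: (real_test_L2 tg)].
(* e controls the expansions of v and, through the choice of h, the distance in
   L2 from the trial function to its smoothing. *)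
suff : `|rip mu w (trial beta x0 f g) + rip mu v (trial beta x0 f2 g2)| <= 0.
  by rewrite normr_le0 addr_eq0 => /eqP.
apply: (@le0_of_small _ (1 + 8 * B)); first by rewrite addr_ge0// mulr_ge0.
move=> e e0 e1.
have [rho1 rho10 Hr] := right_v e0.
have [rho2 rho20 Hl] := left_v e0.
pose q := Nw * M ^+ 2 * 4.
have q0 : 0 <= q by rewrite !mulr_ge0// sqr_ge0.
pose h := Num.min (Num.min 1 (r / 3)) (Num.min (Num.min (rho1 / 3) (rho2 / 3)) (e ^+ 2 / (q + 1))).
have q1 : 0 < q + 1 by rewrite ltr_wpDl.
have h0 : 0 < h by rewrite !lt_min ltr01 !divr_gt0// exprn_gt0.
have h1 : h <= 1 by rewrite !ge_min lexx.
have hr3 : h <= r / 3 by rewrite !ge_min lexx !orbT.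
have hrho1 : h <= rho1 / 3 by rewrite !ge_min lexx !orbT.
have hrho2 : h <= rho2 / 3 by rewrite !ge_min lexx !orbT.
have hq : h * (q + 1) <= e ^+ 2 by rewrite -ler_pdivlMr// !ge_min lexx !orbT.
have hr : 2 * h < r by move: hr3 r0; lra.
have hrho1' : 2 * h < rho1 by move: hrho1 rho10; lra.
have hrho2' : 2 * h < rho2 by move: hrho2 rho20; lra.
have tPsi := smoothed_test beta x0 h tf tg.
have [sPsi _] := tPsi.
pose D x := trial beta x0 f g x - Psi h x.
have hD : D \in L2r by apply: Lfun2B => //; exact: (real_test_L2 tPsi).
have bD : `|rip mu w D| <= e.
  rewrite -(ler_pXn2r (_ : (0 < 2)%N))// ?nnegrE ?(ltW e0)// real_normK ?num_real//.
  apply: le_trans (rip_cauchy_schwarz hw hD) _.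
  apply: le_trans (_ : _ <= Nw * (M ^+ 2 * (4 * h))) _.
    by rewrite ler_wpM2l//; exact: (smoothed_error beta tf tg near_x0 h0 hr).
  apply: le_trans hq; rewrite /q.
  have := ltW h0; set X := Nw * M ^+ 2.
  have -> : Nw * (M ^+ 2 * (4 * h)) = h * (X * 4) by rewrite /X; ring.
  by move=> ?; rewrite ler_wpM2l// lerDl.
have wE : rip mu w (trial beta x0 f g) = rip mu w D + rip mu w (Psi h).
  rewrite (rip_sym mu w) (rip_sym mu w D) (rip_sym mu w (Psi h)) -ripD//.
    by congr (rip mu _ _); apply/funext => x; rewrite /D subrK.
  exact: (real_test_L2 tPsi).
have [[v1 v2] [v3 v4] [v5 v6]] := smoothed_values beta tf tg near_x0 h0 hr.
have dh0 : 0 <= e * (2 * h) by rewrite !mulr_ge0// ltW.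
have segR := @half_pairing R v (Psi h) x0 up d x0 (x0 + 2 * h) (e * (2 * h)) (B / h ^+ 2) hv sPsi.
have segL := @half_pairing R v (Psi h) x0 um d (x0 - 2 * h) x0 (e * (2 * h)) (B / h ^+ 2) hv sPsi.
have h20 : 0 <= 2 * h by rewrite mulr_ge0// ltW.
have le1 : x0 <= x0 + 2 * h by rewrite lerDl.
have le2 : x0 - 2 * h <= x0 by rewrite lerBlDr lerDl.
have {}segR := segR le1 dh0.
have {}segL := segL le2 dh0.
have len1 : x0 + 2 * h - x0 = 2 * h by ring.
have len2 : x0 - (x0 - 2 * h) = 2 * h by ring.
have len3 : x0 - 2 * h - x0 = - (2 * h) by ring.
rewrite v1 v2 v3 v4 len1 in segR.
rewrite v1 v2 v5 v6 len2 len3 in segL.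
set IR := \int[mu]_(x in `[x0, x0 + 2 * h]) _ in segR.
set IL := \int[mu]_(x in `[x0 - 2 * h, x0]) _ in segL.
have bR : `|IR - (up - d * beta)| <= 4 * e * B.
  have -> : 4 * e * B = e * (2 * h) * (B / h ^+ 2) * (2 * h).
    by field; rewrite gt_eqF.
  have -> : up - d * beta = (up + d * (2 * h)) * 1 - d * (beta + 2 * h) -
      ((up + d * (x0 - x0)) * 0 - d * 0) by ring.
  apply: segR.
    move: Hr (ae_neq x0); apply: (@filterS2 _ _ (ae_filter_ringOfSetsType mu)) => x h2 h3 /andP[xa xb].
    have xx0 : x0 < x by rewrite lt_neqAle eq_sym h3.
    have h4 : `|v x - up - d * (x - x0)| <= e * (x - x0).
      by apply: h2; rewrite xx0/=; apply: le_lt_trans xb _; rewrite ltrD2l.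
    by apply: le_trans h4 _; rewrite ler_wpM2l ?(ltW e0)// lerBlDl.
  move=> x /andP[xa xb]; apply: hB => //.
  by rewrite ger0_norm ?subr_ge0// lerBlDl.
have bL : `|IL + um| <= 4 * e * B.
  have -> : 4 * e * B = e * (2 * h) * (B / h ^+ 2) * (2 * h).
    by field; rewrite gt_eqF.
  have -> : IL + um = IL - ((um + d * (x0 - x0)) * 0 - d * 0 -
      ((um + d * - (2 * h)) * 1 - d * - (2 * h))) by ring.
  apply: segL.
    move: Hl (ae_neq x0); apply: (@filterS2 _ _ (ae_filter_ringOfSetsType mu)) => x h2 h3 /andP[xa xb].
    have xx0 : x < x0 by rewrite lt_neqAle h3.
    have h4 : `|v x - um - d * (x - x0)| <= e * (x0 - x).
      by apply: h2; rewrite xx0 andbT; apply: lt_le_trans xa; rewrite ltrD2l ltrN2.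
    by apply: le_trans h4 _; rewrite ler_wpM2l ?(ltW e0)// lerBlDl -lerBlDr.
  move=> x /andP[xa xb]; apply: hB => //.
  by rewrite ler0_norm ?subr_le0// opprB lerBlDl -lerBlDr.
have split_h := segment_split h0 hr; rewrite -/IR -/IL in split_h.
have -> : rip mu w (trial beta x0 f g) + rip mu v (trial beta x0 f2 g2) =
    rip mu w D - ((IL + um) + (IR - (up - d * beta))).
  rewrite wE (green_h h h0 hr); exact: pairing_algebra split_h jump_v.
apply: le_trans (ler_normB _ _) _.
apply: le_trans (lerD bD (le_trans (ler_normD _ _) (lerD bL bR))) _.
by rewrite le_eqVlt; apply/orP; left; apply/eqP; ring.
Qed.

End Boundary.

(** * Trial functions lie in the domain *)

Section TrialDomain.
Local Open Scope complex_scope.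
Context {R : realType}.
Local Notation mu := (@lebesgue_measure R).
Local Notation L2r := (Lfun mu 2%:E).
Implicit Types (x : R).

Variables (Gamma : set R) (A : set ((R -> R[i]) * (R -> R[i]))).
Hypotheses (Gamma_closed : closed Gamma) (Gamma_null : mu Gamma = 0%E).
Hypotheses (A_sa : self_adjoint mu A) (A_delta' : delta'_interaction Gamma A).

Lemma adjoint_pairing u v f g : A (u, v) -> f \in L2r -> g \in L2r ->
  A (emb f, emb (fun x => - g x)) ->
  rip mu (reF v) f = - rip mu (reF u) g /\ rip mu (imF v) f = - rip mu (imF u) g.
Proof.
move=> Auv hf hg; have [[AL2 _ _ _ _] _ Aadj] := A_sa.
have [Lu Lv] := AL2 _ Auv; rewrite /= in Lu Lv.
rewrite {1}Aadj => -[_ _ /(_ _ _ Auv)] /=.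
have hg' : (fun x => - g x) \in L2r by exact: Lfun2N.
rewrite inner_emb// inner_emb// => -[-> ->].
by have [Lur Lui] := Lu; rewrite !ripNr.
Qed.

Variables (beta x0 r : R) (f g : R -> R) (K : set R).
Hypotheses (tf : real_test setT f) (tg : real_test setT g) (r0 : 0 < r).
Hypothesis near_x0 : forall x, `|x - x0| <= r -> f x = 1 /\ g x = x - x0.
Hypotheses (cK : compact K) (KG : K `&` Gamma `<=` [set x0]).
Hypothesis Kfg : forall x, ~ K x -> derive1 f x = 0 /\ derive1 g x = 0.
Hypothesis A_beta : has_intensity A x0 beta.

Let expansion_right (h v : R -> R) (a d : R) : h = v %[ae mu] ->
  (\forall x \near x0^'+, derivable h x 1) ->
  h x @[x --> x0^'+] --> a -> derive1 h x @[x --> x0^'+] --> d ->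
  forall delta, 0 < delta -> exists2 rho, 0 < rho &
  {ae mu, forall x, x0 < x < x0 + rho -> `|v x - a - d * (x - x0)| <= delta * (x - x0)}.
Proof.
move=> hv dh ha hd delta delta0.
have [rho rho0 hrho] := right_expansion dh ha hd delta0.
exists rho => //; move: hv; apply: (@filterS _ _ (ae_filter_ringOfSetsType mu)) => x + xr.
by move=> /(_ I) <-; exact: hrho.
Qed.

Let expansion_left (h v : R -> R) (a d : R) : h = v %[ae mu] ->
  (\forall x \near x0^'-, derivable h x 1) ->
  h x @[x --> x0^'-] --> a -> derive1 h x @[x --> x0^'-] --> d ->
  forall delta, 0 < delta -> exists2 rho, 0 < rho &
  {ae mu, forall x, x0 - rho < x < x0 -> `|v x - a - d * (x - x0)| <= delta * (x0 - x)}.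
Proof.
move=> hv dh ha hd delta delta0.
have [rho rho0 hrho] := left_expansion dh ha hd delta0.
exists rho => //; move: hv; apply: (@filterS _ _ (ae_filter_ringOfSetsType mu)) => x + xr.
by move=> /(_ I) <-; exact: hrho.
Qed.

Local Notation f2 := (derive1 (derive1 f)).
Local Notation g2 := (derive1 (derive1 g)).

(** By self-adjointness it is enough to pair with an arbitrary [(u, v)] in [A], whose
boundary values are those of [has_intensity]; [boundary_identity] applies to
real and imaginary parts separately. *)
Lemma trial_mem : A (emb (trial beta x0 f g), emb (fun x => - trial beta x0 f2 g2 x)).
Proof.
have [[AL2 _ _ _ _] _ Aadj] := A_sa.
have hT : trial beta x0 f g \in L2r.
  by apply: trial_L2; [exact: (real_test_L2 tf)|exact: (real_test_L2 tg)].
have hT2 : trial beta x0 f2 g2 \in L2r.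
  by apply: trial_L2; [exact: (real_test_L2 (real_test_derive (real_test_derive tf)))
                      |exact: (real_test_L2 (real_test_derive (real_test_derive tg)))].
have hT2N : (fun x => - trial beta x0 f2 g2 x) \in L2r by exact: Lfun2N.
rewrite Aadj; split; try exact: L2_emb.
move=> u v Auv /=.
have [Lu Lv] := AL2 _ Auv; rewrite /= in Lu Lv.
have [Lur Lui] := Lu; have [Lvr Lvi] := Lv.
rewrite inner_emb// inner_emb//.
rewrite !ripNr//.
have Psi_pair h : 0 < h -> 2 * h < r ->
    rip mu (reF v) (smoothed beta x0 h f g) =
      - rip mu (reF u) (derive1 (derive1 (smoothed beta x0 h f g))) /\
    rip mu (imF v) (smoothed beta x0 h f g) =
      - rip mu (imF u) (derive1 (derive1 (smoothed beta x0 h f g))).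
  move=> h0 hr; have tP := smoothed_test beta x0 h tf tg.
  apply: adjoint_pairing => //; try exact: (real_test_L2 tP).
    exact: (real_test_L2 (real_test_derive (real_test_derive tP))).
  apply: (cutoff_image Gamma_closed Gamma_null A_sa A_delta' tP).
  exact: (smoothed_cutoff beta tf tg near_x0 h0 hr cK KG Kfg).
have [up [um [dp [dm [[h1 [h1u h1d h1v h1d']] [h2 [h2u h2d h2v h2d']] dpm jmp]]]]] :
  exists up um dp dm : R[i],
    [/\ boundary_values u x0^'+ up dp, boundary_values u x0^'- um dm,
        dp = dm & up - um = (beta / 2)%:C * (dp + dm)] by apply: A_beta; exists v.
have half2 (d : R) : beta / 2 * (d + d) = beta * d by field.
congr (_ +i* _).
- apply: (@boundary_identity R beta x0 r f g tf tg r0 near_x0 (reF u) (reF v)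
    (complex.Re up) (complex.Re um) (complex.Re dp)) => //.
  + apply: (@expansion_right (reF h1)).
    * by move: h1u; apply: (@filterS _ _ (ae_filter_ringOfSetsType mu)) => x + _ => /(_ I); rewrite /reF => ->.
    * by move: h1d; apply: filterS => x [].
    * by case: h1v.
    * by case: h1d'.
  + apply: (@expansion_left (reF h2)).
    * by move: h2u; apply: (@filterS _ _ (ae_filter_ringOfSetsType mu)) => x + _ => /(_ I); rewrite /reF => ->.
    * by move: h2d; apply: filterS => x [].
    * by case: h2v.
    * by rewrite dpm; case: h2d'.
  + move: jmp; rewrite -dpm; case: (up) (um) (dp) => [a b] [a' b'] [c e] /= [hj _].
    by rewrite -(half2 c) hj; ring.
  + by move=> h h0 hr; have [] := Psi_pair h h0 hr.
- apply: (@boundary_identity R beta x0 r f g tf tg r0 near_x0 (imF u) (imF v)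
    (complex.Im up) (complex.Im um) (complex.Im dp)) => //.
  + apply: (@expansion_right (imF h1)).
    * by move: h1u; apply: (@filterS _ _ (ae_filter_ringOfSetsType mu)) => x + _ => /(_ I); rewrite /imF => ->.
    * by move: h1d; apply: filterS => x [].
    * by case: h1v.
    * by case: h1d'.
  + apply: (@expansion_left (imF h2)).
    * by move: h2u; apply: (@filterS _ _ (ae_filter_ringOfSetsType mu)) => x + _ => /(_ I); rewrite /imF => ->.
    * by move: h2d; apply: filterS => x [].
    * by case: h2v.
    * by rewrite dpm; case: h2d'.
  + move: jmp; rewrite -dpm; case: (up) (um) (dp) => [a b] [a' b'] [c e] /= [_ hj].
    by rewrite -(half2 e) hj; ring.
  + by move=> h h0 hr; have [] := Psi_pair h h0 hr.
Qed.

End TrialDomain.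

(** * Cutoffs and local profiles *)

Section Concrete.
Context {R : realType}.
Local Notation mu := (@lebesgue_measure R).
Local Notation L2r := (Lfun mu 2%:E).
Implicit Types (x : R).

Lemma Rintegral_bound (h : R -> R) (a b C : R) : a <= b -> 0 <= C ->
  measurable_fun setT (h : measurableTypeR R -> R) ->
  (forall x, ~ (a <= x <= b) -> h x = 0) -> (forall x, a <= x <= b -> `|h x| <= C) ->
  `| \int[mu]_x h x | <= C * (b - a).
Proof.
move=> ab C0 mh h0 hC.
have ba : 0 <= b - a by rewrite subr_ge0.
have mS : measurable (`[a, b]%classic : set (measurableTypeR R)) by exact: measurable_itv.
have [hL hh] : h \in L2r /\ rip mu h h <= C ^+ 2 * (b - a).
  apply: (Lfun2_bounded mh mS (mu_segment_le ab)) => x /=; rewrite in_itv/=.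
    exact: h0.
  exact: hC.
pose I := (\1_(`[a, b]) : R -> R).
have mI : measurable_fun setT (I : measurableTypeR R -> R) by exact: measurable_indic.
have [hI II] : I \in L2r /\ rip mu I I <= 1 ^+ 2 * (b - a).
  apply: (Lfun2_bounded mI mS (mu_segment_le ab)) => x abx.
    by rewrite /I indicE memNset.
  by rewrite /I indicE mem_set//= normr1.
have -> : \int[mu]_x h x = rip mu h I.
  rewrite rip_indic; apply: Rintegral_support => x /=; rewrite in_itv/=; exact: h0.
rewrite -(ler_pXn2r (_ : (0 < 2)%N))// ?nnegrE ?mulr_ge0// real_normK ?num_real//.
apply: le_trans (rip_cauchy_schwarz hL hI) _.
apply: le_trans (_ : _ <= (C ^+ 2 * (b - a)) * (1 ^+ 2 * (b - a))) _.
  by apply: ler_pM => //; exact: rip_ge0.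
by rewrite le_eqVlt; apply/orP; left; apply/eqP; ring.
Qed.

(** The trivial factor and summand give it the shape [c * k (a * x + b)] of
[derive2_scaled]. *)
Definition far_cutoff (L : R) : R -> R := fun x => 1 * plateau (L^-1 * x + 0).

Definition hat (z : R) : R := z * plateau z.
(** [hat] has slope 1 at 0; dilating the argument and the value by [eps]
keeps this slope and makes the second derivative of order [eps^-1]. *)
Definition near_slope (x0 eps : R) : R -> R :=
  fun x => eps * hat (eps^-1 * x + - (eps^-1 * x0)).

Lemma hat_smooth : smooth_real hat.
Proof. by apply: smoothM; [exact: smooth_id|exact: plateau_smooth]. Qed.

Section FarCutoff.
Variable L : R.
Hypothesis L0 : 0 < L.
Local Notation eta := (far_cutoff L).

Lemma far_cutoff1 x : `|x| <= L / 2 -> eta x = 1.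
Proof.
move=> xL; rewrite /far_cutoff addr0 mul1r plateau1//.
by rewrite normrM gtr0_norm ?invr_gt0// ler_pdivrMl.
Qed.

Lemma far_cutoff0 x : L <= `|x| -> eta x = 0.
Proof.
move=> xL; rewrite /far_cutoff addr0 mul1r plateau0//.
by rewrite normrM gtr0_norm ?invr_gt0// ler_pdivlMl// mulr1.
Qed.

Lemma far_cutoff_test : real_test setT eta.
Proof.
split.
  by apply: smoothM; [exact: smooth_cst|apply: smooth_affine; exact: plateau_smooth].
exists `[- L, L]%classic; split => //; first exact: segment_compact.
move=> x /=; rewrite in_itv/= -ler_norml => /negP; rewrite -ltNge => /ltW.
exact: far_cutoff0.
Qed.

Lemma derive_far_cutoff x : `|x| < L / 2 \/ L < `|x| ->
  derive1 eta x = 0 /\ derive1 (derive1 eta) x = 0.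
Proof.
have o1 : open [set x : R | `|x| < L / 2].
  have := open_ballx 0 (L / 2); congr open.
  by apply/seteqP; split => y /=; rewrite subr0.
have o2 : open [set x : R | L < `|x|].
  have -> : [set x : R | L < `|x|] = [set x | L < x] `|` [set x | x < - L].
    apply/seteqP; split => y /=; rewrite ltr_normr.
      by move=> /orP[h|h]; [left|right]; lra.
    by move=> [h|h]; apply/orP; [left|right]; lra.
  by apply: openU; [exact: open_gtx|exact: open_ltx].
have loc (O : set R) (c : R) : open O -> (forall y, O y -> eta y = c) ->
    forall y, O y -> derive1 eta y = 0 /\ derive1 (derive1 eta) y = 0.
  move=> oO eO; have h1 y : O y -> derive1 eta y = 0.
    by move=> Oy; rewrite (@derive1_eq_on _ _ _ (fun=> c) oO eO)// derive1_cst0.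
  move=> y Oy; split; first exact: h1.
  by rewrite (@derive1_eq_on _ _ _ (fun=> 0) oO h1)// derive1_cst0.
move=> [xL|xL].
- by apply: (loc _ 1 o1) => // y /ltW; exact: far_cutoff1.
- by apply: (loc _ 0 o2) => // y /ltW; exact: far_cutoff0.
Qed.

End FarCutoff.

Lemma far_cutoff_bound : exists2 C : R, 0 <= C & forall L x, 0 < L -> `|x| <= L ->
  `|derive1 (derive1 (far_cutoff L)) x * far_cutoff L x| <= C / L ^+ 2.
Proof.
have sp := @plateau_smooth R.
have sp2 : smooth_real (derive1 (derive1 (@plateau R))) by do 2 apply: derive1_smooth.
have [C [C0 hC]] := continuous_bounded 1 (smooth_continuous sp2).
exists C => // L x L0 xL.
rewrite derive2_scaled// /far_cutoff mul1r addr0 mul1r normrM.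
have /andP[p0 p1] := plateau_01 (L^-1 * x).
have z1 : `|L^-1 * x| <= 1 by rewrite normrM gtr0_norm ?invr_gt0// ler_pdivrMl// mulr1.
rewrite (ger0_norm p0); apply: le_trans (_ : `|L^-1 * L^-1 * derive1 (derive1 plateau) (L^-1 * x)| <= _).
  by rewrite ler_piMr.
rewrite normrM -invfM -expr2 gtr0_norm ?invr_gt0 ?exprn_gt0// mulrC.
by rewrite ler_wpM2r ?invr_ge0 ?exprn_ge0 ?(ltW L0)//; exact: hC.
Qed.

Section NearSlope.
Variables (x0 eps : R).
Hypothesis eps0 : 0 < eps.
Local Notation kap := (near_slope x0 eps).

Let argE x : eps^-1 * x + - (eps^-1 * x0) = (x - x0) / eps.
Proof. by ring. Qed.

Lemma near_slopeE x : kap x = (x - x0) * plateau ((x - x0) / eps).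
Proof.
rewrite /near_slope argE /hat; set p := plateau _.
by field; rewrite gt_eqF.
Qed.

Lemma near_slope1 x : `|x - x0| <= eps / 2 -> kap x = x - x0.
Proof.
move=> h; rewrite near_slopeE plateau1 ?mulr1//.
by rewrite normrM normfV (gtr0_norm eps0) ler_pdivrMr// mulrC.
Qed.

Lemma near_slope0 x : eps <= `|x - x0| -> kap x = 0.
Proof.
move=> h; rewrite near_slopeE plateau0 ?mulr0//.
by rewrite normrM normfV (gtr0_norm eps0) ler_pdivlMr// mul1r.
Qed.

Lemma near_slope_test : real_test setT kap.
Proof.
split.
  by apply: smoothM; [exact: smooth_cst|apply: smooth_affine; exact: hat_smooth].
exists `[x0 - eps, x0 + eps]%classic; split => //; first exact: segment_compact.
move=> x /=; rewrite in_itv/= => h; apply: near_slope0.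
rewrite leNgt; apply/negP; rewrite ltr_norml => /andP[h1 h2]; apply: h.
by apply/andP; split; lra.
Qed.

Lemma derive_near_slope x : eps < `|x - x0| ->
  derive1 kap x = 0 /\ derive1 (derive1 kap) x = 0.
Proof.
have oO : open [set x : R | eps < `|x - x0|].
  have -> : [set x : R | eps < `|x - x0|] = [set x | x0 + eps < x] `|` [set x | x < x0 - eps].
    apply/seteqP; split => y /=; rewrite ltr_normr.
      by move=> /orP[h|h]; [left|right]; lra.
    by move=> [h|h]; apply/orP; [left|right]; lra.
  by apply: openU; [exact: open_gtx|exact: open_ltx].
have e0 y : eps < `|y - x0| -> kap y = 0 by move=> /ltW; exact: near_slope0.
have h1 y : eps < `|y - x0| -> derive1 kap y = 0.
  by move=> Oy; rewrite (@derive1_eq_on _ _ _ (fun=> 0) oO e0)// derive1_cst0.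
move=> hx; split; first exact: h1.
by rewrite (@derive1_eq_on _ _ _ (fun=> 0) oO h1)// derive1_cst0.
Qed.

Lemma derive_near_slope_center : derive1 kap x0 = 1.
Proof.
have e2 : 0 < eps / 2 by rewrite divr_gt0.
rewrite (@derive1_eq_on _ _ _ (fun x => 0 + (x - x0)) (open_ballx x0 (eps / 2))).
- by rewrite derive1_line.
- by move=> y /ltW /near_slope1 ->; rewrite add0r.
- by rewrite /= subrr normr0.
Qed.

(** Integration from [y] to a point beyond the support.  This is the pairing that
survives in the matrix of the form: at [y = x0] it equals -1. *)
Lemma near_slope_step (y B : R) : y <= B -> x0 + eps < B ->
  \int[mu]_x (derive1 (derive1 kap) x * heaviside y x) = - derive1 kap y.
Proof.
move=> yB xB; have [sk _] := near_slope_test.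
have sk2 : smooth_real (derive1 (derive1 kap)) by do 2 apply: derive1_smooth.
have kB z : x0 + eps < z -> derive1 kap z = 0 /\ derive1 (derive1 kap) z = 0.
  by move=> h; apply: derive_near_slope; rewrite ltr_normr; apply/orP; left; lra.
rewrite (@Rintegral_support _ _ R mu _ `]y, B]%classic); last first.
  move=> x /=; rewrite in_itv/= => /negP; rewrite negb_and -leNgt -ltNge => /orP[xy|Bx].
    by rewrite /heaviside ltNge xy mulr0.
  by have [_ ->] := kB x (lt_trans xB Bx); rewrite mul0r.
have -> : \int[mu]_(x in `]y, B]) (derive1 (derive1 kap) x * heaviside y x) =
    \int[mu]_(x in `]y, B]) derive1 (derive1 kap) x.
  apply: eq_Rintegral => x; rewrite inE /= in_itv/= => /andP[yx _].
  by rewrite /heaviside yx mulr1.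
have -> : \int[mu]_(x in `]y, B]) derive1 (derive1 kap) x =
    \int[mu]_(x in `[y, B]) derive1 (derive1 kap) x.
  apply: Rintegral_itv_obnd_cbnd.
  have h2 := real_test_L2 (real_test_derive (real_test_derive near_slope_test)).
  apply: (L2_integrable_segment h2 yB); first exact: measurable_itv.
  by move=> z /=; rewrite !in_itv/= => /andP[/ltW -> ->].
have sk1 := derive1_smooth sk.
rewrite (FTC yB (fun x => smooth_is_derive x sk1) (smooth_continuous sk2)).
by have [-> _] := kB B xB; rewrite sub0r.
Qed.

End NearSlope.

(** The factors are of order [eps^-1] and [eps]. *)
Lemma near_slope_bound : exists2 C : R, 0 <= C & forall x0 eps x, 0 < eps -> `|x - x0| <= eps ->
  `|derive1 (derive1 (near_slope x0 eps)) x * near_slope x0 eps x| <= C.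
Proof.
have sp2 : smooth_real (derive1 (derive1 hat)) by do 2 apply: derive1_smooth; exact: hat_smooth.
have [C1 [C10 hC1]] := continuous_bounded 1 (smooth_continuous sp2).
have [C2 [C20 hC2]] := continuous_bounded 1 (smooth_continuous hat_smooth).
exists (C1 * C2); first exact: mulr_ge0.
move=> x0 eps x eps0 xe.
rewrite (derive2_scaled _ _ _ hat_smooth) /near_slope.
set z := eps^-1 * x + _.
have z1 : `|z| <= 1.
  have -> : z = (x - x0) / eps by rewrite /z; ring.
  by rewrite normrM normfV (gtr0_norm eps0) ler_pdivrMr// mul1r.
have -> : eps * eps^-1 * eps^-1 * derive1 (derive1 hat) z * (eps * hat z) =
    derive1 (derive1 hat) z * hat z.
  set a := derive1 _ _; set b := hat z.
  by field; rewrite gt_eqF.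
by rewrite normrM; apply: ler_pM => //; [exact: hC1|exact: hC2].
Qed.

End Concrete.

(** * The matrix of the quadratic form *)

Section Entries.
Context {R : realType}.
Local Notation mu := (@lebesgue_measure R).
Local Notation L2r := (Lfun mu 2%:E).
Implicit Types (x : R).

Lemma rip_trial (bi bj xi xj : R) (f g f' g' : R -> R) :
  f \in L2r -> g \in L2r -> f' \in L2r -> g' \in L2r ->
  rip mu (trial bi xi f g) (trial bj xj f' g') =
  bi * bj * rip mu (fun x => heaviside xi x * f x) (fun x => heaviside xj x * f' x) +
  bi * rip mu (fun x => heaviside xi x * f x) g' +
  bj * rip mu g (fun x => heaviside xj x * f' x) + rip mu g g'.
Proof.
move=> hf hg hf' hg'.
have Jf := heaviside_L2 xi hf; have Jf' := heaviside_L2 xj hf'.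
have hT := trial_L2 bj xj hf' hg'.
have split_l b y p q k : p \in L2r -> q \in L2r -> k \in L2r ->
    rip mu (trial b y p q) k = b * rip mu (fun x => heaviside y x * p x) k + rip mu q k.
  move=> hp hq hk; have Jp := heaviside_L2 y hp.
  by rewrite -ripZ// -ripD//; exact: Lfun2Z.
have split_r k : k \in L2r -> rip mu k (trial bj xj f' g') =
    bj * rip mu k (fun x => heaviside xj x * f' x) + rip mu k g'.
  by move=> hk; rewrite (rip_sym mu k) split_l// (rip_sym mu k) (rip_sym mu k).
by rewrite split_l// (split_r _ Jf) (split_r _ hg); ring.
Qed.

Let near_in (L eps y x : R) : `|y| + eps <= L -> `|x - y| <= eps -> `|x| <= L.
Proof.
move=> yL xy; apply: le_trans yL.
have -> : x = y + (x - y) by ring.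
by apply: le_trans (ler_normD _ _) _; rewrite lerD2l.
Qed.

Let near_in_lt (L eps y x : R) : `|y| + eps <= L -> `|x - y| < eps -> `|x| < L.
Proof.
move=> yL xy; apply: lt_le_trans yL.
have -> : x = y + (x - y) by ring.
by apply: le_lt_trans (ler_normD _ _) _; rewrite ltrD2l.
Qed.

Let far_away (eps xi xj x : R) : 2 * eps <= `|xi - xj| -> `|x - xj| < eps ->
  eps < `|x - xi|.
Proof.
by have := ler_distD x xi xj; rewrite (distrC xi x) => *; lra.
Qed.

Let le_half (L eps y : R) : 0 < L -> 0 < eps -> `|y| + eps <= L / 2 ->
  y <= L /\ y + eps < L.
Proof. by have := ler_norm y => *; split; lra. Qed.

Let segment_abs (x y eps : R) : ~ (y - eps <= x <= y + eps) -> eps <= `|x - y|.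
Proof.
move=> h; rewrite leNgt; apply/negP; rewrite ltr_norml => /andP[h1 h2].
by apply: h; apply/andP; split; lra.
Qed.

Let abs_segment (x y eps : R) : y - eps <= x <= y + eps -> `|x - y| <= eps.
Proof. by move=> /andP[h1 h2]; rewrite ler_norml; apply/andP; split; lra. Qed.

(** The integrand is of order [L^-2] on an interval of length [2 L]. *)
Lemma far_entry_bound : exists2 C : R, 0 <= C & forall L xi xj : R, 0 < L ->
  `|rip mu (fun x => heaviside xi x * derive1 (derive1 (far_cutoff L)) x)
          (fun x => heaviside xj x * far_cutoff L x)| <= C / L.
Proof.
have [C1 C10 hC1] := @far_cutoff_bound R.
exists (2 * C1); first exact: mulr_ge0.
move=> L xi xj L0.
have teta := far_cutoff_test L0; set eta := far_cutoff L in teta *.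
have heta := real_test_L2 teta.
have heta2 := real_test_L2 (real_test_derive (real_test_derive teta)).
have -> : 2 * C1 / L = C1 / L ^+ 2 * (L - - L) by field; rewrite gt_eqF.
apply: Rintegral_bound.
- by rewrite -subr_ge0 opprK addr_ge0// ltW.
- by rewrite divr_ge0// exprn_ge0// ltW.
- have m1 := Lfun2_measurable (heaviside_L2 xi heta2).
  have m2 := Lfun2_measurable (heaviside_L2 xj heta).
  exact: measurable_funM.
- move=> x; rewrite -ler_norml => /negP; rewrite -ltNge => /ltW xL.
  by rewrite [eta x]far_cutoff0// !mulr0.
- move=> x; rewrite -ler_norml => xL.
  have -> : heaviside xi x * derive1 (derive1 eta) x * (heaviside xj x * eta x) =
    (heaviside xi x * heaviside xj x) * (derive1 (derive1 eta) x * eta x).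
    by set p := derive1 _ x; ring.
  rewrite normrM; apply: le_trans (hC1 L x L0 xL).
  rewrite ler_piMl// /heaviside.
  by do 2 case: ifP => _; rewrite ?mulr1 ?mulr0 ?normr1 ?normr0.
Qed.

(** Profiles at different points have disjoint supports; for a single point a
bounded integrand lives on an interval of length [2 eps]. *)
Lemma near_entry_bound : exists2 C : R, 0 <= C & forall eps xi xj : R, 0 < eps ->
  (xi != xj -> 2 * eps <= `|xi - xj|) ->
  `|rip mu (derive1 (derive1 (near_slope xi eps))) (near_slope xj eps)| <= C * eps.
Proof.
have [C2 C20 hC2] := @near_slope_bound R.
exists (2 * C2); first exact: mulr_ge0.
move=> eps xi xj eps0 xij.
have ti := near_slope_test xi eps0; have tj := near_slope_test xj eps0.
have [xe|ne] := eqVneq xi xj; last first.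
  rewrite (_ : rip _ _ _ = 0) ?normr0; last first.
    rewrite -[RHS](rip0 mu (near_slope xj eps)); apply: eq_Rintegral => x _ /=.
    rewrite mul0r; have [xe|xe] := leP eps `|x - xj|.
      by rewrite near_slope0// mulr0.
    have [_ ->] := derive_near_slope eps0 (far_away (xij ne) xe).
    by rewrite mul0r.
  by rewrite mulr_ge0 ?(ltW eps0)// mulr_ge0.
rewrite -xe.
have -> : 2 * C2 * eps = C2 * (xi + eps - (xi - eps)) by ring.
apply: Rintegral_bound => //.
- by rewrite lerBlDr -addrA lerDl addr_ge0// ltW.
- have m1 := Lfun2_measurable (real_test_L2 (real_test_derive (real_test_derive ti))).
  have m2 := Lfun2_measurable (real_test_L2 ti).
  exact: measurable_funM.
- by move=> x /segment_abs h; rewrite [near_slope xi eps x]near_slope0// mulr0.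
- by move=> x /abs_segment; exact: hC2.
Qed.

(** Of the four terms of [rip_trial], that of [eta''] with [kappa_j] vanishes
by disjointness of supports, that of [kappa_i''] with the step at [xj] is
[- kappa_i' (xj)] by [near_slope_step], and the other two are small. *)
Lemma entry_bound : exists C1 C2 : R, [/\ 0 <= C1, 0 <= C2 &
  forall (L eps bi bj xi xj : R), 0 < L -> 0 < eps ->
    `|xi| + eps <= L / 2 -> `|xj| + eps <= L / 2 ->
    (xi != xj -> 2 * eps <= `|xi - xj|) ->
  `| - rip mu (trial bi xi (derive1 (derive1 (far_cutoff L)))
                           (derive1 (derive1 (near_slope xi eps))))
        (trial bj xj (far_cutoff L) (near_slope xj eps)) - (if xi == xj then bj else 0) |
  <= `|bi * bj| * (C1 / L) + C2 * eps].
Proof.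
have [C1 C10 hC1] := far_entry_bound; have [C2 C20 hC2] := near_entry_bound.
exists C1, C2; split => // L eps bi bj xi xj L0 eps0 xiL xjL xij.
have teta := far_cutoff_test L0.
have ti := near_slope_test xi eps0; have tj := near_slope_test xj eps0.
have hE := hC1 L xi xj L0; have hF := hC2 eps xi xj eps0 xij.
set eta := far_cutoff L in teta hE *.
set ki := near_slope xi eps in ti hF *; set kj := near_slope xj eps in tj hF *.
have heta := real_test_L2 teta.
have heta2 := real_test_L2 (real_test_derive (real_test_derive teta)).
have hki2 := real_test_L2 (real_test_derive (real_test_derive ti)).
have hkj := real_test_L2 tj.
rewrite (rip_trial bi bj xi xj heta2 hki2 heta hkj).
have -> : rip mu (fun x => heaviside xi x * derive1 (derive1 eta) x) kj = 0.
  rewrite -[RHS](rip0 mu kj); apply: eq_Rintegral => x _ /=.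
  have [xe|xe] := leP eps `|x - xj|.
    by rewrite [kj x]near_slope0// !mulr0.
  have [|_ ->] := @derive_far_cutoff R L L0 x; last by rewrite mulr0.
  by left; exact: near_in_lt xjL xe.
have -> : rip mu (derive1 (derive1 ki)) (fun x => heaviside xj x * eta x) = - derive1 ki xj.
  have [B1 _] := le_half L0 eps0 xjL; have [_ B2] := le_half L0 eps0 xiL.
  rewrite -(near_slope_step eps0 B1 B2); apply: eq_Rintegral => x _ /=.
  have [xe|xe] := leP `|x - xi| eps.
    by rewrite [eta x]far_cutoff1 ?mulr1//; exact: near_in xiL xe.
  by have [_ ->] := derive_near_slope eps0 xe; rewrite !mul0r.
have -> : derive1 ki xj = if xi == xj then 1 else 0.
  case: eqVneq => [<-|ne]; first exact: derive_near_slope_center.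
  have xjj : `|xj - xj| < eps by rewrite subrr normr0.
  by have [] := derive_near_slope eps0 (far_away (xij ne) xjj).
set E := rip mu (fun x => heaviside xi x * _) _ in hE *; set F := rip mu _ kj in hF *.
have -> : - (bi * bj * E + bi * 0 + bj * - (if xi == xj then 1 else 0) + F) -
    (if xi == xj then bj else 0) = - (bi * bj * E) - F.
  by case: ifP => _; ring.
apply: le_trans (ler_normB _ _) _; rewrite normrN normrM; apply: lerD => //.
by rewrite ler_wpM2l.
Qed.

End Entries.

(** * Negative definiteness and conclusion *)

Section Quadratic.
Context {R : realType}.

(** The deviation from the diagonal form is at most [delta] times the square of the sum of the
[|u i|], hence at most [n * delta] times the sum of squares. *)
Lemma near_diagonal_form_le n (a : 'I_n -> 'I_n -> R) (beta : 'I_n -> R) (b delta : R)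
    (u : 'I_n -> R) :
  (forall i j, `|a i j - (if i == j then beta j else 0)| <= delta) ->
  (forall i, beta i <= - b) ->
  \sum_i u i * (\sum_j u j * a i j) <= - (b - n%:R * delta) * \sum_i u i ^+ 2.
Proof.
move=> ha hb.
have -> : \sum_i u i * (\sum_j u j * a i j) =
    \sum_i u i ^+ 2 * beta i +
    \sum_i \sum_j u i * u j * (a i j - (if i == j then beta j else 0)).
  rewrite -big_split/=; apply: eq_bigr => i _.
  have -> : u i ^+ 2 * beta i = \sum_j u i * u j * (if i == j then beta j else 0).
    rewrite (bigD1 i)//= eqxx big1 ?addr0 ?expr2// => j ji.
    by rewrite eq_sym (negPf ji) mulr0.
  rewrite -big_split/= mulr_sumr; apply: eq_bigr => j _.
  by rewrite -mulrDr [X in _ = _ * X]addrC subrK mulrA.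
have h1 : \sum_i u i ^+ 2 * beta i <= - b * \sum_i u i ^+ 2.
  rewrite mulr_sumr; apply: ler_sum => i _.
  by rewrite mulrC ler_wpM2r ?sqr_ge0.
have h2 : \sum_i \sum_j u i * u j * (a i j - (if i == j then beta j else 0)) <=
    n%:R * delta * \sum_i u i ^+ 2.
  apply: (@le_trans _ _ (\sum_i \sum_j delta / 2 * (u i ^+ 2 + u j ^+ 2))).
    apply: ler_sum => i _; apply: ler_sum => j _.
    set q := a i j - _; have hq : `|q| <= delta by exact: ha.
    apply: le_trans (ler_norm _) _; rewrite normrM.
    have h3 : `|u i * u j| <= (u i ^+ 2 + u j ^+ 2) / 2.
      have := sqr_ge0 (u i - u j); have := sqr_ge0 (u i + u j) => *.
      by rewrite ler_norml; apply/andP; split; lra.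
    have -> : delta / 2 * (u i ^+ 2 + u j ^+ 2) = (u i ^+ 2 + u j ^+ 2) / 2 * delta by ring.
    by apply: ler_pM.
  under eq_bigr do rewrite -mulr_sumr big_split/= sumr_const card_ord.
  rewrite -mulr_sumr big_split/= sumr_const card_ord -sumrMnl.
  rewrite le_eqVlt; apply/orP; left; apply/eqP.
  by rewrite sumrMnl -mulr_natr; field.
by apply: le_trans (lerD h1 h2) _; rewrite -mulrDl opprB addrC.
Qed.

Lemma exists_small_pos n (p : 'I_n -> R) : (forall i, 0 < p i) ->
  exists2 m, 0 < m & forall i, m <= p i.
Proof.
move=> hp; exists (\big[Num.min/1]_i p i).
  by elim/big_ind : _ => // x y x0 y0; rewrite lt_min x0.
by move=> i; exact: ge_bigmin_seq.
Qed.

Lemma exists_upper n (p : 'I_n -> R) : exists2 m, 0 <= m & forall i, `|p i| <= m.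
Proof.
exists (\sum_i `|p i|); first exact: sumr_ge0.
by move=> i; rewrite (bigD1 i)//= lerDl sumr_ge0.
Qed.

End Quadratic.

Section Final.
Local Open Scope complex_scope.
Context {R : realType}.
Local Notation mu := (@lebesgue_measure R).
Local Notation L2r := (Lfun mu 2%:E).
Implicit Types (x : R).

Lemma rip_double_sum n (u : 'I_n -> R) (p q : 'I_n -> R -> R) :
  (forall i, p i \in L2r) -> (forall i, q i \in L2r) ->
  rip mu (fun x => \sum_i u i * p i x) (fun x => \sum_j u j * q j x) =
  \sum_i u i * (\sum_j u j * rip mu (p i) (q j)).
Proof.
move=> hp hq.
have hup i : (fun x => u i * p i x) \in L2r by exact: Lfun2Z.
have huq i : (fun x => u i * q i x) \in L2r by exact: Lfun2Z.
have hsq : (fun x => \sum_j u j * q j x) \in L2r by exact: (Lfun2_sum huq).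
rewrite (rip_sum hup hsq); apply: eq_bigr => i _.
rewrite ripZ//; congr (_ * _).
rewrite rip_sym (rip_sum huq (hp i)); apply: eq_bigr => j _.
by rewrite ripZ// rip_sym.
Qed.

(** On real functions the hermitian form is the sum of the same real quadratic
form in the real parts and in the imaginary parts of the coefficients. *)
Lemma inner_real_family n (c : 'I_n -> R[i]) (p q : 'I_n -> R -> R) :
  (forall i, p i \in L2r) -> (forall i, q i \in L2r) ->
  complex.Re (inner mu (fun x => \sum_i c i * emb (p i) x)
                       (fun x => \sum_i c i * emb (q i) x)) =
  \sum_i complex.Re (c i) * (\sum_j complex.Re (c j) * rip mu (p i) (q j)) +
  \sum_i complex.Im (c i) * (\sum_j complex.Im (c j) * rip mu (p i) (q j)).
Proof.
move=> hp hq.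
have Lp : L2 mu (fun x => \sum_i c i * emb (p i) x) by apply: L2_sum => i; exact: L2_emb.
have Lq : L2 mu (fun x => \sum_i c i * emb (q i) x) by apply: L2_sum => i; exact: L2_emb.
have reS (f : 'I_n -> R -> R) : reF (fun x => \sum_i c i * emb (f i) x) =
    fun x => \sum_i complex.Re (c i) * f i x.
  apply/funext => x; rewrite /reF raddf_sum; apply: eq_bigr => i _.
  by rewrite /emb; case: (c i) => a b /=; rewrite mulr0 subr0.
have imS (f : 'I_n -> R -> R) : imF (fun x => \sum_i c i * emb (f i) x) =
    fun x => \sum_i complex.Im (c i) * f i x.
  apply/funext => x; rewrite /imF raddf_sum; apply: eq_bigr => i _.
  by rewrite /emb; case: (c i) => a b /=; rewrite mulr0 add0r.
by rewrite (innerE Lp Lq) /complex.Re !reS !imS !rip_double_sum.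
Qed.

Variables (Gamma : set R) (A : set ((R -> R[i]) * (R -> R[i]))).
Hypotheses (Gamma_closed : closed Gamma) (Gamma_bounded : bounded_set Gamma)
  (Gamma_null : mu Gamma = 0%E).
Hypotheses (A_sa : self_adjoint mu A) (A_delta' : delta'_interaction Gamma A)
  (A_discrete : negative_spectrum_discrete mu A).

Lemma isolated_radius x0 : isolated Gamma x0 ->
  Gamma x0 /\ exists2 r : R, 0 < r & forall y, Gamma y -> `|y - x0| < r -> y = x0.
Proof.
move=> [/set_mem Gx [V /nbhs_ballP[r /= r0 rV] VG]]; split => //.
exists r => // y Gy yx.
have : (V `&` Gamma) y by split => //; apply: rV; rewrite /ball/= distrC.
by rewrite VG.
Qed.

Let cutoff_outside (L eps x0 x : R) : 0 < L ->
  ~ (`[x0 - eps, x0 + eps] `|` (`[- L, - (L / 2)] `|` `[L / 2, L]))%classic x ->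
  eps < `|x - x0| /\ (`|x| < L / 2 \/ L < `|x|).
Proof.
move=> L0 /not_orP[/= h1 /not_orP[/= h2 h3]]; rewrite !in_itv/= in h1 h2 h3.
split.
  rewrite ltNge; apply/negP; rewrite ler_norml => /andP[a1 a2]; apply: h1.
  by apply/andP; split; lra.
have [hx|hx] := ltP `|x| (L / 2); first by left.
right; rewrite ltNge; apply/negP => hL.
have [x0'|x0'] := leP 0 x.
  by rewrite ger0_norm// in hx hL; apply: h3; rewrite hx.
rewrite ltr0_norm// in hx hL; apply: h2; apply/andP; split; lra.
Qed.

(** Parameters are chosen in this order: [delta] so small that
[near_diagonal_form_le] keeps a negative bound; [eps] below half the distance from
each point to the rest of [Gamma], and such that the profiles contribute at most
[delta / 2]; [L] so large that [Gamma] and the profiles are inside the plateau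
and the cutoffs contribute at most [delta / 2]. *)
Lemma count_points n (xs : 'I_n -> R) : injective xs ->
  (forall i, negative_intensity_points Gamma A (xs i)) ->
  ((n%:R)%:E <= nb_negative_eigenvalues mu A)%E.
Proof.
move=> xs_inj xsP.
have /choice[beta hbeta] i : exists b : R, has_intensity A (xs i) b /\ b < 0.
  by have [_ [b hb b0]] := xsP i; exists b.
have /choice[rad hrad] i : exists r : R, 0 < r /\ forall y, Gamma y -> `|y - xs i| < r -> y = xs i.
  by have [/isolated_radius[_ [r r0 hr]] _] := xsP i; exists r.
have Gxs i : Gamma (xs i) by have [/isolated_radius[]] := xsP i.
have beta0 i : 0 < - beta i by rewrite oppr_gt0; case: (hbeta i).
have [b b0 hb] := exists_small_pos beta0.
have [r r0 hr] := @exists_small_pos R n rad (fun i => proj1 (hrad i)).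
have [B B0 hB] := exists_upper beta.
have [M M0 hM] : exists2 M : R, 0 <= M & forall y, Gamma y -> `|y| <= M.
  have [M [_ hM]] := Gamma_bounded.
  exists (`|M| + 1); first by rewrite addr_ge0.
  by move=> y Gy; apply: (hM (`|M| + 1)) => //; rewrite ltr_pwDr// ler_norm.
have [C1 [C2 [C10 C20 hC]]] := @entry_bound R.
pose delta := b / (2 * (n%:R + 1)).
have n1 : 0 < (n%:R : R) + 1 by rewrite ltr_wpDl.
have delta0 : 0 < delta by rewrite divr_gt0// mulr_gt0.
have [eps [eps0 eps_r eps_d]] : exists eps : R, [/\ 0 < eps, 2 * eps < r & C2 * eps <= delta / 2].
  exists (Num.min (r / 4) (delta / (2 * (C2 + 1)))).
  have C21 : 0 < 2 * (C2 + 1) by rewrite mulr_gt0// ltr_wpDl.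
  set e := Num.min _ _.
  have e0 : 0 < e by rewrite lt_min !divr_gt0.
  have e1 : e <= r / 4 by rewrite ge_min lexx.
  have e2 : e * (2 * (C2 + 1)) <= delta by rewrite -ler_pdivlMr// ge_min lexx orbT.
  by split=> //; lra.
have [L [L0 L_M L_d]] : exists L : R, [/\ 0 < L, M + eps < L / 2 & B ^+ 2 * (C1 / L) <= delta / 2].
  have X0 : 0 <= 2 * B ^+ 2 * C1 / delta by rewrite divr_ge0 ?(ltW delta0)// !mulr_ge0// sqr_ge0.
  exists (2 * (M + eps) + 2 * B ^+ 2 * C1 / delta + 1).
  set L := _ + 1.
  have Lp : 0 < L by rewrite /L; move: M0 eps0 X0; lra.
  split => //; first by rewrite /L; move: X0; lra.
  rewrite mulrA ler_pdivrMr//.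
  have -> : B ^+ 2 * C1 = delta / 2 * (2 * B ^+ 2 * C1 / delta) by field; rewrite gt_eqF.
  rewrite ler_pM2l ?divr_gt0// /L; move: M0 eps0; lra.
have dist_ij i j : xs i != xs j -> 2 * eps <= `|xs i - xs j|.
  move=> ij; apply: ltW; apply: lt_le_trans eps_r _; apply: le_trans (hr j) _.
  rewrite leNgt; apply/negP => h; move/negP: ij; apply; apply/eqP.
  by have [_] := hrad j; apply.
have xsL i : `|xs i| + eps <= L / 2.
  by apply: ltW; apply: le_lt_trans L_M; rewrite lerD2r; exact: hM.
pose eta := far_cutoff L; pose kap i := near_slope (xs i) eps.
have teta : real_test setT eta by exact: far_cutoff_test.
have tkap i : real_test setT (kap i) by exact: near_slope_test.
pose psi i := trial (beta i) (xs i) eta (kap i).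
pose p i := trial (beta i) (xs i) (derive1 (derive1 eta)) (derive1 (derive1 (kap i))).
have psiL2 i : psi i \in L2r.
  exact: (trial_L2 (beta i) (xs i) (real_test_L2 teta) (real_test_L2 (tkap i))).
have pL2 i : p i \in L2r.
  have h1 := real_test_L2 (real_test_derive (real_test_derive teta)).
  have h2 := real_test_L2 (real_test_derive (real_test_derive (tkap i))).
  exact: (trial_L2 (beta i) (xs i) h1 h2).
have pNL2 i : (fun x => - p i x) \in L2r by exact: Lfun2N.
have Apsi i : A (emb (psi i), emb (fun x => - p i x)).
  (* This compact set carries the derivatives of the cutoff and of the profile,
   and meets Gamma only at xs i. *)
  pose K : set R := (`[xs i - eps, xs i + eps] `|` (`[- L, - (L / 2)] `|` `[L / 2, L]))%classic.
  have e2 : 0 < eps / 2 by rewrite divr_gt0.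
  apply: (@trial_mem R Gamma A Gamma_closed Gamma_null A_sa A_delta' (beta i) (xs i) (eps / 2) eta (kap i) K) => //.
  - move=> x hx; split; last exact: near_slope1.
    apply: far_cutoff1 => //; apply: le_trans (xsL i).
    have -> : x = xs i + (x - xs i) by ring.
    apply: le_trans (ler_normD _ _) _; rewrite lerD2l; apply: le_trans hx _.
    by rewrite ler_pdivrMr// ler_pMr// ler1n.
  - apply: compactU; first exact: segment_compact.
    by apply: compactU; exact: segment_compact.
  - move=> y [Ky Gy].
    have yL : `|y| < L / 2.
      by apply: le_lt_trans L_M; apply: le_trans (hM y Gy) _; rewrite lerDl ltW.
    have [_ ry] := hrad i.
    apply: ry => //; apply: lt_le_trans (hr i); apply: le_lt_trans eps_r.
    case: Ky => [|[]] /=; rewrite in_itv/= => /andP[h1 h2].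
    + by apply: le_trans (_ : eps <= _); [rewrite ler_distl h1 h2|rewrite ler_peMl ?ltW// ltr1n].
    + by move: yL; rewrite ltNge => /negP[]; rewrite -normrN; apply: le_trans (ler_norm _); rewrite lerNr.
    + by move: yL; rewrite ltNge => /negP[]; apply: le_trans h1 (ler_norm y).
  - move=> x /(cutoff_outside L0)[h1 h2].
    have [d1 _] := derive_far_cutoff L0 h2.
    by have [d2 _] := derive_near_slope eps0 h1.
  - by have [] := hbeta i.
apply: (negative_form_bound A_sa A_discrete Apsi) => c [k ck].
rewrite inner_real_family//.
have entries i j : `|rip mu (fun x => - p i x) (psi j) - (if i == j then beta j else 0)| <= delta.
  have -> : rip mu (fun x => - p i x) (psi j) = - rip mu (p i) (psi j).
    by rewrite rip_sym ripNr// rip_sym.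
  have := hC L eps (beta i) (beta j) (xs i) (xs j) L0 eps0 (xsL i) (xsL j) (dist_ij i j).
  rewrite (inj_eq xs_inj) => /le_trans; apply.
  have -> : delta = delta / 2 + delta / 2 by field.
  apply: lerD => //; apply: le_trans L_d; rewrite ler_wpM2r ?divr_ge0 ?(ltW L0)//.
  by rewrite normrM expr2; apply: ler_pM.
have betab i : beta i <= - b by rewrite lerNr; exact: hb.
have qre := near_diagonal_form_le (fun i => complex.Re (c i)) entries betab.
have qim := near_diagonal_form_le (fun i => complex.Im (c i)) entries betab.
apply: le_lt_trans (lerD qre qim) _; rewrite -mulrDr.
have bd : 0 < b - n%:R * delta.
  rewrite subr_gt0 /delta mulrA ltr_pdivrMr ?mulr_gt0// [n%:R * b]mulrC ltr_pM2l//.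
  by move: n1; lra.
rewrite mulNr oppr_lt0 pmulr_rgt0// -big_split/=.
rewrite (bigD1 k)//= ltr_pwDl//; last first.
  by apply: sumr_ge0 => i _; rewrite addr_ge0// sqr_ge0.
rewrite lt_def addr_ge0 ?sqr_ge0// andbT; apply/negP => /eqP h.
move/negP: ck; apply; apply/eqP.
have re0 : complex.Re (c k) ^+ 2 = 0.
  by apply/eqP; rewrite eq_le sqr_ge0 andbT -h lerDl sqr_ge0.
have im0 : complex.Im (c k) ^+ 2 = 0.
  by apply/eqP; rewrite eq_le sqr_ge0 andbT -h lerDr sqr_ge0.
move/eqP: re0; rewrite sqrf_eq0 => /eqP; move/eqP: im0; rewrite sqrf_eq0 => /eqP.
by case: (c k) => x y /= -> ->.
Qed.

End Final.

Theorem theorem1 (R : realType) (Gamma : set R)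
    (A : set ((R -> R[i]) * (R -> R[i])))
    (Gamma_closed : closed Gamma)
    (Gamma_bounded : bounded_set Gamma)
    (Gamma_null : @lebesgue_measure R Gamma = 0%E)
    (A_self_adjoint : self_adjoint (@lebesgue_measure R) A)
    (A_delta' : delta'_interaction Gamma A)
    (A_discrete : negative_spectrum_discrete (@lebesgue_measure R) A) :
  (counting (negative_intensity_points Gamma A)
   <= nb_negative_eigenvalues (@lebesgue_measure R) A)%E.
Proof.
have count := count_points Gamma_closed Gamma_bounded Gamma_null A_self_adjoint A_delta' A_discrete.
set X := negative_intensity_points Gamma A in count *.
have fin_count (s : seq R) : uniq s -> (forall y, y \in s -> X y) ->
    ((size s)%:R%:E <= nb_negative_eigenvalues (@lebesgue_measure R) A)%E.
  move=> us sX; apply: (count _ (fun i : 'I_(size s) => nth 0 s i)).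
    by move=> i j /eqP; rewrite nth_uniq// => /eqP; exact: val_inj.
  by move=> i; apply: sX; exact: mem_nth.
rewrite /counting; case: ifPn => [/asboolP finX|/asboolP infX].
  apply: fin_count => [|y]; first exact: finmap.fset_uniq.
  by rewrite in_fset_set// inE.
rewrite leye_eq; apply/eqP/eqyP => r _.
(* Infinitely many points: finite subsets of every size show that the number of
   eigenvalues exceeds every real number. *)
have [B BX hB] := infinite_set_fset (Num.truncn r).+1 infX.
apply: (le_trans _ (fin_count (finmap.enum_fset B) (finmap.fset_uniq B) BX)).
rewrite lee_fin; apply: ltW; apply: lt_le_trans (truncnS_gt r) _.
by rewrite ler_nat.
Qed.
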